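(* Let $(G,H)=(\mathrm O_n(\overline{\mathbb F}),\mathrm O_m(\overline{\mathbb F})\times\mathrm O_{n-m}(\overline{\mathbb F}))$ with $0<m<n$, $0\le r\le\lfloor n/2\rfloor$, and let $S\in\mathcal O(r_U,r_W,a,b)\subseteq\mathrm{Gr}_G(r)$, with stabilizer $H_S=\{h\in H:h(S)=S\}$. Then $$\dim\mathcal O(r_U,r_W,a,b)=\dim H-\dim H_S=\binom m2+\binom{n-m}2-\dim H_S,$$ and $\dim H_S$ equals $$\begin{aligned}&\tfrac12\left[\binom m2+\binom{n-m}2+r_U^2+r_W^2-\binom{m-2r_U-2a}2-\binom{n-m-2r_W-2a}2\right]\\&\quad+\binom b2-ab+\binom{m-2r_U-2a-b}2+\binom{n-m-2r_W-2a-b}2.\end{aligned}$$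
   Context: $\overline{\mathbb F}$ is an algebraically closed field of characteristic $\neq2$, $V\simeq\overline{\mathbb F}^n$ has a nondegenerate symmetric bilinear form $B$, $V=U\oplus W$ with $U\perp W$, $\dim U=m$, $\dim W=n-m$. $G$ is the isometry group of $V$ and $H$ the product of the isometry groups of $U$ and $W$. $\mathrm{Gr}_G(r)$ is the projective variety of $r$-dimensional subspaces $S$ of $V$ with $S\perp S$. Dimensions of groups and orbits are as algebraic varieties over $\overline{\mathbb F}$. $\binom k2=k(k-1)/2$. For a subspace $X$, $\mathrm{Rad}(X)=X\cap X^\perp$; $\mathbf P_US=(S+W)\cap U$, $\mathbf P_WS=(S+U)\cap W$. For $S\in\mathrm{Gr}_G(r)$: $r_U(S)=\dim(S\cap U)$, $r_W(S)=\dim(S\cap W)$, $a(S)=\dim\frac{\mathrm{Rad}(\mathbf P_US)}{S\cap U}=\dim\frac{\mathrm{Rad}(\mathbf P_WS)}{S\cap W}$, $b(S)=\dim\frac{\mathbf P_US}{\mathrm{Rad}(\mathbf P_US)}$. The 4-tuple $(r_U(S),r_W(S),a(S),b(S))$ determines the $H$-orbit of $S$; $\mathcal O(r_U,r_W,a,b)$ denotes the $H$-orbit with this 4-tuple. *)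

(* Defs.v *)
From mathcomp Require Import all_boot all_order all_algebra.
From mathcomp Require Import sesquilinear.
From mathcomp Require Import classical_sets.
From mathcomp Require Import mpoly.

Set Implicit Arguments.
Unset Strict Implicit.
Unset Printing Implicit Defensive.

Import GRing.Theory.
Local Open Scope ring_scope.
Local Open Scope classical_set_scope.

(* Krull dimension of a subset A of a space, the topology being given by its
   family of closed sets and A carrying the subspace topology. *)
Section KrullDimension.
Variables (T : Type) (closedT : set (set T)).

Definition rel_closed (A Z : set T) : Prop :=
  exists2 C : set T, closedT C & Z = A `&` C.

Definition irreducible_set (Z : set T) : Prop :=
  Z !=set0 /\
  forall C1 C2 : set T, closedT C1 -> closedT C2 ->
    Z `<=` C1 `|` C2 -> Z `<=` C1 \/ Z `<=` C2.

Definition irreducible_chain (A : set T) (d : nat) : Prop :=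
  exists Z : nat -> set T,
    (forall i, (i <= d)%N -> rel_closed A (Z i) /\ irreducible_set (Z i)) /\
    (forall i, (i < d)%N -> Z i `<=` Z i.+1 /\ Z i <> Z i.+1).

Definition has_dimension (A : set T) (d : nat) : Prop :=
  irreducible_chain A d /\ ~ irreducible_chain A d.+1.

End KrullDimension.

Section Zariski.
Variables (F : fieldType) (n : nat).

Definition zariski_closed_End (C : set 'End('rV[F]_n)) : Prop :=
  exists P : set {mpoly F[n * n]},
    C = [set h | forall p, P p -> p.@[fun k => mxvec (lin1_mx h) 0 k] = 0].

(* Pluecker coordinates of an r-dimensional subspace S, indexed by all maps
   'I_r -> 'I_n rather than only the increasing ones: the additional
   coordinates are 0 or, up to sign, the usual ones, so that the topology
   induced by the projective space of coordinates is the same. *)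
Definition pluecker (r : nat) (S : {vspace 'rV[F]_n}) :
    'I_#|{ffun 'I_r -> 'I_n}| -> F :=
  fun k => \det (colsub (enum_val k) (\matrix_(i < r) (vbasis S)`_i)).

Definition zariski_closed_Gr (r : nat) (C : set {vspace 'rV[F]_n}) : Prop :=
  exists2 P : set {mpoly F[#|{ffun 'I_r -> 'I_n}|]},
    (forall p, P p -> exists d : nat, p \is d.-homog) &
    C = [set S | \dim S = r /\ forall p, P p -> p.@[@pluecker r S] = 0].

End Zariski.

Section OrthogonalDecomposition.
Variables (F : fieldType) (n : nat) (B : {symmetric 'rV[F]_n}).
Variables U W : {vspace 'rV[F]_n}.

(* O(U) x O(W), embedded in GL(V) for V = U (+) W. *)
Definition groupH : set 'End('rV[F]_n) :=
  [set h | [/\ (h @: U)%VS = U, (h @: W)%VS = W,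
               {in U &, isometry B B h} & {in W &, isometry B B h}]].

Definition stabH (S : {vspace 'rV[F]_n}) : set 'End('rV[F]_n) :=
  [set h | groupH h /\ (h @: S)%VS = S].

Definition orbitH (S : {vspace 'rV[F]_n}) : set {vspace 'rV[F]_n} :=
  [set (h @: S)%VS | h in groupH].

Definition GrG (r : nat) : set {vspace 'rV[F]_n} :=
  [set S | \dim S = r /\ (S <= orthov B S)%VS].

Definition Rad (X : {vspace 'rV[F]_n}) : {vspace 'rV[F]_n} :=
  (X :&: orthov B X)%VS.

Definition PU (S : {vspace 'rV[F]_n}) : {vspace 'rV[F]_n} :=
  ((S + W) :&: U)%VS.

(* The natural number subtractions compute dimensions of quotients: Rad X is
   contained in X, and S :&: U is contained in Rad (PU S) if S is totally
   isotropic and U is orthogonal to W. *)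
Definition inv_rU (S : {vspace 'rV[F]_n}) : nat := \dim (S :&: U).
Definition inv_rW (S : {vspace 'rV[F]_n}) : nat := \dim (S :&: W).
Definition inv_a (S : {vspace 'rV[F]_n}) : nat :=
  \dim (Rad (PU S)) - \dim (S :&: U).
Definition inv_b (S : {vspace 'rV[F]_n}) : nat :=
  \dim (PU S) - \dim (Rad (PU S)).

(* O is an H-orbit in Gr_G(r) with 4-tuple (rU, rW, a, b). *)
Definition orbit_with_invariants (r rU rW a b : nat)
    (O : set {vspace 'rV[F]_n}) : Prop :=
  exists S0 : {vspace 'rV[F]_n},
    [/\ GrG r S0,
        (inv_rU S0, inv_rW S0, inv_a S0, inv_b S0) = (rU, rW, a, b) &
        O = orbitH S0].

End OrthogonalDecomposition.

Definition binom2 (x : rat) : rat := x * (x - 1) / 2%:R.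

(* Main.v *)
(* A chain of irreducible closed sets of length d yields, for every q, at least q^d
   functions of degree O(q) that are linearly independent on the top member; a set
   covered by finitely many rational images of F^N carries only O(q^N) of them. This
   bounds Krull dimensions from above, and conversely the images of a flag of linear
   subspaces under a parametrization with injective differential form a chain.
   The Cayley transform x |-> (1 - x)/(1 + x) parametrizes the isometries that
   stabilise given subspaces by the skew endomorphisms x that map each of these
   subspaces into itself, so H and H_S have the dimensions of the corresponding Lie
   algebras h and h_S, and a complement of h_S in h parametrizes the orbit near S.
   Finally dim h_S is computed in a basis of V = U + W adapted to S and to its
   orthogonal: the form (u, w) |-> B(u x, w) is skew, and the invariance of U, W and S
   means that some of its entries vanish and that some others are equal up to sign. *)

Require Import Defs.
From HB Require Import structures.
From mathcomp Require Import all_boot all_order all_algebra.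
From mathcomp Require Import sesquilinear.
From mathcomp Require Import classical_sets.
From mathcomp Require Import mpoly.
From mathcomp Require Import boolp.
From mathcomp Require Import fingroup perm.
From mathcomp Require Import zify ring.

Set Implicit Arguments.
Unset Strict Implicit.
Unset Printing Implicit Defensive.

Import GRing.Theory.
Local Open Scope ring_scope.

(** The Cayley transform misses every isometry with eigenvalue -1 and, on skew endomorphisms, takes
    only values of determinant 1, whereas the groups in question are disconnected. Upper bounds
    therefore need finitely many translated charts; a lower bound needs only the chart at the
    identity. For the orbit the obstacle is that a complement of h_S in h need not be a subalgebra
    and that the transform is not multiplicative, so the chart of h does not split into a chart of
    h_S and one of the complement. Comparison along lines through 0 replaces such a splitting: a
    nonzero polynomial has a nonzero lowest homogeneous form, which already the first-order
    behaviour of curves through 0 detects. *)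

Lemma digits_inj (N k : nat) (a b : nat -> nat) :
  (forall i, (i < N)%N -> (a i < k)%N) -> (forall i, (i < N)%N -> (b i < k)%N) ->
  (\sum_(i < N) a i * k ^ i = \sum_(i < N) b i * k ^ i)%N ->
  forall i, (i < N)%N -> a i = b i.
Proof.
elim: N a b => [//|N IH] a b ha hb.
have e (c : nat -> nat) : (\sum_(i < N.+1) c i * k ^ i =
    (\sum_(i < N) c i.+1 * k ^ i) * k + c 0)%N.
  rewrite big_ord_recl expn0 muln1 addnC big_distrl /=; congr (_ + _)%N.
  by apply: eq_bigr => i _; rewrite expnSr mulnA.
have k0 : (0 < k)%N by case: k ha {hb e IH} => // /(_ 0%N isT).
rewrite !e => h.
have h0 : a 0%N = b 0%N.
  have := congr1 (modn ^~ k) h.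
  by rewrite !modnMDl !modn_small ?ha ?hb.
have hS : (\sum_(i < N) a i.+1 * k ^ i = \sum_(i < N) b i.+1 * k ^ i)%N.
  by apply/eqP; rewrite -(eqn_pmul2r k0) -(eqn_add2r (a 0%N)) {2}h0 h.
case=> [//|i] iN.
by apply: (IH (a \o succn) (b \o succn)) hS _ _ => // j jN; [apply: ha|apply: hb].
Qed.

(** * Polynomial functions and germs of rational curves *)

Section PolynomialFunctions.
Variable F : closedFieldType.

(** A root z of [p * 'X - 1] satisfies p(z) z = 1, hence is not a root of p; that polynomial can
    only lack roots when it is constant, and then p = 0. *)
Lemma closed_poly_nonroot (p : {poly F}) : p != 0 -> exists z, p.[z] != 0.
Proof.
move=> p0; have [s1|s1] := eqVneq (size (p * 'X - 1)) 1%N.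
  exists 1; apply: contraNneq p0 => p1.
  have /size_poly1P[c c0 e] : size (p * 'X - 1) == 1%N by rewrite s1.
  have := congr1 (horner^~ 1) e; rewrite hornerD hornerM p1 mul0r add0r hornerN !hornerC => ec.
  have := congr1 (fun q => q + 1) e; rewrite subrK -ec polyCN polyC1 addNr => /eqP.
  by rewrite mulf_eq0 polyX_eq0 orbF.
have /closed_rootP[z] := s1; rewrite rootE !hornerE subr_eq0 => /eqP e.
by exists z; apply: contra_eq_neq e => ->; rewrite mul0r eq_sym oner_neq0.
Qed.


(** Exponents range over a box instead of being bounded by total degree: the number of monomials is
    then exactly k ^ N. *)
Definition boxmon N k (a : {ffun 'I_N -> 'I_k}) (t : 'I_N -> F) : F :=
  \prod_i t i ^+ a i.

Definition boxmnm N k (a : {ffun 'I_N -> 'I_k}) : 'X_{1..N} := [multinom a i | i < N].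

Lemma boxmnm_inj N k : injective (@boxmnm N k).
Proof.
move=> a b /mnmP e; apply/ffunP => i; apply: val_inj.
by have := e i; rewrite !mnmE.
Qed.

Lemma meval_box N k (p : {mpoly F[N]}) (t : 'I_N -> F) : (msize p <= k)%N ->
  p.@[t] = \sum_(a : {ffun 'I_N -> 'I_k}) p@_(boxmnm a) * boxmon a t.
Proof.
move=> pk; rewrite mevalE.
have ltk m : m \in msupp p -> forall i, (m i < k)%N.
  move=> /msize_mdeg_lt mp i; apply: leq_trans pk.
  by apply: leq_ltn_trans mp; rewrite mdegE (bigD1 i) //= leq_addr.
have -> : \sum_(m <- msupp p) p@_m * \prod_i t i ^+ m i =
   \sum_(m <- [seq boxmnm a | a : {ffun 'I_N -> 'I_k}] | m \in msupp p)
       p@_m * \prod_i t i ^+ m i.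
  rewrite -[RHS]big_filter; apply: perm_big; apply: uniq_perm => //.
    by rewrite filter_uniq // map_inj_uniq ?enum_uniq //; apply: boxmnm_inj.
  move=> m; rewrite mem_filter; case: (boolP (m \in msupp p)) => //= mp.
  apply/esym/mapP; exists [ffun i => Ordinal (ltk m mp i)]; first by rewrite mem_enum.
  by apply/mnmP => i; rewrite mnmE ffunE.
rewrite big_map big_enum_cond /= [RHS](bigID (fun a => boxmnm a \in msupp p)) /=.
rewrite [X in _ = _ + X]big1 ?addr0; last first.
  by move=> a am; rewrite memN_msupp_eq0 ?mul0r.
apply: eq_bigr => a _; congr (_ * _); apply: eq_bigr => i _.
by rewrite mnmE.
Qed.

(* Kronecker substitution [t_i = z ^ (k ^ i)] separates the monomials. *)
Lemma boxmon_free N k (c : {ffun 'I_N -> 'I_k} -> F) :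
  (forall t, \sum_a c a * boxmon a t = 0) -> forall a, c a = 0.
Proof.
move=> h a.
pose e (b : {ffun 'I_N -> 'I_k}) := (\sum_(i < N) b i * k ^ i)%N.
have einj : injective e.
  move=> b b' /= eb; apply/ffunP => i; apply: val_inj => /=.
  pose f (d : {ffun 'I_N -> 'I_k}) j : nat := if insub j is Some l then d l else 0%N.
  have fE d (j : 'I_N) : f d j = d j by rewrite /f valK.
  have flt d j : (j < N)%N -> (f d j < k)%N by move=> jN; rewrite /f insubT.
  rewrite -!fE; apply: (digits_inj (flt b) (flt b')) (ltn_ord i).
  by under eq_bigr do rewrite fE; under [RHS]eq_bigr do rewrite fE.
pose q : {poly F} := \sum_b c b *: 'X^(e b).
have q0 : q = 0.
  apply/eqP; apply: contraT => /closed_poly_nonroot[z]; case/eqP.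
  rewrite horner_sum -[RHS](h (fun i => z ^+ (k ^ i))).
  apply: eq_bigr => b _; rewrite hornerZ hornerXn; congr (_ * _).
  by rewrite /e -prodrXr; apply: eq_bigr => i _; rewrite -exprM mulnC.
have := congr1 (fun p : {poly F} => p`_(e a)) q0.
rewrite coef0 coef_sum (bigD1 a) //= coefZ coefXn eqxx mulr1 big1 ?addr0 //.
by move=> b ba; rewrite coefZ coefXn (inj_eq einj) eq_sym (negPf ba) mulr0.
Qed.

Lemma mpoly_fun_eq0 N (p : {mpoly F[N]}) : (forall t, p.@[t] = 0) -> p = 0.
Proof.
move=> h; apply/mpolyP => m; rewrite mcoeff0.
have [mp|/memN_msupp_eq0//] := boolP (m \in msupp p).
have lt i : (m i < msize p)%N.
  by apply: leq_ltn_trans (msize_mdeg_lt mp); rewrite mdegE (bigD1 i) //= leq_addr.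
have := @boxmon_free N (msize p) (fun a => p@_(boxmnm a)) _ [ffun i => Ordinal (lt i)].
have -> : boxmnm [ffun i => Ordinal (lt i)] = m by apply/mnmP => i; rewrite mnmE ffunE.
by apply=> t; rewrite -meval_box ?h.
Qed.

(* A rational function of one variable without pole at 0, [f 0] being its value:
   an identity that holds off finitely many points extends to 0 ([reg_eq0]). *)
Definition reg (f : F -> F) := exists p d : {poly F}, d.[0] != 0 /\
  forall z, d.[z] != 0 -> f z = p.[z] / d.[z].

(** Truth at all but finitely many points. The point 0 may be an exception, which permits dividing
    by z before passing to the value at 0. *)
Definition agerm (P : F -> Prop) := exists2 d : {poly F}, d != 0 &
  forall z, d.[z] != 0 -> P z.

Lemma agerm_and P Q : agerm P -> agerm Q -> agerm (fun z => P z /\ Q z).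
Proof.
move=> [d d0 hd] [e e0 he]; exists (d * e); first by rewrite mulf_neq0.
by move=> z; rewrite hornerM mulf_eq0 negb_or => /andP[/hd ? /he].
Qed.

Lemma agermW (P Q : F -> Prop) : (forall z, P z -> Q z) -> agerm P -> agerm Q.
Proof. by move=> h [d d0 hd]; exists d => // z /hd /h. Qed.

Lemma agerm_ex P : agerm P -> exists z, P z.
Proof. by move=> [d /closed_poly_nonroot[z dz] h]; exists z; apply: h. Qed.

Lemma agerm_neq0 : agerm (fun z => z != 0).
Proof. by exists 'X; rewrite ?polyX_eq0 // => z; rewrite hornerX. Qed.

Lemma eq_reg f g : f =1 g -> reg f -> reg g.
Proof. by move=> e [p [d [d0 h]]]; exists p, d; split=> // z; rewrite -e; apply: h. Qed.

Lemma reg_poly (p : {poly F}) : reg (fun z => p.[z]).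
Proof. by exists p, 1; rewrite hornerE oner_neq0; split=> // z _; rewrite hornerE divr1. Qed.

Lemma reg_cst c : reg (fun=> c).
Proof. by apply: eq_reg (reg_poly c%:P) => z; rewrite hornerC. Qed.

Lemma reg_id : reg id.
Proof. by apply: eq_reg (reg_poly 'X) => z; rewrite hornerX. Qed.

Lemma regD f g : reg f -> reg g -> reg (fun z => f z + g z).
Proof.
move=> [p [d [d0 h]]] [q [e [e0 h']]].
exists (p * e + q * d), (d * e); rewrite !hornerE mulf_neq0 //; split=> // z.
rewrite !hornerE mulf_eq0 negb_or => /andP[dz ez].
by rewrite h // h' //; field; rewrite dz ez.
Qed.

Lemma regM f g : reg f -> reg g -> reg (fun z => f z * g z).
Proof.
move=> [p [d [d0 h]]] [q [e [e0 h']]].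
exists (p * q), (d * e); rewrite !hornerE mulf_neq0 //; split=> // z.
rewrite !hornerE mulf_eq0 negb_or => /andP[dz ez].
by rewrite h // h' //; field; rewrite dz ez.
Qed.

Lemma regN f : reg f -> reg (fun z => - f z).
Proof. by move=> /(regM (reg_cst (-1))); apply: eq_reg => z; rewrite mulN1r. Qed.

Lemma regV f : reg f -> f 0 != 0 -> reg (fun z => (f z)^-1).
Proof.
move=> [p [d [d0 h]]]; rewrite h // mulf_eq0 invr_eq0 (negPf d0) orbF => p0.
(* The fraction d / p is expanded by d, so that its denominator also excludes the points where f is
   not known to equal p / d. *)
exists (d * d), (p * d); rewrite !hornerE mulf_neq0 //; split=> // z.
rewrite !hornerE mulf_eq0 negb_or => /andP[pz dz].
by rewrite h //; field; rewrite dz pz.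
Qed.

Lemma reg_sum (I : finType) (P : pred I) (f : I -> F -> F) : (forall i, reg (f i)) ->
  reg (fun z => \sum_(i | P i) f i z).
Proof.
move=> h; rewrite -[index_enum I]/(index_enum I); elim: (index_enum I) => [|i s IH].
  by apply: eq_reg (reg_cst 0) => z; rewrite big_nil.
case: (boolP (P i)) => Pi; last by apply: eq_reg IH => z; rewrite big_cons (negPf Pi).
by apply: eq_reg (regD (h i) IH) => z; rewrite big_cons Pi.
Qed.

Lemma reg_prod (I : finType) (P : pred I) (f : I -> F -> F) : (forall i, reg (f i)) ->
  reg (fun z => \prod_(i | P i) f i z).
Proof.
move=> h; elim: (index_enum I) => [|i s IH].
  by apply: eq_reg (reg_cst 1) => z; rewrite big_nil.
case: (boolP (P i)) => Pi; last by apply: eq_reg IH => z; rewrite big_cons (negPf Pi).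
by apply: eq_reg (regM (h i) IH) => z; rewrite big_cons Pi.
Qed.

Lemma regX f k : reg f -> reg (fun z => f z ^+ k).
Proof.
move=> h; elim: k => [|k IH]; first exact: reg_cst.
by apply: eq_reg (regM h IH) => z; rewrite exprS.
Qed.

Lemma reg_neq0 f : reg f -> f 0 != 0 -> agerm (fun z => f z != 0).
Proof.
move=> [p [d [d0 h]]]; rewrite h // mulf_eq0 invr_eq0 (negPf d0) orbF => p0.
exists (p * d).
  apply/eqP => /(congr1 (horner^~ 0)); rewrite !hornerE => /eqP.
  by rewrite mulf_eq0 (negPf d0) (negPf p0).
move=> z; rewrite hornerM mulf_eq0 negb_or => /andP[pz dz].
by rewrite h // mulf_neq0 ?invr_neq0.
Qed.

Lemma reg_eq0 f : reg f -> agerm (fun z => f z = 0) -> f 0 = 0.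
Proof.
move=> rf h; apply/eqP; apply: contraT => /(reg_neq0 rf) h'.
by have [z [-> /eqP]] := agerm_ex (agerm_and h h').
Qed.

(* Dividing [p (z * w z)] by the lowest power of [z] and letting [z] tend to 0
   leaves the lowest homogeneous form of [p] at [v]. *)
Lemma dominant_eq0 N (p : {mpoly F[N]}) :
  (forall v : 'I_N -> F, exists w : F -> 'I_N -> F,
     [/\ forall i, reg (w ^~ i), w 0 =1 v &
         agerm (fun z => p.@[fun i => z * w z i] = 0)]) -> p = 0.
Proof.
move=> h; apply/eqP; apply: contraT => p0.
have hm : exists k, has (fun m => mdeg m == k) (msupp p).
  by exists (mdeg (mlead p)); apply/hasP; exists (mlead p); rewrite ?mlead_supp.
pose e := ex_minn hm.
have emin m : m \in msupp p -> (e <= mdeg m)%N.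
  move=> mp; rewrite /e; case: ex_minnP => k _ -> //.
  by apply/hasP; exists m.
pose q := pihomog [measure of mdeg] e p.
have qE (t : 'I_N -> F) : q.@[t] =
    \sum_(m <- msupp p) (mdeg m == e)%:R * (p@_m * \prod_i t i ^+ m i).
  rewrite /q pihomogE raddf_sum /= big_mkcond /=.
  by apply: eq_bigr => m _; case: eqP; rewrite ?mul0r // mul1r mevalZ mevalX.
have q0 : q = 0.
  apply: mpoly_fun_eq0 => v; have [w [rw w0 hw]] := h v.
  pose f z := \sum_(m <- msupp p) z ^+ (mdeg m - e) * (p@_m * \prod_i w z i ^+ m i).
  have rf : reg f.
    rewrite /f; elim: (msupp p) => [|m s IH].
      by apply: eq_reg (reg_cst 0) => z; rewrite big_nil.
    apply: eq_reg (regD _ IH); first by move=> z; rewrite big_cons.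
    apply: regM; first exact/regX/reg_id.
    apply: regM; first exact: reg_cst.
    by apply: reg_prod => i; apply: regX.
  have f0 : f 0 = 0.
    apply: reg_eq0 => //; apply: agermW (agerm_and hw agerm_neq0) => z [hz z0].
    apply: (mulfI (expf_neq0 e z0)); rewrite mulr0 -[RHS]hz mevalE big_distrr /=.
    apply: eq_big_seq => m mp; rewrite mulrA -exprD subnKC ?emin // mulrCA.
    congr (_ * _); under [RHS]eq_bigr do rewrite exprMn.
    by rewrite big_split /= prodrXr -mdegE.
  rewrite qE -[RHS]f0 /f; apply: eq_big_seq => m mp.
  rewrite expr0n subn_eq0 [(mdeg m <= e)%N](_ : _ = (mdeg m == e)).
    by do 2!congr (_ * _); apply: eq_bigr => i _; rewrite w0.
  by rewrite eqn_leq emin ?andbT.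
have [m mp /eqP mk] : exists2 m, m \in msupp p & mdeg m == e.
  by apply/hasP; rewrite /e; case: ex_minnP.
have := congr1 (mcoeff m) q0; rewrite mcoeff0 /q pihomogE raddf_sum /= big_mkcond.
rewrite (bigD1_seq m) ?msupp_uniq //= mk eqxx mcoeffZ mcoeffX eqxx mulr1.
rewrite big1_seq ?addr0.
  by move/eqP; rewrite -[_ == 0]negbK -mcoeff_msupp mp.
move=> i /andP[im _]; case: eqP => // _.
by rewrite mcoeffZ mcoeffX (negPf im) mulr0.
Qed.

End PolynomialFunctions.

(** * Degrees under substitution, and linear dependence by counting *)

Section Degree.
Variable F : closedFieldType.

Definition deg_le N e (p : {mpoly F[N]}) := (msize p <= e.+1)%N.

Lemma deg_leW N e e' (p : {mpoly F[N]}) : (e <= e')%N -> deg_le e p -> deg_le e' p.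
Proof. by move=> ee /leq_trans; apply; rewrite ltnS. Qed.

Lemma deg_leM N a b (p q : {mpoly F[N]}) :
  deg_le a p -> deg_le b q -> deg_le (a + b) (p * q).
Proof.
rewrite /deg_le => ha hb.
have [->|p0] := eqVneq p 0; first by rewrite mul0r msize0.
have [->|q0] := eqVneq q 0; first by rewrite mulr0 msize0.
rewrite msizeM //; have := leq_add ha hb; rewrite addSn addnS.
by case: (msize p + msize q)%N => // n; rewrite ltnS.
Qed.

Lemma deg_leC N c : deg_le 0 (c%:MP : {mpoly F[N]}).
Proof. by rewrite /deg_le msizeC; case: (c != 0). Qed.

Lemma deg_le1 N : deg_le 0 (1 : {mpoly F[N]}).
Proof. exact: deg_leC. Qed.

Lemma deg_leX N e k (p : {mpoly F[N]}) : deg_le e p -> deg_le (e * k) (p ^+ k).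
Proof.
move=> h; elim: k => [|k IH]; first by rewrite muln0 deg_le1.
by rewrite exprS mulnS deg_leM.
Qed.

Lemma deg_le_sum N e (I : Type) (s : seq I) (P : pred I) (p : I -> {mpoly F[N]}) :
  (forall i, P i -> deg_le e (p i)) -> deg_le e (\sum_(i <- s | P i) p i).
Proof.
move=> h; elim/big_rec: _ => [|i q Pi hq]; first by rewrite /deg_le msize0.
by rewrite /deg_le; apply: leq_trans (msizeD_le _ _) _; rewrite geq_max; apply/andP; split; [apply: h|].
Qed.

Lemma deg_leZ N e c (p : {mpoly F[N]}) : deg_le e p -> deg_le e (c *: p).
Proof. exact/leq_trans/msizeZ_le. Qed.

Lemma deg_le_mon N D e (m : 'X_{1..D}) (p : 'I_D -> {mpoly F[N]}) :
  (forall i, deg_le e (p i)) -> deg_le (e * mdeg m) (\prod_i p i ^+ m i).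
Proof.
move=> h; rewrite mdegE big_distrr /=.
elim/big_rec2: _ => [|i q d _ hq]; first exact: deg_le1.
by apply: deg_leM => //; apply: deg_leX.
Qed.

Lemma meval_homog_subst N D e k (p : {mpoly F[D]}) (q : 'I_D -> {mpoly F[N]}) :
  p \is k.-homog -> (forall i, deg_le e (q i)) ->
  exists2 P, deg_le (e * k) P &
    forall t a, p.@[fun i => a * (q i).@[t]] = a ^+ k * P.@[t].
Proof.
move=> /dhomogP hp hq.
(* The default 0 concerns no monomial of [p]; it gives the degree bound for every [m] at once. *)
exists (\sum_(m <- msupp p) p@_m *: (if mdeg m == k then \prod_i q i ^+ m i else 0)).
  apply: deg_le_sum => m _; apply: deg_leZ; case: eqP => [<-|_].
    exact: deg_le_mon.
  by rewrite /deg_le msize0.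
move=> t a; rewrite mevalE raddf_sum big_distrr /=.
apply: eq_big_seq => m mp; rewrite mevalZ mulrCA; congr (_ * _).
rewrite -(hp m mp) /= eqxx rmorph_prod /= mdegE -prodrXr -big_split /=.
by apply: eq_bigr => i _; rewrite exprMn rmorphXn.
Qed.

(** Here [a] is the inverse of a common denominator [d]: monomials of degree below k are padded with
    powers of [d], so that a single factor a ^ k comes out of all of them. *)
Lemma meval_subst N D e k (p : {mpoly F[D]}) (q : 'I_D -> {mpoly F[N]}) d :
  deg_le k p -> (forall i, deg_le e (q i)) -> deg_le e d ->
  exists2 P, deg_le (e * k) P &
    forall t a, a * d.@[t] = 1 -> p.@[fun i => a * (q i).@[t]] = a ^+ k * P.@[t].
Proof.
move=> hp hq hd.
exists (\sum_(m <- msupp p) p@_m *: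
   (if (mdeg m <= k)%N then d ^+ (k - mdeg m) * \prod_i q i ^+ m i else 0)).
  apply: deg_le_sum => m _; apply: deg_leZ; case: leqP => [mk|_].
    rewrite -[X in (e * X)%N](subnK mk) mulnDr; apply: deg_leM; first exact: deg_leX.
    exact: deg_le_mon.
  by rewrite /deg_le msize0.
move=> t a ad; rewrite mevalE raddf_sum big_distrr /=.
apply: eq_big_seq => m mp; rewrite mevalZ mulrCA; congr (_ * _).
have mk : (mdeg m <= k)%N by rewrite -ltnS; apply: leq_trans (msize_mdeg_lt mp) hp.
rewrite mk -[in a ^+ k](subnK mk) exprD mevalM rmorphXn /= mulrACA -exprMn ad expr1n.
rewrite mul1r rmorph_prod /= mdegE -prodrXr -big_split /=.
by apply: eq_bigr => i _; rewrite exprMn rmorphXn.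
Qed.

Lemma linear_dependence (J I : finType) (M : J -> I -> F) : (#|I| < #|J|)%N ->
  exists2 c : J -> F, exists j, c j != 0 & forall i, \sum_j c j * M j i = 0.
Proof.
move=> h; pose A := \matrix_(j < #|J|, i < #|I|) M (enum_val j) (enum_val i).
have : kermx A != 0.
  rewrite -mxrank_eq0 mxrank_ker subn_eq0 -ltnNge.
  exact: leq_ltn_trans (rank_leq_col _) h.
case/rowV0Pn => v /sub_kermxP vA v0.
have [j0 hj0] : exists j, v 0 j != 0.
  by apply/existsP; apply: contraNT v0 => /existsPn h0; apply/eqP/rowP => j;
     rewrite mxE; apply/eqP; have := h0 j; rewrite negbK.
exists (fun j => v 0 (enum_rank j)).
  by exists (enum_val j0); rewrite enum_valK.
move=> i; have := congr1 (fun B : 'rV_#|I| => B 0 (enum_rank i)) vA.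
rewrite !mxE => e; rewrite -[RHS]e (reindex (fun j : 'I_#|J| => enum_val j)) /=; last exact/onW_bij/enum_val_bij.
by apply: eq_bigr => j _; rewrite mxE !enum_valK enum_rankK.
Qed.

End Degree.

(** * Krull dimension by counting functions *)

Section GradedTopology.
Variables (F : closedFieldType) (T : Type) (closedT : set (set T)).

(* [Phi k] plays the role of the polynomials of degree at most [k] on an affine
   space, and of the homogeneous polynomials of degree [k] in projective
   coordinates that are normalised in some arbitrary way. *)
Record graded_topology (T0 : set T) (Phi : nat -> (T -> F) -> Prop) : Prop := {
  gt_closed : forall C, closedT C <-> exists2 P : set (T -> F),
      forall f, P f -> exists k, Phi k f &
      C = [set t | T0 t /\ forall f, P f -> f t = 0]%classic;
  gt_zero : forall k, Phi k (fun=> 0);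
  gt_lin : forall k a f g, Phi k f -> Phi k g -> Phi k (fun t => a * f t + g t);
  gt_one : Phi 0%N (fun=> 1);
  gt_mul : forall k l f g, Phi k f -> Phi l g -> Phi (k + l)%N (fun t => f t * g t);
  gt_nonzero : forall t, T0 t -> exists2 f, Phi 1%N f & f t != 0 }.

Variables (T0 : set T) (Phi : nat -> (T -> F) -> Prop).
Hypothesis gt : graded_topology T0 Phi.

Lemma gt_sum k (J : finType) (c : J -> F) (g : J -> T -> F) :
  (forall j, Phi k (g j)) -> Phi k (fun t => \sum_j c j * g j t).
Proof.
move=> h; elim: (index_enum J) => [|j s IH].
  by under eq_fun do rewrite big_nil; apply: gt_zero gt _.
by under eq_fun do rewrite big_cons; apply: gt_lin gt _ _ _ _ _ IH.
Qed.

Lemma gt_scale k a f : Phi k f -> Phi k (fun t => a * f t).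
Proof.
move=> h; have := gt_lin gt a h (gt_zero gt k).
by under eq_fun do rewrite addr0.
Qed.

Lemma gt_exp k l f : Phi k f -> Phi (k * l)%N (fun t => f t ^+ l).
Proof.
move=> h; elim: l => [|l IH]; first by rewrite muln0; under eq_fun do rewrite expr0; apply: gt_one gt.
by rewrite mulnS; under eq_fun do rewrite exprS; apply: gt_mul gt _ _ _ _ h IH.
Qed.

Lemma zeroset_closed k f : Phi k f -> closedT [set t | T0 t /\ f t = 0]%classic.
Proof.
move=> h; apply/(gt_closed gt); exists [set f]%classic; first by move=> _ ->; exists k.
by apply/seteqP; split=> t [tT ft]; split=> //; [move=> _ ->|apply: ft].
Qed.

Lemma irreducible_mul Z k l f g : irreducible_set closedT Z -> (Z `<=` T0)%classic ->
  Phi k f -> Phi l g -> (forall t, Z t -> f t * g t = 0) ->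
  (forall t, Z t -> f t = 0) \/ (forall t, Z t -> g t = 0).
Proof.
move=> [_ hZ] ZT hf hg h.
have [|H|H] := hZ _ _ (zeroset_closed hf) (zeroset_closed hg).
- move=> t Zt; have /eqP := h t Zt; rewrite mulf_eq0 => /orP[]/eqP e; [left|right];
    by split=> //; apply: ZT.
- by left=> t /H [].
- by right=> t /H [].
Qed.

Definition indep_on (A : set T) (J : finType) (g : J -> T -> F) :=
  forall c : J -> F, (forall t, A t -> \sum_j c j * g j t = 0) -> forall j, c j = 0.

(* If [f] vanishes on [Z] but not on the irreducible [Z'], the powers of [f] are
   independent over the functions that are independent on [Z]; the powers of [f0]
   only serve to equalise the degrees. *)
Lemma indep_step Z Z' k f f0 K (J : finType) (g : J -> T -> F) q :
  irreducible_set closedT Z -> irreducible_set closedT Z' ->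
  (Z `<=` Z')%classic -> (Z' `<=` T0)%classic ->
  Phi k f -> (forall t, Z t -> f t = 0) -> (exists2 t, Z' t & f t != 0) ->
  Phi 1%N f0 -> (exists2 t, Z t & f0 t != 0) ->
  (forall j, Phi K (g j)) -> indep_on Z g ->
  indep_on Z' (fun (a : J * 'I_q) t =>
     g a.1 t * (f t ^+ a.2 * f0 t ^+ (k * (q - a.2)))).
Proof.
move=> iZ iZ' ZZ' ZT hf fZ [t1 Z't1 ft1] hf0 [t2 Zt2 ft2] hg gind c hc.
(* Once the coefficients with exponent below m vanish, the relation is divisible by f ^ m.
   Irreducibility of Z' cancels this factor, and on Z, where f is 0, only the terms with exponent
   exactly m survive. *)
have key m : (m < q)%N -> (forall a : J * 'I_q, (a.2 < m)%N -> c a = 0) ->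
   forall a : J * 'I_q, a.2 = m :> nat -> c a = 0.
  move=> mq hm.
  (* The functions are cut off together with the coefficients: for exponents below m, the truncated
     [a.2 - m] would give a term of the wrong degree. *)
  pose Hc (a : J * 'I_q) := if (m <= a.2)%N then c a else 0.
  pose Hg (a : J * 'I_q) t := if (m <= a.2)%N then
       g a.1 t * (f t ^+ (a.2 - m) * f0 t ^+ (k * (q - a.2))) else 0.
  pose H t := \sum_a Hc a * Hg a t.
  have PhiH : Phi (K + k * (q - m))%N H.
    apply: gt_sum => -[j l]; rewrite /Hg /=; case: leqP => [ml|_]; last exact: gt_zero gt _.
    apply: gt_mul gt _ _ _ _ (hg j) _.
    have -> : (k * (q - m) = k * (l - m) + 1 * (k * (q - l)))%N.
      by rewrite mul1n -mulnDr; congr (_ * _)%N; have := ltn_ord l; lia.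
    by apply: gt_mul gt _ _ _ _ _ _; apply: gt_exp.
  have H0 t : Z' t -> H t = 0.
    have : forall t, Z' t -> f t ^+ m * H t = 0.
      move=> s /hc <-; rewrite /H big_distrr /=; apply: eq_bigr => -[j l] _; rewrite /Hc /Hg /=.
      case: leqP => ml; last by rewrite hm // !mul0r mulr0.
      rewrite -[X in _ = _ * (_ * (f s ^+ X * _))](subnKC ml) exprD; ring.
    move=> h; have [h1|] := irreducible_mul iZ' ZT (gt_exp m hf) PhiH h; last exact.
    by have /eqP := h1 _ Z't1; rewrite expf_eq0 (negPf ft1) andbF.
  pose c' j := c (j, Ordinal mq).
  have HZ t : Z t -> f0 t ^+ (k * (q - m)) * (\sum_j c' j * g j t) = 0.
    move=> Zt; rewrite -[RHS](H0 t (ZZ' _ Zt)) /H.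
    rewrite (eq_bigr (fun a => Hc (a.1, a.2) * Hg (a.1, a.2) t)); last by case.
    rewrite -(pair_bigA _ (fun j l => Hc (j, l) * Hg (j, l) t)) /Hc /Hg /=.
    rewrite big_distrr /=; apply: eq_bigr => j _.
    rewrite (bigD1 (Ordinal mq)) //= leqnn subnn expr0 mul1r big1 ?addr0.
      by rewrite mulrCA [f0 t ^+ _ * _]mulrC.
    move=> l lm; case: ifP => [ml|_]; last by rewrite mul0r.
    rewrite fZ // expr0n subn_eq0 leqNgt ltn_neqAle ml andbT.
    by rewrite eq_sym -val_eqE in lm; rewrite lm mul0r !mulr0.
  have c'0 : forall t, Z t -> \sum_j c' j * g j t = 0.
    have [|h1|//] := irreducible_mul iZ _ (gt_exp (k * (q - m)) hf0) (gt_sum c' hg) HZ.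
      by move=> s /ZZ' /ZT.
    by have /eqP := h1 _ Zt2; rewrite expf_eq0 (negPf ft2) andbF.
  move=> [j l] /= lm; rewrite -(gind _ c'0 j) /c'; congr (c (_, _)).
  exact: val_inj.
have all m : (m <= q)%N -> forall a : J * 'I_q, (a.2 < m)%N -> c a = 0.
  elim: m => // m IH mq a; rewrite ltnS leq_eqVlt => /orP[/eqP|].
    by apply: key => //; apply: IH; apply: ltnW.
  by apply: IH; apply: ltnW.
by move=> a; apply: (all q).
Qed.

(** Each strict inclusion of the chain supplies a function that vanishes on the smaller member but
    not on the larger one; its powers with exponents below q multiply the size of the family by q.
    [E] adds up the degrees of these functions and so does not depend on q. *)
Lemma chain_family A d : (A `<=` T0)%classic -> irreducible_chain closedT A d ->
  exists E, forall q, exists (J : finType) (g : J -> T -> F),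
    [/\ #|J| = (q ^ d)%N, forall j, Phi (E * q)%N (g j) & indep_on A g].
Proof.
move=> AT [Z [hZ hlt]].
have ZA i : (i <= d)%N -> (Z i `<=` A)%classic.
  by move=> /hZ[[C _ ->] _] t [].
have irr i : (i <= d)%N -> irreducible_set closedT (Z i) by move=> /hZ[].
have [[t0 Zt0] _] := irr 0%N isT.
(* A single [f0] serves every step, because a point of the smallest member lies in all the
   others. *)
have [f0 hf0 ft0] := gt_nonzero gt (AT _ (ZA 0%N isT _ Zt0)).
have Z0 i : (i <= d)%N -> Z i t0.
  by elim: i => // i IH id; have [h _] := hlt i id; apply/h/IH/ltnW.
suff main i : (i <= d)%N -> exists E, forall q, exists (J : finType) (g : J -> T -> F),
    [/\ #|J| = (q ^ i)%N, forall j, Phi (E * q)%N (g j) & indep_on (Z i) g].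
  have [E hE] := main d (leqnn d); exists E => q; have [J [g [h1 h2 h3]]] := hE q.
  by exists J, g; split=> // c hc; apply: h3 => t /(ZA d (leqnn d)) /hc.
elim: i => [_|i IH id].
  exists 0%N => q; exists unit, (fun _ _ => 1); split; first by rewrite card_unit.
    by move=> _; rewrite mul0n; apply: gt_one gt.
  by move=> c /(_ t0 Zt0); rewrite (bigD1 tt) //= big1 => [|[]//]; rewrite addr0 mulr1 => h [].
have [E hE] := IH (ltnW id); have [Zi Zne] := hlt i id.
have [t1 Zt1 nZt1] : exists2 t, Z i.+1 t & ~ Z i t.
  apply: contrapT => h; apply: Zne; apply/seteqP; split=> // t Zt.
  by apply: contrapT => nZ; apply: h; exists t.
have [[C hC ZC] _] := hZ i (ltnW id).
have /(gt_closed gt)[P hP CE] := hC.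
have [f Pf ft1] : exists2 f, P f & f t1 != 0.
  apply: contrapT => h; apply: nZt1; rewrite ZC CE; split; first exact: ZA id _ Zt1.
  split; first exact/AT/(ZA _ id).
  by move=> f Pf; apply/eqP; apply: contraT => ft; case: h; exists f.
have [k hk] := hP f Pf.
exists (E + k)%N => q; have [J [g [cJ hg gi]]] := hE q.
exists (J * 'I_q)%type, (fun (a : J * 'I_q) t =>
     g a.1 t * (f t ^+ a.2 * f0 t ^+ (k * (q - a.2)))); split.
- by rewrite card_prod cJ card_ord expnSr.
- move=> [j l] /=; rewrite mulnDl; apply: gt_mul gt _ _ _ _ (hg j) _.
  have -> : (k * q = k * l + 1 * (k * (q - l)))%N.
    by rewrite mul1n -mulnDr; congr (_ * _)%N; have := ltn_ord l; lia.
  by apply: gt_mul gt _ _ _ _ _ _; apply: gt_exp.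
apply: (@indep_step (Z i) (Z i.+1) k f f0 (E * q)%N) => //.
- exact/irr/ltnW.
- exact: irr.
- by move=> t /(ZA _ id) /AT.
- by move=> t; rewrite ZC CE => -[_ [_ h]]; apply: h.
- by exists t1.
- by exists t0 => //; apply/Z0/ltnW.
Qed.

End GradedTopology.

Section Parametrization.
Variables (F : closedFieldType) (T : Type) (closedT : set (set T)).
Variables (T0 : set T) (Phi : nat -> (T -> F) -> Prop).
Hypothesis gt : graded_topology closedT T0 Phi.

(* [mu] absorbs the common denominator, and the normalisation of the projective
   coordinates of [phi t]. *)
Definition param N c (phi : ('I_N -> F) -> T) (delta : {mpoly F[N]}) :=
  exists mu : ('I_N -> F) -> F,
    (forall t, delta.@[t] != 0 -> T0 (phi t) /\ mu t != 0) /\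
    (forall k f, Phi k f -> exists2 P, deg_le (c * k) P &
       forall t, delta.@[t] != 0 -> f (phi t) = mu t ^+ k * P.@[t]).

(** In each chart, a function of degree K becomes a polynomial with (c K + 1) ^ N possible
    coefficients, up to a factor that is the same for all functions. A relation between the
    coefficient vectors of all charts together exists as soon as there are more functions than
    coefficients. *)
Lemma param_dependence N c K (I J : finType) (phi : I -> ('I_N -> F) -> T)
    (delta : I -> {mpoly F[N]}) (g : J -> T -> F) :
  (forall i, param c (phi i) (delta i)) -> (forall j, Phi K (g j)) ->
  (#|I| * (c * K).+1 ^ N < #|J|)%N ->
  exists2 a : J -> F, exists j, a j != 0 &
    forall i t, (delta i).@[t] != 0 -> \sum_j a j * g j (phi i t) = 0.
Proof.
move=> hphi hg lt.
pose mu i := projT1 (cid (hphi i)).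
have hmu1 i k f : Phi k f -> exists P, deg_le (c * k) P /\
    forall t, (delta i).@[t] != 0 -> f (phi i t) = mu i t ^+ k * P.@[t].
  by move=> hf; have [_ h] := projT2 (cid (hphi i)); have [P h1 h2] := h k f hf; exists P.
pose P i j := projT1 (cid (hmu1 i K (g j) (hg j))).
have hdeg i j : deg_le (c * K) (P i j) by have [] := projT2 (cid (hmu1 i K (g j) (hg j))).
have hval i j t : (delta i).@[t] != 0 -> g j (phi i t) = mu i t ^+ K * (P i j).@[t].
  by have [_ h] := projT2 (cid (hmu1 i K (g j) (hg j))); apply: h.
have lt' : (#|{: I * {ffun 'I_N -> 'I_(c * K).+1}}| < #|J|)%N.
  by rewrite card_prod card_ffun !card_ord.
have [a a0 ha] := linear_dependence
   (fun j (ib : I * {ffun 'I_N -> 'I_(c * K).+1}) => (P ib.1 j)@_(boxmnm ib.2)) lt'.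
exists a => // i t dt.
under eq_bigr do rewrite hval // mulrCA.
rewrite -big_distrr /= [X in _ * X](_ : _ = 0) ?mulr0 //.
under eq_bigr do rewrite (meval_box t (hdeg _ _)) big_distrr /=.
rewrite exchange_big /= big1 // => b _.
under eq_bigr do rewrite mulrA.
by rewrite -big_distrl /= (ha (i, b)) mul0r.
Qed.

Lemma poly_growth_lt s C N : exists q, (s * (C * q).+1 ^ N < q ^ N.+1)%N.
Proof.
(* Since C q + 1 <= (C + 1) q, it is enough that q exceed s (C + 1) ^ N. *)
pose q := (s * C.+1 ^ N).+1; exists q.
apply: (@leq_ltn_trans (s * (C.+1 * q) ^ N)).
  rewrite leq_mul2l; apply/orP; right.
  have : ((C * q).+1 <= C.+1 * q)%N by rewrite mulSn -add1n leq_add2r.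
  by move=> h; elim: (N) => // N' IH; rewrite !expnS leq_mul.
by rewrite expnMn mulnA expnS ltn_pmul2r ?expn_gt0.
Qed.

(** The images of the charts need not cover A: they only have to be dense, in the sense that
    functions vanishing on them vanish on A. Orbits need this generality. *)
Lemma dim_upper (A : set T) N c (I : finType) (phi : I -> ('I_N -> F) -> T)
    (delta : I -> {mpoly F[N]}) :
  (A `<=` T0)%classic -> (forall i, param c (phi i) (delta i)) ->
  (forall k f, Phi k f -> (forall i t, (delta i).@[t] != 0 -> f (phi i t) = 0) ->
      forall t, A t -> f t = 0) ->
  ~ irreducible_chain closedT A N.+1.
Proof.
move=> AT hphi hA /(chain_family gt AT)[E hE].
have [q hq] := poly_growth_lt #|I| (c * E) N.
have [J [g [cJ hg gi]]] := hE q.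
have [|a [j aj] ha] := param_dependence hphi hg; first by rewrite cJ mulnA.
move/eqP: aj; apply; apply: gi j => t.
by apply: (hA (E * q)%N _ (gt_sum gt a hg)) => i s; apply: ha.
Qed.

Lemma param_sub N M c (phi : ('I_N -> F) -> T) delta (q : 'I_N -> {mpoly F[M]}) :
  (forall i, deg_le 1 (q i)) -> param c phi delta ->
  exists2 d : {mpoly F[M]}, forall t, d.@[t] = delta.@[fun i => (q i).@[t]] &
    param c (fun t => phi (fun i => (q i).@[t])) d.
Proof.
move=> hq [mu [hmu hphi]].
have sub k p : deg_le k p -> exists2 P, deg_le k P & forall t, p.@[fun i => (q i).@[t]] = P.@[t].
  move=> hp; have [P h1 h2] := meval_subst hp hq (deg_leW (leq0n 1) (deg_le1 _ _)).
  exists P; first by rewrite mul1n in h1.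
  move=> t; have := h2 t 1; rewrite meval1 mul1r expr1n mul1r => <- //.
  by apply: meval_eq => i; rewrite mul1r.
have [d _ hd] := sub _ _ (leqnSn (msize delta)).
exists d => // ; exists (fun t => mu (fun i => (q i).@[t])); split.
  by move=> t dt; apply: hmu; rewrite hd.
move=> k f /hphi[P h1 h2]; have [P' h3 h4] := sub _ _ h1.
by exists P' => // t dt; rewrite h2 ?hd // h4.
Qed.

(** If the image were in neither closed set, some equation of each would pull back to a nonzero
    polynomial, and the product of both with [delta] would vanish identically. *)
Lemma param_irreducible N c (phi : ('I_N -> F) -> T) delta (C1 C2 : set T) :
  param c phi delta -> closedT C1 -> closedT C2 ->
  (forall t, delta.@[t] != 0 -> C1 (phi t) \/ C2 (phi t)) ->
  (forall t, delta.@[t] != 0 -> C1 (phi t)) \/ (forall t, delta.@[t] != 0 -> C2 (phi t)).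
Proof.
move=> [mu [hmu hphi]] /(gt_closed gt)[P1 hP1 ->] /(gt_closed gt)[P2 hP2 ->] h.
apply: contrapT => /not_orP[n1 n2].
have sep (Q : set (T -> F)) : (forall f, Q f -> exists k, Phi k f) ->
    ~ (forall t, delta.@[t] != 0 -> T0 (phi t) /\ forall f, Q f -> f (phi t) = 0) ->
    exists2 p : {mpoly F[N]}, p != 0 & forall t, delta.@[t] != 0 ->
       (forall f, Q f -> f (phi t) = 0) -> p.@[t] = 0.
  move=> hQ hn; apply: contrapT => hp; apply: hn => t dt; split; first by have [] := hmu t dt.
  move=> f Qf; have [k /hphi[p _ pE]] := hQ f Qf; rewrite pE //.
  have [->|p0] := eqVneq p 0; first by rewrite meval0 mulr0.
  case: hp; exists p => // s ds /(_ f Qf); rewrite pE // => /eqP.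
  by rewrite mulf_eq0 expf_eq0 (negPf (proj2 (hmu s ds))) andbF /= => /eqP.
have [p p0 hp] := sep P1 hP1 n1; have [p' p'0 hp'] := sep P2 hP2 n2.
have d0 : delta != 0.
  by apply/eqP => d0; apply: n1 => t; rewrite d0 meval0 eqxx.
have /eqP : delta * (p * p') = 0.
  apply: mpoly_fun_eq0 => t; rewrite !mevalM.
  have [->|dt] := eqVneq (delta.@[t]) 0; first by rewrite mul0r.
  by case: (h t dt) => -[_ ht]; [rewrite (hp t)|rewrite (hp' t)] => //; rewrite ?mul0r ?mulr0.
by rewrite !mulf_eq0 (negPf d0) (negPf p0) (negPf p'0).
Qed.

Definition closure_of (X : set T) : set T :=
  [set s | T0 s /\ forall k f, Phi k f -> (forall t, X t -> f t = 0) -> f s = 0]%classic.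

Lemma closure_closed X : closedT (closure_of X).
Proof.
apply/(gt_closed gt).
exists [set f | exists2 k, Phi k f & forall t, X t -> f t = 0]%classic.
  by move=> f [k]; exists k.
apply/seteqP; split=> s [Ts h]; split=> //.
  by move=> f [k hf hX]; apply: h hf hX.
by move=> k f hf hX; apply: h; exists k.
Qed.

Lemma closure_min X C : closedT C -> (X `<=` C)%classic -> (closure_of X `<=` C)%classic.
Proof.
move=> /(gt_closed gt)[P hP ->] h s [Ts hs]; split=> // f Pf.
by have [k hk] := hP f Pf; apply: hs hk _ => t /h[_ ->].
Qed.

Lemma sub_closure X : (X `<=` T0)%classic -> (X `<=` closure_of X)%classic.
Proof. by move=> XT s Xs; split; [apply: XT|move=> k f _; apply]. Qed.


Lemma gt_prod (I : finType) k (f : I -> T -> F) : (forall i, Phi k (f i)) ->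
  Phi (#|I| * k)%N (fun t => \prod_i f i t).
Proof.
move=> h; rewrite cardE mulnC; under eq_fun do rewrite -big_enum /=.
elim: (enum I) => [|i s IH].
  by rewrite muln0; under eq_fun do rewrite big_nil; apply: gt_one gt.
by rewrite mulnS; under eq_fun do rewrite big_cons; apply: gt_mul gt _ _ _ _ (h i) IH.
Qed.

Definition emb i N (t : 'I_i -> F) : 'I_N -> F := fun j => oapp t 0 (insub (val j)).
Arguments emb {i} N t _ /.

Lemma emb_widen i N (le : (i <= N)%N) (t : 'I_i -> F) l : emb N t (widen_ord le l) = t l.
Proof. by rewrite /emb /= valK. Qed.

Lemma emb_emb i i' N (t : 'I_i -> F) : (i <= i')%N -> emb N (emb i' t) = emb N t.
Proof.
move=> le; apply/funext => j; rewrite /emb; case: insubP => [l _ <-//|] /=.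
rewrite -leqNgt => /(leq_trans le) h; case: insubP => //= l.
by rewrite ltnNge h.
Qed.

Lemma emb_scale i N (t : 'I_i -> F) z : emb N (fun j => z * t j) = (fun j => z * emb N t j).
Proof. by apply/funext => j; rewrite /emb; case: insubP => //=; rewrite mulr0. Qed.

(* The chain consists of the closures of the images of the coordinate subspaces
   of [F^N]: the functions [y / y0] are algebraically independent on each image,
   because they are tangent to the coordinates at 0, so that counting functions
   tells the closures apart. *)
Lemma dim_lower (A : set T) N c (phi : ('I_N -> F) -> T) (delta : {mpoly F[N]})
    (y0 : T -> F) (y : 'I_N -> T -> F) :
  (A `<=` T0)%classic -> param c phi delta ->
  (forall t, delta.@[t] != 0 -> A (phi t)) ->
  Phi 1%N y0 -> (forall l, Phi 1%N (y l)) ->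
  (forall v : 'I_N -> F, exists w : F -> 'I_N -> F,
     [/\ forall l, reg (w ^~ l), w 0 =1 v &
       agerm (fun z => let s := phi (fun j => z * v j) in
         [/\ delta.@[fun j => z * v j] != 0, y0 s != 0 &
             forall l, y l s = z * w z l * y0 s])]) ->
  irreducible_chain closedT A N.
Proof.
move=> AT hphi hA hy0 hy hw.
pose X i := [set s | exists2 t : 'I_i -> F, delta.@[emb N t] != 0 & s = phi (emb N t)]%classic.
have XA i : (X i `<=` A)%classic by move=> _ [t dt ->]; apply: hA.
have XT i : (X i `<=` T0)%classic by move=> s /XA /AT.
have sub i : exists2 d : {mpoly F[i]}, forall t, d.@[t] = delta.@[emb N t] &
    param c (fun t => phi (emb N t)) d.
  pose q (j : 'I_N) : {mpoly F[i]} := oapp (fun l : 'I_i => 'X_l) 0 (insub (val j)).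
  have qE t : (fun j => (q j).@[t]) = emb N t.
    apply/funext => j; rewrite /q /emb; case: insub => [l|] /=; first by rewrite mevalXU.
    by rewrite meval0.
  have hq j : deg_le 1 (q j).
    rewrite /q; case: insub => [l|] /=; last by rewrite /deg_le msize0.
    by rewrite /deg_le msizeX mdeg1.
  have [d hd pd] := param_sub hq hphi; exists d; first by move=> t; rewrite hd qE.
  by have <- : (fun t => phi (fun j => (q j).@[t])) = (fun t => phi (emb N t))
    by apply/funext => t; rewrite qE.
exists (fun i => A `&` closure_of (X i))%classic; split.
  move=> i iN; split; first by exists (closure_of (X i)) => //; apply: closure_closed.
  have [d hd pd] := sub i; split.
    (* The direction v = 0 only serves to show that [delta] does not vanish at the origin, hence
       that the image is not empty. *)
    have [w [_ _ /agerm_ex[z /= [dz _ _]]]] := hw (fun=> 0).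
    have e : (fun j : 'I_N => z * 0) = emb N (fun _ : 'I_i => 0).
      by apply/funext => j; rewrite /emb mulr0; case: insubP.
    rewrite e in dz; exists (phi (emb N (fun _ : 'I_i => 0))); split; first exact: hA.
    by apply: sub_closure; [apply: XT|exists (fun=> 0)].
  move=> C1 C2 hC1 hC2 hZ.
  have XZ : (X i `<=` A `&` closure_of (X i))%classic.
    by move=> s Xs; split; [apply: XA Xs|apply: sub_closure Xs; apply: XT].
  have [|h|h] := param_irreducible pd hC1 hC2.
  - by move=> t; rewrite hd => dt; apply/hZ/XZ; exists t.
  - left=> s [_]; apply: closure_min => // _ [t dt ->]; apply: h; by rewrite hd.
  - right=> s [_]; apply: closure_min => // _ [t dt ->]; apply: h; by rewrite hd.
move=> i iN; split.
  move=> s [As cs]; split=> //.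
  apply: closure_min cs; first exact: closure_closed.
  move=> _ [t dt ->]; apply: sub_closure; first exact: XT.
  by exists (emb i.+1 t); rewrite emb_emb.
move=> eZ.
have [d hd pd] := sub i.
(* The q ^ (i + 1) monomials in i + 1 of the functions are too many for the image of an
   i-dimensional space, so a relation holds there; if the two members of the chain were equal, it
   would persist on the next image. *)
have [q hq] := poly_growth_lt 1 (c * i.+1) i.
pose yi (l : 'I_i.+1) := y (widen_ord iN l).
(* Monomials in the quotients of [yi l] by [y0], cleared of denominators by the factor y0 ^ q for
   each variable. *)
pose g (a : {ffun 'I_i.+1 -> 'I_q}) s := \prod_l (yi l s ^+ a l * y0 s ^+ (q - a l)).
have hg a : Phi (i.+1 * q)%N (g a).
  rewrite -[i.+1]card_ord; apply: gt_prod => l.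
  have := ltnW (ltn_ord (a l)); move: (nat_of_ord (a l)) => b bq.
  rewrite -[X in Phi X](subnKC bq) -[X in (X + _)%N]mul1n -[X in (_ + X)%N]mul1n.
  apply: (gt_mul gt (f := fun s => yi l s ^+ b) (g := fun s => y0 s ^+ (q - b)));
    by [exact: (gt_exp gt b (hy _))|exact: (gt_exp gt (q - b) hy0)].
have [|a [a1 aa1] ha] := param_dependence (I := unit) (fun _ => pd) hg.
  by rewrite card_unit card_ffun !card_ord mulnA.
pose f s := \sum_b a b * g b s.
have hf : Phi (i.+1 * q)%N f by exact: (gt_sum gt a hg).
have f0 (t : 'I_i.+1 -> F) : delta.@[emb N t] != 0 -> f (phi (emb N t)) = 0.
  move=> dt.
  have : (A `&` closure_of (X i))%classic (phi (emb N t)).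
    rewrite eZ; split; first exact: hA.
    by apply: sub_closure; [apply: XT|exists t].
  case=> _ [_]; apply; first exact: hf.
  by move=> _ [s ds ->]; apply: (ha tt); rewrite hd.
pose Q : {mpoly F[i.+1]} := \sum_b a b *: 'X_[boxmnm b].
have QE t : Q.@[t] = \sum_b a b * boxmon b t.
  rewrite /Q raddf_sum; apply: eq_bigr => b _ /=; rewrite mevalZ mevalX.
  by congr (_ * _); apply: eq_bigr => l _; rewrite mnmE.
suff Q0 : Q = 0.
  move/eqP: aa1; apply; apply: (@boxmon_free F i.+1 q) => t.
  by rewrite -QE Q0 meval0.
apply: dominant_eq0 => v; have [w [rw w0 hwv]] := hw (emb N v).
exists (fun z l => w z (widen_ord iN l)); split=> //.
  by move=> l; rewrite w0 emb_widen.
apply: agermW hwv => z; rewrite -emb_scale /= => -[dz yz hl].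
have := f0 _ dz; rewrite /f.
set s := phi _ in yz hl *.
rewrite (eq_bigr (fun b => (y0 s ^+ q) ^+ i.+1 *
    (a b * boxmon b (fun l => z * w z (widen_ord iN l))))).
  rewrite -big_distrr /= => /eqP; rewrite mulf_eq0 !expf_eq0 (negPf yz) !andbF /=.
  by rewrite -QE => /eqP.
move=> b _; rewrite mulrCA; congr (_ * _).
rewrite -[X in _ ^+ X]card_ord -prodr_const /boxmon -big_split /=.
apply: eq_bigr => l _; rewrite /yi hl exprMn -mulrA -exprD subnKC; last exact/ltnW.
by rewrite mulrC.
Qed.

End Parametrization.

(** * Isometry groups and the Cayley transform *)

Section MatrixEndomorphisms.
Variables (F : fieldType) (n : nat).
Implicit Types (g h x y : 'M[F]_n) (X Y S : {vspace 'rV[F]_n}).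

Definition fmx g : 'End('rV[F]_n) := linfun (mulmxr g).

Lemma fmxE g u : fmx g u = u *m g.
Proof. by rewrite lfunE. Qed.

Lemma lin1_mxE (h : 'End('rV[F]_n)) u : u *m lin1_mx h = h u.
Proof. by rewrite mul_rV_lin1. Qed.

Lemma fmxK g : lin1_mx (fmx g) = g.
Proof. by apply/row_matrixP => i; rewrite !rowE lin1_mxE fmxE. Qed.

Lemma lin1_mxK (h : 'End('rV[F]_n)) : fmx (lin1_mx h) = h.
Proof. by apply/lfunP => u; rewrite fmxE lin1_mxE. Qed.

Lemma limg_fmxM g h X : (fmx (g *m h) @: X = fmx h @: (fmx g @: X))%VS.
Proof.
rewrite -limg_comp; congr (_ @: _)%VS; apply/lfunP => u.
by rewrite comp_lfunE !fmxE mulmxA.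
Qed.

Lemma limg_fmx1 X : (fmx 1%:M @: X = X)%VS.
Proof.
rewrite -[RHS]lim1g; congr (_ @: _)%VS; apply/lfunP => u.
by rewrite fmxE mulmx1 id_lfunE.
Qed.

Lemma lker_fmx g : g \in unitmx -> lker (fmx g) == 0%VS.
Proof. by move=> gu; apply/lker0P => u v; rewrite !fmxE => /(can_inj (mulmxK gu)). Qed.

Lemma dim_fmx g X : g \in unitmx -> \dim (fmx g @: X) = \dim X.
Proof. by move=> gu; rewrite limg_dim_eq // (eqP (lker_fmx gu)) capv0. Qed.

Lemma limg_fmxV g X Y : g \in unitmx -> (fmx g @: X = Y)%VS -> (fmx (invmx g) @: Y = X)%VS.
Proof. by move=> gu <-; rewrite -limg_fmxM mulmxV // limg_fmx1. Qed.

Lemma limg_fmx_sub g X : g \in unitmx -> (fmx g @: X <= X)%VS -> (fmx g @: X = X)%VS.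
Proof. by move=> gu h; apply/eqP; rewrite eqEdim h dim_fmx /=. Qed.

Lemma sub_fmxP x X : reflect (forall u, u \in X -> u *m x \in X) (fmx x @: X <= X)%VS.
Proof.
apply: (iffP idP) => [/subvP h u uX|h].
  by rewrite -fmxE; apply: h; apply: memv_img.
by apply/subvP => _ /memv_imgP[u uX ->]; rewrite fmxE h.
Qed.

Lemma sub_fmxD x y X : (fmx x @: X <= X)%VS -> (fmx y @: X <= X)%VS ->
  (fmx (x + y) @: X <= X)%VS.
Proof.
by move=> /sub_fmxP hx /sub_fmxP hy; apply/sub_fmxP => u uX; rewrite mulmxDr memvD ?hx ?hy.
Qed.

Lemma sub_fmxZ a x X : (fmx x @: X <= X)%VS -> (fmx (a *: x) @: X <= X)%VS.
Proof.
by move=> /sub_fmxP hx; apply/sub_fmxP => u uX; rewrite -scalemxAr memvZ ?hx.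
Qed.

Lemma sub_fmxM x y X : (fmx x @: X <= X)%VS -> (fmx y @: X <= X)%VS ->
  (fmx (x *m y) @: X <= X)%VS.
Proof. by move=> hx hy; rewrite limg_fmxM; apply: subv_trans (limgS _ hx) hy. Qed.

Lemma sub_fmx1 X : (fmx 1%:M @: X <= X)%VS.
Proof. by rewrite limg_fmx1. Qed.

Lemma sub_fmxV g X : g \in unitmx -> (fmx g @: X <= X)%VS -> (fmx (invmx g) @: X <= X)%VS.
Proof. by move=> gu /(limg_fmx_sub gu) h; rewrite (limg_fmxV gu h). Qed.

(* Agrees with [invmx] on invertible matrices, and depends rationally on all of them. *)
Definition ainv g : 'M[F]_n := (\det g)^-1 *: \adj g.

Lemma ainvE g : g \in unitmx -> ainv g = invmx g.
Proof. by rewrite /ainv /invmx => ->. Qed.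

Definition cayley x : 'M[F]_n := (1%:M - x) *m ainv (1%:M + x).

Lemma cayley_add1 x : 1%:M + x \in unitmx -> 1%:M + cayley x = 2%:R *: invmx (1%:M + x).
Proof.
move=> xu; rewrite /cayley ainvE // -{1}[1%:M](mulmxV xu) -mulmxDl addrACA subrr addr0.
by rewrite mulmxDl mul1mx -mulr2n scaler_nat.
Qed.

Lemma one_sub_cayley x : 1%:M + x \in unitmx ->
  1%:M - cayley x = 2%:R *: (x *m ainv (1%:M + x)).
Proof.
move=> xu; rewrite /cayley ainvE // -{1}[1%:M](mulmxV xu) -mulmxBl scalemxAl; congr (_ *m _).
by rewrite opprB [1%:M + x]addrC addrACA subrr addr0 scaler_nat mulr2n.
Qed.

(** The deviation from the identity appears as z times a matrix that is regular at z = 0; in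
    particular the derivative there is - 2 x. *)
Lemma cayley_line z x : 1%:M + z *: x \in unitmx ->
  cayley (z *: x) = 1%:M - (2%:R * z) *: (x *m ainv (1%:M + z *: x)).
Proof.
move=> xu; apply/eqP; rewrite eq_sym subr_eq addrC -subr_eq.
by rewrite one_sub_cayley // -scalemxAl scalerA.
Qed.

Hypothesis F2 : (2%:R : F) != 0.

Lemma cayley_add1_unit x : 1%:M + x \in unitmx -> 1%:M + cayley x \in unitmx.
Proof. by move=> xu; rewrite cayley_add1 // unitmxZ ?unitfE // unitmx_inv. Qed.

Lemma cayleyK x : 1%:M + x \in unitmx -> cayley (cayley x) = x.
Proof.
move=> xu; rewrite {1}/cayley ainvE ?cayley_add1_unit // cayley_add1 //.
rewrite one_sub_cayley // ainvE //.
rewrite invmxZ; last by rewrite unitmxZ ?unitfE // unitmx_inv.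
rewrite invmxK -scalemxAr -scalemxAl scalerA mulVf //.
by rewrite scale1r -mulmxA mulVmx // mulmx1.
Qed.

Lemma comm_one_addB x : (1%:M + x) *m (1%:M - x) = (1%:M - x) *m (1%:M + x).
Proof.
apply: comm_mxB; first exact: comm_mx1.
by apply/comm_mx_sym/comm_mxD; [apply: comm_mx1|apply: comm_mx_refl].
Qed.

Variable J : 'M[F]_n.
Hypothesis Ju : J \in unitmx.

(** Matrices act on row vectors from the right, so the equation says that g preserves the form with
    Gram matrix [J]. The list of stable subspaces lets H and H_S be treated together; [inL] is the
    corresponding Lie algebra. *)
Definition inG (Xs : seq {vspace 'rV[F]_n}) g :=
  g *m J *m g^T = J /\ forall X, X \in Xs -> (fmx g @: X)%VS = X.

Definition inL (Xs : seq {vspace 'rV[F]_n}) x :=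
  x *m J + J *m x^T = 0 /\ forall X, X \in Xs -> (fmx x @: X <= X)%VS.

Lemma inG_unit Xs g : inG Xs g -> g \in unitmx.
Proof.
move=> [h _]; have : g *m J *m g^T \in unitmx by rewrite h.
by rewrite unitmx_mul => /andP[]; rewrite unitmx_mul => /andP[].
Qed.

Lemma inGM Xs g h : inG Xs g -> inG Xs h -> inG Xs (g *m h).
Proof.
move=> [g1 g2] [h1 h2]; split=> [|X XX]; last by rewrite limg_fmxM g2 ?h2.
by rewrite trmx_mul -!mulmxA [J *m _]mulmxA [h *m _]mulmxA [h *m (J *m _)]mulmxA h1 mulmxA.
Qed.

Lemma inGV Xs g : inG Xs g -> inG Xs (invmx g).
Proof.
move=> hg; have gu := inG_unit hg; case: hg => h1 h2; split=> [|X XX].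
  rewrite -{1}h1 -!mulmxA -trmx_mul mulVmx // trmx1 mulmx1 mulmxA mulVmx // mul1mx.
  by [].
by rewrite (limg_fmxV gu (h2 X XX)).
Qed.

Lemma inL_unit Xs x : inL Xs x -> 1%:M + x \in unitmx -> 1%:M - x \in unitmx.
Proof.
move=> [/eqP]; rewrite addr_eq0 => /eqP h _ xu.
have e : (1%:M - x) *m J = J *m (1%:M + x)^T.
  by rewrite mulmxBl mul1mx h opprK linearD /= trmx1 mulmxDr mulmx1.
have : (1%:M - x) *m J \in unitmx by rewrite e unitmx_mul Ju unitmx_tr.
by rewrite unitmx_mul => /andP[].
Qed.

Lemma cayley_inG Xs x : inL Xs x -> 1%:M + x \in unitmx -> inG Xs (cayley x).
Proof.
move=> hx xu; have xu' := inL_unit hx xu; case: hx => /eqP; rewrite addr_eq0 => /eqP h hX.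
rewrite /cayley ainvE //; split=> [|X XX]; last first.
  apply: limg_fmx_sub; first by rewrite unitmx_mul xu' unitmx_inv.
  have hXX := hX X XX.
  apply: sub_fmxM; last by apply: sub_fmxV => //; apply: sub_fmxD => //; apply: sub_fmx1.
  by apply: sub_fmxD; [apply: sub_fmx1|rewrite -scaleN1r; apply: sub_fmxZ].
have e1 : J *m (1%:M - x)^T = (1%:M + x) *m J.
  by rewrite mulmxDl mul1mx h linearB /= trmx1 mulmxBr mulmx1.
have e2 : J *m (1%:M + x)^T = (1%:M - x) *m J.
  by rewrite mulmxBl mul1mx h opprK linearD /= trmx1 mulmxDr mulmx1.
have e3 : J *m (invmx (1%:M + x))^T = invmx (1%:M - x) *m J.
  apply: (can_inj (mulKmx xu')).
  by rewrite mulKVmx // mulmxA -e2 -mulmxA -trmx_mul mulVmx // trmx1 mulmx1.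
have com : invmx (1%:M + x) *m invmx (1%:M - x) = invmx (1%:M - x) *m invmx (1%:M + x).
  apply: (can_inj (mulKmx xu')); rewrite mulKVmx //; apply: (can_inj (mulKmx xu)).
  by rewrite mulmxV // mulmxA comm_one_addB -mulmxA mulKVmx // mulmxV.
rewrite trmx_mul -!mulmxA [J *m _]mulmxA e3 -!mulmxA e1 [invmx _ *m (invmx _ *m _)]mulmxA.
by rewrite com -mulmxA mulKVmx // mulKmx.
Qed.

Lemma cayley_inL Xs g : inG Xs g -> 1%:M + g \in unitmx -> inL Xs (cayley g).
Proof.
move=> [h hX] gu; rewrite /cayley ainvE //; split=> [|X XX]; last first.
  have hg : (fmx g @: X <= X)%VS by rewrite hX.
  apply: sub_fmxM; last by apply: sub_fmxV => //; apply: sub_fmxD => //; apply: sub_fmx1.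
  by apply: sub_fmxD; [apply: sub_fmx1|rewrite -scaleN1r; apply: sub_fmxZ].
have com : (1%:M - g) *m invmx (1%:M + g) = invmx (1%:M + g) *m (1%:M - g).
  apply: (can_inj (mulKmx gu)); rewrite mulKVmx // mulmxA.
  by rewrite comm_one_addB -mulmxA mulmxV // mulmx1.
have gu' : (1%:M + g)^T \in unitmx by rewrite unitmx_tr.
(* Multiplying by 1 + g on the left and by its transpose on the right clears both inverses; what
   remains only uses that g is an isometry. *)
apply: (can_inj (mulKmx gu)); apply: (can_inj (mulmxK gu')).
set y := _ *m invmx _; have e : (1%:M + g) *m y = 1%:M - g by rewrite /y com mulKVmx.
rewrite mulmx0 mul0mx mulmxDr mulmxDl mulmxA e -!mulmxA -trmx_mul e.
have h' : g *m (J *m g^T) = J by rewrite mulmxA.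
have e1 : J *m (1%:M + g)^T = J + J *m g^T by rewrite linearD /= trmx1 mulmxDr mulmx1.
have e2 : J *m (1%:M - g)^T = J - J *m g^T by rewrite linearB /= trmx1 mulmxBr mulmx1.
rewrite e1 e2 mulmxBl mulmxDl !mul1mx mulmxDr mulmxBr h'.
move: (J *m g^T) (g *m J) => a b.
have -> : J + a - (b + J) = a - b by rewrite [J + a]addrC opprD [- b - J]addrC addrA addrK.
have -> : J - a + (b - J) = b - a by rewrite addrC addrA subrK.
by rewrite addrA subrK subrr.
Qed.

End MatrixEndomorphisms.

(** * Pluecker coordinates and rational parametrizations *)

Section Pluecker.
Variables (F : fieldType) (n : nat).
Implicit Type S : {vspace 'rV[F]_n}.

(** A Cauchy-Binet formula in which the maps f are not grouped by their images: expanding the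
    entries of the product is then enough, and the terms match the redundant coordinates of
    [pluecker]. *)
Lemma det_mulmx_colsub r (M : 'M[F]_(r, n)) (E : 'M[F]_(n, r)) :
  \det (M *m E) = \sum_(f : {ffun 'I_r -> 'I_n}) (\prod_j E (f j) j) * \det (colsub f M).
Proof.
under [RHS]eq_bigr do rewrite /determinant big_distrr /=.
rewrite exchange_big /=; apply: eq_bigr => s _.
under [RHS]eq_bigr do rewrite mulrCA.
rewrite -big_distrr /=; congr (_ * _).
under eq_bigr do rewrite mxE.
rewrite bigA_distr_bigA /=.
rewrite (reindex (fun f : {ffun 'I_r -> 'I_n} => [ffun i => f (s i)])) /=; last first.
  exists (fun f : {ffun 'I_r -> 'I_n} => [ffun i => f (s^-1%g i)]) => f _;
    by apply/ffunP => i; rewrite !ffunE ?permK ?permKV.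
apply: eq_bigr => f _; rewrite [X in X * _](reindex_inj (@perm_inj _ s)) /= -big_split /=.
by apply: eq_bigr => i _; rewrite ffunE mxE mulrC.
Qed.

Definition rows_of r S : 'M[F]_(r, n) := \matrix_(i < r) (vbasis S)`_i.

Lemma row_free_rows_of r S : \dim S = r -> row_free (rows_of r S).
Proof.
move=> dS; rewrite -kermx_eq0; apply/rowV0P => v /sub_kermxP v0.
subst r; have /freeP fr := basis_free (vbasisP S).
apply/rowP => i; rewrite mxE; apply: (fr (v 0)).
rewrite -[RHS]v0 mulmx_sum_row; apply: eq_bigr => j _.
by rewrite rowK.
Qed.

Lemma mem_rows_of r S u : \dim S = r -> (u \in S) = (u <= rows_of r S)%MS.
Proof.
move=> dS; subst r; apply/idP/submxP => [/coord_vbasis ->|[c ->]].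
  exists (\row_i coord (vbasis S) i u); rewrite mulmx_sum_row.
  by apply: eq_bigr => i _; rewrite mxE rowK.
rewrite mulmx_sum_row memv_suml // => i _.
by rewrite rowK memvZ // vbasis_mem // mem_nth // size_tuple.
Qed.

Lemma mem_limg_fmx r S g u : \dim S = r ->
  (u \in (fmx g @: S)%VS) = (u <= rows_of r S *m g)%MS.
Proof.
move=> dS; apply/memv_imgP/idP => [[v vS ->]|].
  by rewrite fmxE submxMr // -mem_rows_of.
move/submxP => [c ->]; exists (c *m rows_of r S); last by rewrite fmxE mulmxA.
by rewrite (mem_rows_of _ dS) submxMl.
Qed.

(** [vbasis S] does not vary with S in any controlled way. Any other matrix of the same size with
    row space S differs from it by a change of basis, whose determinant rescales all coordinates at
    once. *)
Lemma pluecker_rows r S (M : 'M[F]_(r, n)) : \dim S = r ->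
  (forall u, (u \in S) = (u <= M)%MS) ->
  \det (rows_of r S *m pinvmx M) != 0 /\
  forall k, @pluecker F n r S k =
    \det (rows_of r S *m pinvmx M) * \det (colsub (enum_val k) M).
Proof.
move=> dS hM; have e : rows_of r S *m pinvmx M *m M = rows_of r S.
  apply: mulmxKpV; apply/row_subP => i; rewrite -hM (mem_rows_of _ dS).
  exact: row_sub.
split.
  rewrite -unitfE -unitmxE -row_free_unit -row_leq_rank.
  apply: leq_trans (mxrankM_maxl _ M); rewrite e.
  by rewrite row_leq_rank row_free_rows_of.
move=> k; rewrite /pluecker -/(rows_of r S) -[in LHS]e -det_mulmx; congr (\det _).
by apply/matrixP => i j; rewrite !mxE; apply: eq_bigr => l _; rewrite !mxE.
Qed.

End Pluecker.

(** * The Zariski topologies of endomorphisms and of Grassmannians as graded topologies *)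

Section Topologies.
Variables (F : closedFieldType) (n : nat).

Definition Phi_End k (f : 'End('rV[F]_n) -> F) :=
  exists2 p : {mpoly F[n * n]}, deg_le k p &
    forall h, f h = p.@[fun k => mxvec (lin1_mx h) 0 k].

Definition Phi_Gr r k (f : {vspace 'rV[F]_n} -> F) :=
  exists2 p : {mpoly F[#|{ffun 'I_r -> 'I_n}|]}, p \is k.-homog &
    forall S, f S = p.@[@pluecker F n r S].

Lemma graded_End : graded_topology (@zariski_closed_End F n) setT Phi_End.
Proof.
split.
- move=> C; split=> [[P ->]|[P hP ->]].
    exists [set f | exists2 p, P p & f = fun h : 'End('rV[F]_n) => p.@[fun k => mxvec (lin1_mx h) 0 k]]%classic.
      by move=> _ [p Pp ->]; exists (msize p), p; rewrite /deg_le.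
    apply/seteqP; split=> h /=.
      by move=> hh; split=> // _ [p Pp ->]; apply: hh.
    by move=> [_ hh] p Pp; apply: (hh (fun h : 'End('rV[F]_n) => p.@[fun k => mxvec (lin1_mx h) 0 k])); exists p.
  exists [set p | P (fun h : 'End('rV[F]_n) => p.@[fun k => mxvec (lin1_mx h) 0 k])]%classic.
  apply/seteqP; split=> h /=; first by move=> [_ hh] p /hh.
  move=> hh; split=> // f Pf; have [k [p _ pE]] := hP f Pf.
  have fE : f = fun h : 'End('rV[F]_n) => p.@[fun k => mxvec (lin1_mx h) 0 k].
    by apply/funext => h'; apply: pE.
  by rewrite pE; apply: hh; rewrite /= -fE.
- by move=> k; exists 0; rewrite ?/deg_le ?msize0 // => h; rewrite meval0.
- move=> k a f g [p hp pE] [q hq qE]; exists (a *: p + q).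
    by have := @deg_le_sum F _ k bool [:: true; false] predT
         (fun b => if b then a *: p else q); rewrite !big_cons big_nil addr0; apply;
       case=> // _; apply: deg_leZ.
  by move=> h; rewrite mevalD mevalZ pE qE.
- by exists 1; [apply: deg_le1|move=> h; rewrite meval1].
- move=> k l f g [p hp pE] [q hq qE]; exists (p * q); first exact: deg_leM.
  by move=> h; rewrite mevalM pE qE.
- move=> h _; exists (fun=> 1); last exact: oner_neq0.
  exists 1; first by apply: deg_leW (deg_le1 _ _).
  by move=> h'; rewrite meval1.
Qed.

Lemma graded_Gr r :
  graded_topology (@zariski_closed_Gr F n r) [set S | \dim S = r]%classic (Phi_Gr r).
Proof.
split.
- move=> C; split=> [[P hP ->]|[P hP ->]].
    exists [set f | exists2 p, P p & f = fun S => p.@[@pluecker F n r S]]%classic.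
      by move=> _ [p Pp ->]; have [d hd] := hP p Pp; exists d, p.
    apply/seteqP; split=> S /= [dS hh]; split=> //.
      by move=> _ [p Pp ->]; apply: hh.
    by move=> p Pp; apply: (hh (fun S => p.@[@pluecker F n r S])); exists p.
  exists [set p | (exists d, p \is d.-homog) /\ P (fun S => p.@[@pluecker F n r S])]%classic.
    by move=> p [].
  apply/seteqP; split=> S /= [dS hh]; split=> //; first by move=> p [_ /hh].
  move=> f Pf; have [k [p hp pE]] := hP f Pf.
  have fE : f = fun S => p.@[@pluecker F n r S] by apply/funext => S'; apply: pE.
  by rewrite pE; apply: hh; split; [exists k|rewrite -fE].
- by move=> k; exists 0; rewrite ?rpred0 // => h; rewrite meval0.
- move=> k a f g [p hp pE] [q hq qE]; exists (a *: p + q).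
    by apply: rpredD => //; apply: rpredZ.
  by move=> h; rewrite mevalD mevalZ pE qE.
- by exists 1; [apply: dhomog1|move=> h; rewrite meval1].
- move=> k l f g [p hp pE] [q hq qE]; exists (p * q); first exact: dhomogM.
  by move=> h; rewrite mevalM pE qE.
- move=> S dS; have fr := row_free_rows_of dS.
  have [k hk] : exists k, @pluecker F n r S k != 0.
    apply: contrapT => hn.
    (* If all coordinates were 0, so would be the expansion of this determinant, which is that of
       the identity. *)
    have : \det (rows_of r S *m pinvmx (rows_of r S)) = 0.
      rewrite det_mulmx_colsub big1 // => f _.
      have -> : \det (colsub f (rows_of r S)) = @pluecker F n r S (enum_rank f).
        by rewrite /pluecker enum_rankK.
      have [->|h] := eqVneq (@pluecker F n r S (enum_rank f)) 0; first by rewrite mulr0.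
      by case: hn; exists (enum_rank f).
    by rewrite mulmxVp // det1 => /eqP; rewrite oner_eq0.
  exists (fun S => @pluecker F n r S k) => //; exists 'X_k; first by rewrite dhomogX /= mdeg1.
  by move=> S'; rewrite mevalXU.
Qed.

End Topologies.

(** * Cayley charts as rational parametrizations *)

Section MatrixParam.
Variables (F : closedFieldType) (n N : nat) (e : 'I_N -> 'M[F]_n).

Definition mxcomb (t : 'I_N -> F) : 'M[F]_n := \sum_i t i *: e i.

Definition gen_mx : 'M[{mpoly F[N]}]_n := \sum_i 'X_i *: map_mx (@mpolyC N F) (e i).

Lemma map_meval_polyC m m' (t : 'I_N -> F) (A : 'M[F]_(m, m')) :
  map_mx (meval t) (map_mx (@mpolyC N F) A) = A.
Proof. by apply/matrixP => i j; rewrite !mxE mevalC. Qed.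

Lemma map_gen_mx t : map_mx (meval t) gen_mx = mxcomb t.
Proof.
rewrite /gen_mx /mxcomb raddf_sum /=; apply: eq_bigr => i _.
by rewrite map_mxZ /= mevalXU map_meval_polyC.
Qed.

Definition gen_det : {mpoly F[N]} := \det (1%:M + gen_mx).

Lemma gen_detE t : gen_det.@[t] = \det (1%:M + mxcomb t).
Proof. by rewrite /gen_det -det_map_mx map_mxD map_mx1 map_gen_mx. Qed.

Definition gen_num : 'M[{mpoly F[N]}]_n := (1%:M - gen_mx) *m \adj (1%:M + gen_mx).

Lemma gen_numE t : cayley (mxcomb t) =
  (\det (1%:M + mxcomb t))^-1 *: map_mx (meval t) gen_num.
Proof.
rewrite /gen_num map_mxM map_mxB map_mx_adj map_mxD map_mx1 map_gen_mx.
by rewrite /cayley /ainv -scalemxAr.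
Qed.

Lemma common_degree (I : finType) (q : I -> {mpoly F[N]}) :
  exists d, forall i, deg_le d (q i).
Proof.
exists (\max_i msize (q i))%N => i.
by rewrite /deg_le; apply: leq_trans (leqnSn _); apply: (leq_bigmax i).
Qed.

Lemma param_End (g0 : 'M[F]_n) : exists c,
  param setT (@Phi_End F n) c (fun t => fmx (cayley (mxcomb t) *m g0)) gen_det.
Proof.
pose q k := mxvec (gen_num *m map_mx (@mpolyC N F) g0) 0 k.
(* [None] stands for the denominator, so that one degree bounds it together with all numerators. *)
have [d hd] := common_degree (fun o => oapp q gen_det o).
exists d, (fun t => (\det (1%:M + mxcomb t))^-1); split.
  by move=> t dt; split=> //; rewrite invr_neq0 // -gen_detE.
move=> k f [p hp pE].
have [P P1 P2] := meval_subst hp (fun i => hd (Some i)) (hd None).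
exists P => // t dt; rewrite pE -P2 /=; last by rewrite gen_detE mulVf // -gen_detE.
apply: meval_eq => i; rewrite fmxK gen_numE /q /=.
rewrite -scalemxAl linearZ mxE; congr (_ * _).
case/mxvec_indexP: i => i j; rewrite !mxvecE.
set A := gen_num *m _; have -> : (A i j).@[t] = map_mx (meval t) A i j by rewrite [RHS]mxE.
by rewrite /A [in RHS]map_mxM /= map_meval_polyC.
Qed.

Lemma param_Gr r (S : {vspace 'rV[F]_n}) (g0 : 'M[F]_n) : \dim S = r ->
  g0 \in unitmx ->
  (forall t, 1%:M + mxcomb t \in unitmx -> cayley (mxcomb t) \in unitmx) ->
  exists c, param [set S | \dim S = r]%classic (Phi_Gr r) c
    (fun t => fmx (cayley (mxcomb t) *m g0) @: S)%VS gen_det.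
Proof.
move=> dS g0u hu.
pose M := map_mx (@mpolyC N F) (rows_of r S) *m gen_num *m map_mx (@mpolyC N F) g0.
pose q (k : 'I_#|{ffun 'I_r -> 'I_n}|) := \det (colsub (enum_val k) M).
have [d hd] := common_degree q.
pose im t := (fmx (cayley (mxcomb t) *m g0) @: S)%VS.
pose Mt t := rows_of r S *m (cayley (mxcomb t) *m g0).
pose la t := \det (rows_of r (im t) *m pinvmx (Mt t)).
pose D t := \det (1%:M + mxcomb t).
have dim_im t : gen_det.@[t] != 0 -> \dim (im t) = r.
  move=> dt; rewrite dim_fmx // unitmx_mul g0u andbT; apply: hu.
  by rewrite unitmxE unitfE -gen_detE.
have pl t : gen_det.@[t] != 0 -> la t != 0 /\
  forall k, @pluecker F n r (im t) k = la t * \det (colsub (enum_val k) (Mt t)).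
  move=> dt; apply: pluecker_rows; first exact: dim_im.
  by move=> u; apply: mem_limg_fmx.
(* [la t] compares the chosen basis of the image with the rows of [Mt t], and each of these r rows
   carries the Cayley denominator once. *)
exists d, (fun t => la t * (D t)^-1 ^+ r); split.
  move=> t dt; split; first exact: dim_im.
  rewrite mulf_neq0 ?expf_neq0 ?invr_neq0 //; first by have [] := pl t dt.
  by rewrite /D -gen_detE.
move=> k f [p hp pE].
have [P P1 P2] := meval_homog_subst hp hd.
exists P => // t dt; rewrite pE -P2; apply: meval_eq => i.
have [_ ->] := pl t dt; rewrite -mulrA; congr (_ * _).
rewrite /q -det_map_mx -detZ; congr (\det _).
apply/matrixP => a b; rewrite /Mt gen_numE -scalemxAl -scalemxAr [LHS]mxE [LHS]mxE [RHS]mxE.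
congr (_ * _).
have -> : map_mx (meval t) (colsub (enum_val i) M) a b = map_mx (meval t) M a (enum_val i b).
  by rewrite [LHS]mxE [RHS]mxE; congr (_.@[t]); rewrite mxE.
by rewrite /M [in RHS]map_mxM [in RHS]map_mxM /= !map_meval_polyC mulmxA.
Qed.

End MatrixParam.

(** * Matrices whose entries are regular at 0 *)

Section RegularMatrices.
Variable F : closedFieldType.

Definition regmx m p (A : F -> 'M[F]_(m, p)) := forall i j, reg (fun z => A z i j).

Lemma eq_regmx m p (A B : F -> 'M[F]_(m, p)) : A =1 B -> regmx A -> regmx B.
Proof. by move=> e h i j; apply: eq_reg (h i j) => z; rewrite e. Qed.

Lemma regmx_cst m p (A : 'M[F]_(m, p)) : regmx (fun=> A).
Proof. by move=> i j; apply: reg_cst. Qed.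

Lemma regmxD m p (A B : F -> 'M[F]_(m, p)) : regmx A -> regmx B -> regmx (fun z => A z + B z).
Proof. by move=> hA hB i j; apply: eq_reg (regD (hA i j) (hB i j)) => z; rewrite mxE. Qed.

Lemma regmxZ m p f (A : F -> 'M[F]_(m, p)) : reg f -> regmx A -> regmx (fun z => f z *: A z).
Proof. by move=> hf hA i j; apply: eq_reg (regM hf (hA i j)) => z; rewrite mxE. Qed.

Lemma regmxN m p (A : F -> 'M[F]_(m, p)) : regmx A -> regmx (fun z => - A z).
Proof. by move=> hA i j; apply: eq_reg (regN (hA i j)) => z; rewrite mxE. Qed.

Lemma regmxM m p q (A : F -> 'M[F]_(m, p)) (B : F -> 'M[F]_(p, q)) :
  regmx A -> regmx B -> regmx (fun z => A z *m B z).
Proof.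
move=> hA hB i j; apply: (eq_reg (f := fun z => \sum_k A z i k * B z k j)).
  by move=> z; rewrite mxE.
by apply: reg_sum => k; apply: regM.
Qed.

Lemma reg_det m (A : F -> 'M[F]_m) : regmx A -> reg (fun z => \det (A z)).
Proof.
move=> hA; apply: reg_sum => s; apply: regM; first exact: reg_cst.
by apply: reg_prod => i; apply: hA.
Qed.

Lemma regmx_ainv m (A : F -> 'M[F]_m) : regmx A -> A 0 \in unitmx -> regmx (fun z => ainv (A z)).
Proof.
move=> hA A0; apply: regmxZ.
  by apply: regV; [apply: reg_det|rewrite -unitfE -unitmxE].
move=> i j; apply: (eq_reg (f := fun z => (-1) ^+ (j + i) * \det (row' j (col' i (A z))))).
  by move=> z; rewrite mxE.
apply: regM; first exact: reg_cst.
by apply: reg_det => k l; apply: eq_reg (hA (lift j k) (lift i l)) => z; rewrite !mxE.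
Qed.

Lemma agerm_unitmx m (A : F -> 'M[F]_m) : regmx A -> A 0 \in unitmx ->
  agerm (fun z => A z \in unitmx).
Proof.
move=> hA A0; have := reg_neq0 (reg_det hA); rewrite -unitfE -unitmxE => /(_ A0).
by apply: agermW => z; rewrite unitmxE unitfE.
Qed.

End RegularMatrices.

(** * The dimension of a group of isometries and of its orbits *)

(** A subspace contained in P but different from it can be enlarged by a vector of P; the dimension
    of the ambient space stops this process. *)
Lemma exists_vspace (K : fieldType) (vT : vectType K) (P : vT -> Prop) :
  P 0 -> (forall a x y, P x -> P y -> P (a *: x + y)) ->
  exists V : {vspace vT}, forall x, x \in V <-> P x.
Proof.
move=> P0 Plin.
have grow k : (exists V : {vspace vT}, forall x, x \in V <-> P x) \/
    (exists V : {vspace vT}, (k <= \dim V)%N /\ forall x, x \in V -> P x).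
  elim: k => [|k [|[V [kV VP]]]]; first by right; exists 0%VS; split=> // x; rewrite memv0 => /eqP->.
    by left.
  have [[V' hV']|nV] := pselect (exists V : {vspace vT}, forall x, x \in V <-> P x).
    by left; exists V'.
  have [x Px xV] : exists2 x, P x & x \notin V.
    apply: contrapT => h; apply: nV; exists V => x; split=> [/VP//|Px].
    by apply: contrapT => /negP xV; apply: h; exists x.
  right; exists (V + <[x]>)%VS; split.
    rewrite dimv_disjoint_sum; last first.
      apply/eqP; rewrite -subv0; apply/subvP => y; rewrite memv_cap => /andP[yV /vlineP[a ya]].
      rewrite memv0; apply: contraNT xV => y0; have a0 : a != 0.
        by apply: contraNneq y0 => a0; rewrite ya a0 scale0r.
      by rewrite -[x](scalerK a0) -ya memvZ.
    have x0 : x != 0 by apply: contraNneq xV => ->; rewrite mem0v.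
    by rewrite dim_vline x0 addn1.
  move=> y /memv_addP[u /VP Pu [_ /vlineP[a ->] ->]].
  by rewrite addrC; apply: Plin.
have [//|[V [h _]]] := grow (\dim {:vT}).+1.
by have := dimvS (subvf V); rewrite leqNgt h.
Qed.

Lemma finite_span (K : fieldType) (vT : vectType K) (T : eqType) (P : T -> Prop) (A : T -> vT) :
  exists2 s : seq T, forall x, x \in s -> P x &
    forall x, P x -> A x \in <<map A s>>%VS.
Proof.
apply: contrapT => hn.
have grow k : exists2 s : seq T, forall x, x \in s -> P x & (k <= \dim <<map A s>>%VS)%N.
  elim: k => [|k [s sP ks]]; first by exists [::].
  have [x Px xs] : exists2 x, P x & A x \notin <<map A s>>%VS.
    apply: contrapT => h; apply: hn; exists s => // x Px.
    by apply: contrapT => /negP xV; apply: h; exists x.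
  exists (x :: s); first by move=> y; rewrite inE => /predU1P[->//|/sP].
  rewrite /= span_cons (leq_ltn_trans ks) // ltnNge; apply: contra xs => h.
  have /eqP -> : <<map A s>>%VS == (<[A x]> + <<map A s>>)%VS.
    by rewrite eqEdim addvSr h.
  exact: (subvP (addvSl _ _) _ (memv_line _)).
have [s _ h] := grow (\dim {:vT}).+1.
by have := dimvS (subvf <<map A s>>%VS); rewrite leqNgt h.
Qed.

Section Helpers.
Variables (F : closedFieldType).

Lemma paramW T (T0 : set T) Phi N c c' (phi : ('I_N -> F) -> T) delta : (c <= c')%N ->
  param T0 Phi c phi delta -> param T0 Phi c' phi delta.
Proof.
move=> cc [mu [h1 h2]]; exists mu; split=> // k f /h2[P hP PE]; exists P => //.
by apply: deg_leW hP; rewrite leq_mul2r cc orbT.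
Qed.

Lemma common_param T (T0 : set T) Phi N (I : finType) (phi : I -> ('I_N -> F) -> T) delta :
  (forall i, exists c, param T0 Phi c (phi i) delta) ->
  exists c, forall i, param T0 Phi c (phi i) delta.
Proof.
move=> h; exists (\max_i projT1 (cid (h i)))%N => i.
by apply: paramW (projT2 (cid (h i))); apply: (leq_bigmax i).
Qed.

Lemma linear_mx_sum m p (l : {scalar 'M[F]_(m, p)}) A :
  l A = \sum_i \sum_j A i j * l (delta_mx i j).
Proof.
rewrite {1}[A]matrix_sum_delta raddf_sum; apply: eq_bigr => i _.
by rewrite raddf_sum; apply: eq_bigr => j _; rewrite /= linearZ.
Qed.

Lemma reg_linear m p (l : {scalar 'M[F]_(m, p)}) (A : F -> 'M[F]_(m, p)) :
  regmx A -> reg (fun z => l (A z)).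
Proof.
move=> hA; apply: (eq_reg (f := fun z => \sum_i \sum_j A z i j * l (delta_mx i j))).
  by move=> z; rewrite -linear_mx_sum.
by do 2 (apply: reg_sum => ?); apply: regM; [apply: hA|apply: reg_cst].
Qed.

Lemma Phi_End_linear n (l : {scalar 'M[F]_n}) : Phi_End 1 (fun h => l (lin1_mx h)).
Proof.
exists (\sum_k l (vec_mx (delta_mx 0 k)) *: 'X_k).
  by apply: deg_le_sum => k _; apply: deg_leZ; rewrite /deg_le msizeX mdeg1.
move=> h; set A := lin1_mx h.
have {1}-> : A = \sum_k mxvec A 0 k *: vec_mx (delta_mx 0 k).
  rewrite -{1}[A]mxvecK {1}(row_sum_delta (mxvec A)) raddf_sum.
  by apply: eq_bigr => k _; rewrite /= linearZ.
rewrite !raddf_sum; apply: eq_bigr => k _ /=.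
by rewrite linearZ mevalZ mevalXU mulrC.
Qed.

End Helpers.

Section Dimension.
Variables (F : closedFieldType) (n : nat) (J : 'M[F]_n).
Hypotheses (F2 : (2%:R : F) != 0) (Ju : J \in unitmx).
Variables (Xs : seq {vspace 'rV[F]_n}).

(* The functions [h |-> \det (g + h)] span a finite dimensional space, hence
   finitely many translates of the domain of the Cayley transform cover the group. *)
Lemma finite_cover : exists l (g : 'I_l -> 'M[F]_n), (forall i, inG J Xs (g i)) /\
  forall h, inG J Xs h -> exists i, 1%:M + h *m invmx (g i) \in unitmx.
Proof.
(* Writing g + h as the product of the block row (g, 1) and the block column (1, h) makes its
   determinant a pairing of a vector depending on g with one depending on h. *)
pose A (g : 'M[F]_n) : 'rV[F]_#|{ffun 'I_n -> 'I_(n + n)}| := \row_(k < #|{ffun 'I_n -> 'I_(n + n)}|) \det (colsub (enum_val k) (row_mx g 1%:M)).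
pose B (h : 'M[F]_n) : 'cV[F]_#|{ffun 'I_n -> 'I_(n + n)}| := \col_(k < #|{ffun 'I_n -> 'I_(n + n)}|) \prod_j (col_mx 1%:M h) (enum_val k j) j.
have AB g h : \det (g + h) = (A g *m B h) 0 0.
  have -> : g + h = row_mx g 1%:M *m col_mx 1%:M h by rewrite mul_row_col mulmx1 mul1mx.
  rewrite det_mulmx_colsub mxE (reindex (fun k : 'I_#|{ffun 'I_n -> 'I_(n + n)}| => enum_val k)) /=; last exact/onW_bij/enum_val_bij.
  by apply: eq_bigr => k _; rewrite !mxE mulrC.
have [s sG sp] := finite_span (inG J Xs) A.
exists (size s), (fun i => nth 0 s i); split; first by move=> i; apply: sG; apply: mem_nth.
move=> h hG; apply: contrapT => hn.
have z g : g \in s -> \det (g + h) = 0.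
  move=> gs; apply/eqP; apply: contraT => d0; case: hn.
  have i1 : (index g s < size s)%N by rewrite index_mem.
  exists (Ordinal i1); rewrite /= nth_index //.
  have gu := inG_unit Ju (sG g gs).
  have -> : 1%:M + h *m invmx g = (g + h) *m invmx g by rewrite mulmxDl mulmxV.
  by rewrite unitmx_mul unitmx_inv gu andbT unitmxE unitfE.
have hu := inG_unit Ju hG.
have : (<<map A s>> <= lker (linfun (mulmxr (B h))))%VS.
  apply/span_subvP => _ /mapP[g gs ->]; rewrite memv_ker lfunE /=.
  by apply/eqP/matrixP => i j; rewrite !ord1 -AB z // mxE.
(* The vanishing extends from the chosen translates to h itself: 0 = det (h + h) = 2 ^ n det h,
   which is impossible when 2 is invertible. *)
move/subvP/(_ _ (sp h hG)); rewrite memv_ker lfunE /= => /eqP/matrixP/(_ 0 0).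
rewrite -AB mxE -mulr2n -scaler_nat detZ => /eqP.
by rewrite mulf_eq0 expf_eq0 (negPf F2) andbF /= -[_ == 0]negbK -unitfE -unitmxE hu.
Qed.

Lemma ainv1 : ainv 1%:M = 1%:M :> 'M[F]_n.
Proof. by rewrite ainvE ?unitmx1 ?invmx1. Qed.

Lemma cayley0 : cayley 0 = 1%:M :> 'M[F]_n.
Proof. by rewrite /cayley addr0 subr0 ainv1 mulmx1. Qed.

Lemma inL0 : inL J Xs 0.
Proof.
split=> [|X _]; first by rewrite trmx0 mul0mx mulmx0 addr0.
by apply/sub_fmxP => u _; rewrite mulmx0 mem0v.
Qed.

Lemma inL_lin a x y : inL J Xs x -> inL J Xs y -> inL J Xs (a *: x + y).
Proof.
move=> [x1 x2] [y1 y2]; split=> [|X XX]; last first.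
  by apply: sub_fmxD; [apply/sub_fmxZ/x2|apply: y2].
rewrite linearD linearZ /= mulmxDl mulmxDr -scalemxAl -scalemxAr addrACA -scalerDr x1 y1.
by rewrite scaler0 addr0.
Qed.

Variable L : {vspace 'M[F]_n}.
Hypothesis hL : forall x, x \in L <-> inL J Xs x.

Lemma mxcomb_basis (V : {vspace 'M[F]_n}) (t : 'I_(\dim V) -> F) :
  mxcomb (fun i => (vbasis V)`_i) t \in V.
Proof.
by apply: memv_suml => i _; rewrite memvZ // vbasis_mem // mem_nth // size_tuple.
Qed.

Lemma mxcomb_coord (V : {vspace 'M[F]_n}) x : x \in V ->
  mxcomb (fun i => (vbasis V)`_i) (fun i => coord (vbasis V) i x) = x.
Proof. by move=> xV; rewrite [RHS](coord_vbasis xV). Qed.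

Lemma coord_mxcomb (V : {vspace 'M[F]_n}) (t : 'I_(\dim V) -> F) i :
  coord (vbasis V) i (mxcomb (fun i => (vbasis V)`_i) t) = t i.
Proof. exact: coord_sum_free (basis_free (vbasisP V)). Qed.

Lemma mxcombZ N (e : 'I_N -> 'M[F]_n) z t :
  mxcomb e (fun i => z * t i) = z *: mxcomb e t.
Proof. by rewrite scaler_sumr; apply: eq_bigr => i _; rewrite scalerA. Qed.

Lemma gen_det_unit N (e : 'I_N -> 'M[F]_n) t :
  ((gen_det e).@[t] != 0) = (1%:M + mxcomb e t \in unitmx).
Proof. by rewrite gen_detE unitmxE unitfE. Qed.

Lemma regmx_line (x : 'M[F]_n) : regmx (fun z => 1%:M + z *: x).
Proof. by apply: regmxD; [|apply: regmxZ; [apply: reg_id|]]; apply: regmx_cst. Qed.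

Lemma agerm_line (x : 'M[F]_n) : agerm (fun z => 1%:M + z *: x \in unitmx).
Proof. by apply: agerm_unitmx; [apply: regmx_line|rewrite scale0r addr0 unitmx1]. Qed.

Lemma regmx_line_ainv (x : 'M[F]_n) : regmx (fun z => ainv (1%:M + z *: x)).
Proof. by apply: regmx_ainv; [apply: regmx_line|rewrite scale0r addr0 unitmx1]. Qed.

Lemma regmx_cayley (x : 'M[F]_n) : regmx (fun z => cayley (z *: x)).
Proof.
apply: regmxM; last exact: regmx_line_ainv.
apply: eq_regmx (regmx_line (- x)) => z; by rewrite scalerN.
Qed.

Theorem dim_group :
  has_dimension (@zariski_closed_End F n) [set h | inG J Xs (lin1_mx h)]%classic (\dim L).
Proof.
set N := \dim L; pose e (i : 'I_N) := (vbasis L)`_i.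
have AT : ([set h | inG J Xs (lin1_mx h)] `<=` setT)%classic by [].
split; last first.
  have [l [g [gG hg]]] := finite_cover.
  have [c hc] := common_param (fun i => param_End e (g i)).
  apply: (dim_upper (graded_End F n) AT hc).
  move=> k f _ hf h hG; have [i hi] := hg _ hG.
  have gu := inG_unit Ju (gG i).
  have xL : cayley (lin1_mx h *m invmx (g i)) \in L.
    by apply/hL/cayley_inL => //; apply: inGM => //; apply: inGV.
  have := hf i (fun j => coord (vbasis L) j (cayley (lin1_mx h *m invmx (g i)))).
  rewrite gen_det_unit mxcomb_coord // cayleyK // mulmxKV // lin1_mxK; apply.
  exact: cayley_add1_unit.
have [c hc] := param_End e 1%:M.
(* The coordinates of (1 - h) / 2, where [coord] is used as a linear functional on all matrices: (1
   - h) / 2 need not lie in [L]. At h = cayley (z x) its first-order term is z x. *)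
pose y (l : 'I_N) (h : 'End('rV[F]_n)) :=
  - 2%:R^-1 * coord (vbasis L) l (lin1_mx h) + 2%:R^-1 * coord (vbasis L) l 1%:M * 1.
have one1 : @Phi_End F n 1 (fun=> 1 : F).
  by exists 1 => [|h]; [apply: deg_leW (deg_le1 _ _)|rewrite meval1].
apply: (dim_lower (graded_End F n) AT hc (y0 := fun=> 1) (y := y)) => //.
- move=> t; rewrite gen_det_unit => tu /=; rewrite fmxK mulmx1; apply: cayley_inG => //.
  by apply/hL/mxcomb_basis.
- move=> l; apply: (gt_lin (graded_End F n) (- 2%:R^-1) (f := fun h => coord (vbasis L) l (lin1_mx h))
    (g := fun=> 2%:R^-1 * coord (vbasis L) l 1%:M * 1)).
    exact: Phi_End_linear.
  exact: (gt_scale (graded_End F n)).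
move=> v; pose x := mxcomb e v.
exists (fun z l => coord (vbasis L) l (x *m ainv (1%:M + z *: x))); split.
- move=> l; apply: (reg_linear (coord (vbasis L) l) (A := fun z => x *m ainv (1%:M + z *: x))).
  by apply: regmxM; [apply: regmx_cst|apply: regmx_line_ainv].
- by move=> l; rewrite scale0r addr0 ainv1 mulmx1 coord_mxcomb.
apply: agermW (agerm_line x) => z zu; split; rewrite ?oner_neq0 //.
  by rewrite gen_det_unit mxcombZ.
move=> l; rewrite /y fmxK mulmx1 mxcombZ mulr1 mulNr addrC mulr1 -mulrBr -linearB.
rewrite one_sub_cayley // linearZ /= mulKf // -scalemxAl linearZ /=.
by [].
Qed.

End Dimension.

(** * The dimension of an orbit *)

Section DimensionOrbit.
Variables (F : closedFieldType) (n : nat) (J : 'M[F]_n).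
Hypotheses (F2 : (2%:R : F) != 0) (Ju : J \in unitmx).
Variables (Xs : seq {vspace 'rV[F]_n}) (S : {vspace 'rV[F]_n}).
Variables (L LS : {vspace 'M[F]_n}).
Hypothesis hL : forall x, x \in L <-> inL J Xs x.
Hypothesis hLS : forall x, x \in LS <-> inL J (S :: Xs) x.

Definition replace_col m p (i : 'I_p) (u : 'cV[F]_m) (A : 'M[F]_(m, p)) :=
  \matrix_(a, b) (if b == i then u a 0 else A a b).

Lemma mul_replace_col q m p (i : 'I_p) (u : 'cV[F]_m) (A : 'M[F]_(m, p)) (B : 'M[F]_(q, m)) :
  B *m replace_col i u A = replace_col i (B *m u) (B *m A).
Proof.
apply/matrixP => a b; rewrite !mxE; case: eqP => bi; rewrite ?mxE;
  by apply: eq_bigr => k _; rewrite !mxE ?bi ?eqxx //; case: eqP.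
Qed.

Lemma det_replace_colZ m (i : 'I_m) z (u : 'cV[F]_m) (A : 'M[F]_m) :
  \det (replace_col i (z *: u) A) = z * \det (replace_col i u A).
Proof.
rewrite !(expand_det_col _ i) big_distrr /=; apply: eq_bigr => k _.
rewrite !mxE eqxx -mulrA; congr (_ * (_ * _)).
rewrite /cofactor; congr (_ * \det _).
by apply/matrixP => a b; rewrite !mxE eq_sym (negPf (neq_lift _ _)).
Qed.

Lemma det_replace_col1 m (i : 'I_m) (u : 'cV[F]_m) :
  \det (replace_col i u 1%:M) = u i 0.
Proof.
have adj1 : \adj (1%:M : 'M[F]_m) = 1%:M.
  by have := mul_mx_adj (1%:M : 'M[F]_m); rewrite mul1mx det1.
have cof k : cofactor (replace_col i u 1%:M) k i = (k == i)%:R.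
  have := congr1 (fun B : 'M[F]_m => B i k) adj1; rewrite [LHS]mxE [RHS]mxE eq_sym => <-.
  rewrite /cofactor; congr (_ * \det _).
  by apply/matrixP => a b; rewrite !mxE [_ == i]eq_sym (negPf (neq_lift _ _)).
rewrite (expand_det_col _ i) (bigD1 i) //= big1 ?addr0 => [|k ki].
  by rewrite cof mxE !eqxx mulr1.
by rewrite cof (negPf ki) mulr0.
Qed.

Lemma LS_sub : (LS <= L)%VS.
Proof.
apply/subvP => x /hLS[h1 h2]; apply/hL; split=> // X XX; apply: h2.
by rewrite inE XX orbT.
Qed.

Lemma regmx_replace_col m p (i : 'I_p) (u : F -> 'cV[F]_m) (A : F -> 'M[F]_(m, p)) :
  regmx u -> regmx A -> regmx (fun z => replace_col i (u z) (A z)).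
Proof.
move=> hu hA a b; apply: (eq_reg (f := fun z => if b == i then u z a 0 else A z a b)).
  by move=> z; rewrite mxE.
by case: (b == i).
Qed.

(* With [L = LS + Q], a function that vanishes on the translates of [cayley Q]
   vanishes on those of [cayley L]: near the identity every [cayley x] with [x] in
   [L] is the product of some [cayley x2] fixing [S] and some [cayley x1] with [x1]
   in [Q], at least to first order, which is enough by [dominant_eq0]. *)
Lemma orbit_upper (A := [set (fmx g @: S)%VS | g in inG J Xs]%classic) :
  ~ irreducible_chain (@zariski_closed_Gr F n (\dim S)) A (\dim L - \dim LS).+1.
Proof.
set r := \dim S; have dS : \dim S = r by [].
pose Q := (L :\: LS)%VS.
have dQ : \dim Q = (\dim L - \dim LS)%N.
  by have := dimv_cap_compl L LS; rewrite (capv_idPr LS_sub) => <-; rewrite addKn.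
have QL : (Q <= L)%VS by apply: diffvSl.
rewrite -dQ.
pose e (i : 'I_(\dim Q)) := (vbasis Q)`_i; pose e' (i : 'I_(\dim L)) := (vbasis L)`_i.
have uL x : x \in L -> 1%:M + x \in unitmx -> cayley x \in unitmx.
  by move=> /hL hx xu; apply: (inG_unit Ju (cayley_inG Ju hx xu)).
have AT : (A `<=` [set X | \dim X = r])%classic.
  by move=> _ [g gG <-] /=; rewrite dim_fmx //; apply: (inG_unit Ju gG).
have [l [g [gG hg]]] := finite_cover F2 Ju Xs.
have gu i := inG_unit Ju (gG i).
have eu t : 1%:M + mxcomb e t \in unitmx -> cayley (mxcomb e t) \in unitmx.
  by apply: uL; apply: (subvP QL); apply: mxcomb_basis.
have [c hc] := common_param (fun i => param_Gr (e := e) dS (gu i) eu).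
apply: (dim_upper (graded_Gr F n r) AT hc).
move=> k f hf f0 _ [h hG <-]; have [i hi] := hg _ hG.
have eu' t : 1%:M + mxcomb e' t \in unitmx -> cayley (mxcomb e' t) \in unitmx.
  by apply: uL; apply: mxcomb_basis.
have [c' [mu [hmu hP]]] := param_Gr (e := e') dS (gu i) eu'.
have [P Pdeg PE] := hP k f hf.
have xL : cayley (h *m invmx (g i)) \in L.
  by apply/hL/cayley_inL => //; apply: inGM => //; apply: inGV.
(* [P] is f in the full chart of [L] whose translate contains h. It has to vanish identically,
   although f is only known to vanish on the charts of [Q]. *)
suff P0 : P = 0.
  have := PE (fun j => coord (vbasis L) j (cayley (h *m invmx (g i)))).
  rewrite gen_det_unit mxcomb_coord // cayleyK // mulmxKV // P0 meval0 mulr0; apply.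
  exact: cayley_add1_unit.
apply: dominant_eq0 => v; pose x := mxcomb e' v.
have xinL : x \in L by apply: mxcomb_basis.
have [x1 [x2 [x1Q x2S xE]]] : exists x1 x2, [/\ x1 \in Q, x2 \in LS & x = x2 + x1].
  have : x \in (Q + LS)%VS.
    by have := addv_diff_cap L LS; rewrite (capv_idPr LS_sub) => ->.
  by case/memv_addP => y1 y1Q [y2 y2S ->]; exists y1, y2; rewrite addrC.
pose a1 z := x1 *m ainv (1%:M + z *: x1); pose a2 z := x2 *m ainv (1%:M + z *: x2).
pose G z := cayley (z *: x2) *m cayley (z *: x1).
(* Chosen such that z W(z) = cayley (G z): it is 1 - G z divided by z, followed by the inverse of 1
   + G z. Thus the point of the full chart at z W(z) is exactly the product [G z]. *)
pose W z := (2%:R *: a2 z + 2%:R *: a1 z - (4%:R * z) *: (a2 z *m a1 z)) *m ainv (1%:M + G z).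
have ra1 : regmx a1 by apply: regmxM; [apply: regmx_cst|apply: regmx_line_ainv].
have ra2 : regmx a2 by apply: regmxM; [apply: regmx_cst|apply: regmx_line_ainv].
have rG : regmx (fun z => 1%:M + G z).
  by apply: regmxD; [apply: regmx_cst|apply: regmxM; apply: regmx_cayley].
have G0 : 1%:M + G 0 = 2%:R *: 1%:M.
  by rewrite /G !scale0r cayley0 mulmx1 scaler_nat mulr2n.
have G0u : 1%:M + G 0 \in unitmx by rewrite G0 unitmxZ ?unitfE // unitmx1.
have rW : regmx W.
  apply: regmxM; last by apply: regmx_ainv.
  apply: regmxD; first by apply: regmxD; apply: regmxZ => //; apply: reg_cst.
  apply: regmxN; apply: regmxZ; last exact: regmxM.
  by apply: regM; [apply: reg_cst|apply: reg_id].
have W0 : W 0 = x.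
  rewrite /W /a1 /a2 !scale0r !addr0 ainv1 !mulmx1 mulr0 scale0r subr0 G0 -scalerDr.
  rewrite ainvE -?G0 // G0 invmxZ -?G0 // invmx1 -scalemxAr mulmx1 scalerA mulVf // scale1r.
  by [].
exists (fun z j => coord (vbasis L) j (W z)); split.
- by move=> j; apply: (reg_linear (coord (vbasis L) j) rW).
- by move=> j; rewrite W0 coord_mxcomb.
have := agerm_and (agerm_and (agerm_line x1) (agerm_line x2))
          (agerm_and (agerm_neq0 F) (agerm_unitmx rG G0u)).
apply: agermW => z [[u1 u2] [z0 uG]].
have x1L : inL J Xs (z *: x1) by apply/hL; rewrite memvZ //; apply: (subvP QL).
have x2L : inL J (S :: Xs) (z *: x2) by apply/hLS; rewrite memvZ.
have x2L' : inL J Xs (z *: x2) by apply/hL; rewrite memvZ //; apply: (subvP LS_sub).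
have gz : inG J Xs (G z) by apply: inGM; apply: cayley_inG.
have zW : z *: W z = cayley (G z).
  rewrite /cayley /W scalemxAl; congr (_ *m _).
  rewrite /G !cayley_line // -/(a1 z) -/(a2 z); move: (a1 z) (a2 z) => b1 b2.
  have -> : 1%:M - (1%:M - (2%:R * z) *: b2) *m (1%:M - (2%:R * z) *: b1) =
      (2%:R * z) *: b2 + (2%:R * z) *: b1 - ((2%:R * z) * (2%:R * z)) *: (b2 *m b1).
    rewrite mulmxBl mul1mx mulmxBr mulmx1 -scalemxAl -scalemxAr scalerA.
    by rewrite !opprB addrC addrA subrK addrAC.
  rewrite scalerBr scalerDr !scalerA; congr (_ *: _ + _ *: _ - _ *: _); ring.
have WL : W z \in L.
  rewrite -[W z](scalerK z0) zW memvZ //; apply/hL; exact: cayley_inL.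
have zw : mxcomb e' (fun j => z * coord (vbasis L) j (W z)) = cayley (G z).
  by rewrite mxcombZ mxcomb_coord.
have du : (gen_det e').@[fun j => z * coord (vbasis L) j (W z)] != 0.
  by rewrite gen_det_unit zw; apply: cayley_add1_unit.
have := PE _ du; rewrite zw cayleyK //.
(* The factor coming from [LS] acts first and fixes S; what is left is a point of the chart of [Q],
   where f vanishes. *)
have -> : (fmx (G z *m g i) @: S = fmx (cayley (z *: x1) *m g i) @: S)%VS.
  rewrite /G -mulmxA limg_fmxM; congr (_ @: _)%VS.
  by have [_] := cayley_inG Ju x2L u2; apply; rewrite inE eqxx.
have := f0 i (fun j => z * coord (vbasis Q) j x1).
rewrite gen_det_unit mxcombZ mxcomb_coord // => ->// /esym/eqP.
by rewrite mulf_eq0 expf_eq0 (negPf (proj2 (hmu _ du))) andbF /= => /eqP.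
Qed.


Lemma Phi_Gr_minor r (E : 'M[F]_(n, r)) :
  Phi_Gr r 1 (fun S' : {vspace 'rV[F]_n} => \sum_(f : {ffun 'I_r -> 'I_n})
     (\prod_j E (f j) j) * @pluecker F n r S' (enum_rank f)).
Proof.
exists (\sum_(f : {ffun 'I_r -> 'I_n}) (\prod_j E (f j) j) *: 'X_(enum_rank f)).
  by apply: rpred_sum => f _; apply: rpredZ; rewrite dhomogX /= mdeg1.
by move=> S'; rewrite raddf_sum; apply: eq_bigr => f _; rewrite /= mevalZ mevalXU.
Qed.

Lemma minor_rows r (E : 'M[F]_(n, r)) (S' : {vspace 'rV[F]_n}) la (M : 'M[F]_(r, n)) :
  (forall k, @pluecker F n r S' k = la * \det (colsub (enum_val k) M)) ->
  \sum_(f : {ffun 'I_r -> 'I_n}) (\prod_j E (f j) j) * @pluecker F n r S' (enum_rank f) =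
  la * \det (M *m E).
Proof.
move=> h; rewrite det_mulmx_colsub big_distrr /=; apply: eq_bigr => f _.
by rewrite h enum_rankK mulrCA.
Qed.

(* The tangent map at 0 of [t |-> cayley (x t)] is [t |-> M *m x t *m K], which is
   injective on [Q]; it is read off the minors [\det (M *m g *m E')], where [E'] is
   the right inverse [E] of [M] with one column replaced by one of [K]. *)
Lemma orbit_lower (A := [set (fmx g @: S)%VS | g in inG J Xs]%classic) :
  irreducible_chain (@zariski_closed_Gr F n (\dim S)) A (\dim L - \dim LS).
Proof.
set r := \dim S; have dS : \dim S = r by [].
pose Q := (L :\: LS)%VS.
have dQ : \dim Q = (\dim L - \dim LS)%N.
  by have := dimv_cap_compl L LS; rewrite (capv_idPr LS_sub) => <-; rewrite addKn.
have QL : (Q <= L)%VS by apply: diffvSl.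
rewrite -dQ.
pose e (i : 'I_(\dim Q)) := (vbasis Q)`_i.
have eL t : mxcomb e t \in L by apply: (subvP QL); apply: mxcomb_basis.
have uL x : x \in L -> 1%:M + x \in unitmx -> cayley x \in unitmx.
  by move=> /hL hx xu; apply: (inG_unit Ju (cayley_inG Ju hx xu)).
have AT : (A `<=` [set X | \dim X = r])%classic.
  by move=> _ [g gG <-] /=; rewrite dim_fmx //; apply: (inG_unit Ju gG).
have eu t : 1%:M + mxcomb e t \in unitmx -> cayley (mxcomb e t) \in unitmx by apply: uL.
have [c hc] := param_Gr (e := e) dS (unitmx1 F n) eu.
pose M := rows_of r S; pose E := pinvmx M; pose K := cokermx M.
have ME : M *m E = 1%:M by apply: mulmxVp; apply: row_free_rows_of.
have MK : M *m K = 0 by apply: mulmx_coker.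
pose T (t : 'rV[F]_(\dim Q)) := M *m mxcomb e (fun i => t 0 i) *m K.
have Tlin : linear T.
  move=> b t t'; rewrite /T scalemxAl -mulmxDl; congr (_ *m _).
  rewrite scalemxAr -mulmxDr; congr (_ *m _).
  rewrite scaler_sumr -big_split; apply: eq_bigr => i _.
  by rewrite !mxE /= scalerDl scalerA.
pose TL := GRing.isLinear.Build _ _ _ _ T Tlin.
pose Tl : {linear 'rV[F]_(\dim Q) -> 'M[F]_(r, n)} := HB.pack T TL.
(* The equation M x K = 0 says that x maps S into itself; then x lies in [LS], which meets [Q] only
   in 0. *)
have Tker : lker (linfun Tl) == 0%VS.
  apply/lker0P => t t'; rewrite !lfunE /= => /eqP; rewrite -subr_eq0 -[Tl t - _]linearB /=.
  rewrite -/(T _) /T => /eqP h0.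
  set s := t - t' in h0; set x := mxcomb _ _ in h0.
  have xQ : x \in Q by apply: mxcomb_basis.
  have xL : x \in L by apply: (subvP QL).
  have xLS : x \in LS.
    apply/hLS; have [h1 h2] := (hL x).1 xL; split=> // X; rewrite inE => /predU1P[->|]; last exact: h2.
    apply/sub_fmxP => u; rewrite !(mem_rows_of _ dS) -/M => /submxP[d ->].
    by rewrite submxE -!mulmxA [M *m _]mulmxA h0 mulmx0.
  have x0 : x = 0.
    apply/eqP; rewrite -memv0 -(capv_diff L LS) memv_cap xQ.
    by [].
  apply/eqP; rewrite -subr_eq0 -/s; apply/eqP/rowP => i; rewrite [RHS]mxE.
  by have := coord_mxcomb (fun i => s 0 i) i; rewrite -/x x0 linear0.
pose H := (linfun Tl)^-1%VF.
have HT t : H (T t) = t by have := lker0_lfunK Tker t; rewrite lfunE.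
pose mn (E' : 'M[F]_(n, r)) (S' : {vspace 'rV[F]_n}) := \sum_(f : {ffun 'I_r -> 'I_n})
     (\prod_j E' (f j) j) * @pluecker F n r S' (enum_rank f).
pose Eij (p : 'I_r * 'I_n) := replace_col p.1 (col p.2 K) E.
(* [H] inverts the tangent map, and - 1 / 2 cancels the derivative - 2 x of the Cayley transform
   along x. *)
pose C l (p : 'I_r * 'I_n) := - 2%:R^-1 * H (delta_mx p.1 p.2) 0 l.
pose y l S' := \sum_p C l p * mn (Eij p) S'.
apply: (dim_lower (graded_Gr F n r) AT hc (y0 := mn E) (y := y)).
- move=> t; rewrite gen_det_unit => tu; exists (cayley (mxcomb e t) *m 1%:M) => //.
  by rewrite mulmx1; apply: cayley_inG => //; apply/hL.
- exact: Phi_Gr_minor.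
- by move=> l; apply: (gt_sum (graded_Gr F n r)) => p; apply: Phi_Gr_minor.
move=> v; pose x := mxcomb e v.
pose a z := x *m ainv (1%:M + z *: x).
(* The matrix of the minor for [Eij p] with the factor z removed from its exceptional column; this
   factor is there because M K = 0. *)
pose Qz p z := replace_col p.1 (- 2%:R *: (M *m a z *m col p.2 K)) (M *m cayley (z *: x) *m E).
pose Dz z := \det (M *m cayley (z *: x) *m E).
have ra : regmx a by apply: regmxM; [apply: regmx_cst|apply: regmx_line_ainv].
have rM : regmx (fun z => M *m cayley (z *: x) *m E).
  by apply: regmxM; [apply: regmxM; [|apply: regmx_cayley]|]; apply: regmx_cst.
have rD : reg Dz by apply: reg_det.
have D0 : Dz 0 = 1 by rewrite /Dz scale0r cayley0 mulmx1 ME det1.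
have rQ p : reg (fun z => \det (Qz p z)).
  apply: reg_det; apply: regmx_replace_col => //; apply: regmxZ; first exact: reg_cst.
  by apply: regmxM; [apply: regmxM|]; first apply: regmx_cst; last apply: regmx_cst.
have D0' : Dz 0 != 0 by rewrite D0 oner_neq0.
exists (fun z l => (\sum_p C l p * \det (Qz p z)) * (Dz z)^-1); split.
- move=> l; apply: regM; last exact: regV.
  by apply: reg_sum => p; apply: regM; first exact: reg_cst.
- move=> l; rewrite D0 invr1 mulr1.
  have -> : v l = H (T (\row_i v i)) 0 l by rewrite HT mxE.
  have -> : T (\row_i v i) = M *m x *m K.
    by congr (_ *m _ *m _); apply: eq_bigr => i _; rewrite mxE.
  rewrite [M *m x *m K]matrix_sum_delta pair_bigA /= raddf_sum summxE; apply: eq_bigr => p _.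
  rewrite /= linearZ mxE /Qz /a !scale0r addr0 ainv1 cayley0 !mulmx1 ME det_replace_col1.
  have -> : M *m x *m col p.2 K = col p.2 (M *m x *m K) by rewrite !colE mulmxA.
  rewrite 2!mxE /C; set h := H _ 0 l; set b := (M *m x *m K) _ _.
  by field.
have := agerm_and (agerm_line x) (reg_neq0 rD D0').
apply: agermW => z [zu Dn0] /=.
set S' := (_ @: S)%VS.
have gu : cayley (z *: x) \in unitmx by apply: uL => //; rewrite memvZ //; apply: eL.
have S'E : S' = (fmx (cayley (z *: x)) @: S)%VS by rewrite /S' mulmx1 mxcombZ.
have dS' : \dim S' = r by rewrite S'E dim_fmx.
have hS' u : (u \in S') = (u <= M *m cayley (z *: x))%MS.
  by rewrite S'E; apply: mem_limg_fmx.
have [la0 hla] := pluecker_rows dS' hS'.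
split.
- by rewrite gen_det_unit mxcombZ.
- by rewrite /mn (minor_rows _ hla) mulf_neq0.
move=> l; rewrite [mn E S'](minor_rows _ hla) -/(Dz z).
set la := \det _ in la0 hla *.
have e1 p : \det (M *m cayley (z *: x) *m Eij p) = z * \det (Qz p z).
  rewrite /Eij mul_replace_col /Qz -det_replace_colZ; congr (\det (replace_col _ _ _)).
  rewrite cayley_line // -/(a z) mulmxBr mulmx1 mulmxBl -scalemxAr -scalemxAl scalerA mulrN scaleNr.
  have -> : M *m col p.2 K = 0 by rewrite colE mulmxA MK mul0mx.
  by rewrite sub0r mulrC.
rewrite /y (eq_bigr (fun p => (la * z) * (C l p * \det (Qz p z)))); last first.
  by move=> p _; rewrite [mn _ S'](minor_rows _ hla) e1; ring.
by rewrite -big_distrr /=; field.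
Qed.

End DimensionOrbit.

(** * The Lie algebra of the stabilizer *)

Lemma dim_coordinates (K : fieldType) (vT : vectType K) (V : {vspace vT}) (J : finType)
    (phi : J -> vT -> K) :
  (forall j a x y, phi j (a *: x + y) = a * phi j x + phi j y) ->
  (forall x, x \in V -> (forall j, phi j x = 0) -> x = 0) ->
  (forall y : J -> K, exists2 x, x \in V & forall j, phi j x = y j) ->
  \dim V = #|J|.
Proof.
move=> lin inj surj.
pose T x : 'rV[K]_#|J| := \row_j phi (enum_val j) x.
have Tlin : linear T by move=> a x y; apply/rowP => j; rewrite !mxE lin.
pose TL := GRing.isLinear.Build _ _ _ _ T Tlin.
pose Tl : {linear vT -> 'rV[K]_#|J|} := HB.pack T TL.
have <- : \dim (linfun Tl @: V) = \dim V.
  apply: limg_dim_eq; apply/eqP; rewrite -subv0; apply/subvP => x.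
  rewrite memv_cap memv_ker lfunE /= -/(T x) memv0 => /andP[xV /eqP h].
  apply/eqP/inj => // j; have := congr1 (fun r : 'rV_#|J| => r 0 (enum_rank j)) h.
  by rewrite !mxE enum_rankK.
have -> : (linfun Tl @: V)%VS = fullv.
  apply/eqP; rewrite eqEsubv subvf; apply/subvP => r _.
  have [x xV hx] := surj (fun j => r 0 (enum_rank j)).
  have -> : r = linfun Tl x by rewrite lfunE /= -/(T x); apply/rowP => j; rewrite mxE hx enum_valK.
  exact: memv_img.
by rewrite dimvf /dim /= mul1n.
Qed.

(** * Skew arrays with prescribed zeros and linked entries *)

Section SkewPatterns.
Variables (F : fieldType) (I : finType) (A Lk : rel I) (sg : I -> I).
Hypotheses (F2 : (2%:R : F) != 0) (Asym : ssrbool.symmetric A) (Lsym : ssrbool.symmetric Lk).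
Hypothesis LA : forall i j, Lk i j -> A i j.
Hypothesis LsgA : forall i j, Lk i j -> A (sg i) (sg j).
Hypothesis LsgL : forall i j, Lk i j -> ~~ Lk (sg i) (sg j).

(** An entry at a position of [Lk] is minus the entry at the position moved by [sg], which [LsgL]
    keeps outside [Lk]: dependent entries refer directly to free ones. *)
Definition admissible (X : I -> I -> F) := [/\ forall i j, X j i = - X i j,
  forall i j, ~~ A i j -> X i j = 0 & forall i j, Lk i j -> X i j = - X (sg i) (sg j)].

(** The enumeration of [I] merely selects one of (i, j) and (j, i). The diagonal is left out because
    skew entries vanish there in characteristic other than 2. *)
Definition free_pair (p : I * I) :=
  [&& (enum_rank p.1 < enum_rank p.2)%N, A p.1 p.2 & ~~ Lk p.1 p.2].

Definition free_index := {p : I * I | free_pair p}.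

Lemma skew_diag (X : I -> I -> F) i : (forall i j, X j i = - X i j) -> X i i = 0.
Proof.
move=> /(_ i i)/eqP; rewrite -subr_eq0 opprK -mulr2n -mulr_natl mulf_eq0 (negPf F2) /=.
by move/eqP.
Qed.

Lemma admissible_eq0 X : admissible X ->
  (forall p : free_index, X (val p).1 (val p).2 = 0) -> forall i j, X i j = 0.
Proof.
move=> [Xs XA XL] X0.
have noL i j : A i j -> ~~ Lk i j -> X i j = 0.
  move=> Aij Lij; case: (ltngtP (enum_rank i) (enum_rank j)) => h.
  - have fp : free_pair (i, j) by rewrite /free_pair /= h Aij.
    by have := X0 (Sub (i, j) fp); rewrite SubK.
  - have fp : free_pair (j, i) by rewrite /free_pair /= h Asym Aij Lsym.
    by rewrite Xs; have := X0 (Sub (j, i) fp); rewrite SubK => ->; rewrite oppr0.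
  - by have /enum_rank_inj -> := val_inj h; apply: skew_diag.
move=> i j; case: (boolP (A i j)) => [Aij|]; last exact: XA.
case: (boolP (Lk i j)) => [Lij|]; last exact: noL.
by rewrite XL // noL ?oppr0 ?LsgA ?LsgL.
Qed.

Lemma admissible_exists (y : free_index -> F) : exists2 X, admissible X &
  forall p : free_index, X (val p).1 (val p).2 = y p.
Proof.
pose X0 i j := if insub (i, j) is Some p then y p else
   if insub (j, i) is Some p then - y p else 0.
have X0s i j : X0 j i = - X0 i j.
  rewrite /X0; case: insubP => [p|]; case: insubP => [q|] /=; rewrite ?opprK ?oppr0 //.
  by move=> /and3P[/ltnW]; rewrite /= leqNgt => h _ _ _ /and3P[]; rewrite /= (negPf h).
have X0n i j : ~~ A i j || Lk i j -> X0 i j = 0.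
  rewrite /X0 => h; rewrite !insubN // /free_pair /= !negb_and negbK.
    by rewrite Asym Lsym h orbT.
  by rewrite h orbT.
exists (fun i j => if Lk i j then - X0 (sg i) (sg j) else X0 i j).
  split=> i j.
  - by rewrite Lsym; case: ifP => _; rewrite X0s.
  - move=> nA; case: ifP => [/LA|_]; first by rewrite (negPf nA).
    by apply: X0n; rewrite nA.
  - by move=> Lij; rewrite Lij (negPf (LsgL Lij)).
move=> p; have := valP p; rewrite /free_pair => /and3P[h1 h2 h3].
by rewrite (negPf h3) /X0 -surjective_pairing valK.
Qed.

(** The positions allowed and not linked consist of diagonal ones and of two copies of the free
    ones, exchanged by swapping coordinates; doubling avoids a division in the naturals. *)
Lemma card_free_index : (2 * #|{: free_index}| + #|[set i | A i i && ~~ Lk i i]| =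
  #|[set p : I * I | A p.1 p.2 && ~~ Lk p.1 p.2]|)%N.
Proof.
pose R p := A p.1 p.2 && ~~ Lk p.1 p.2.
pose lt (p : I * I) := (enum_rank p.1 < enum_rank p.2)%N.
pose sw (p : I * I) := (p.2, p.1).
have c1 : #|{: free_index}| = #|[set p | R p && lt p]|.
  rewrite card_sig; apply: eq_card => p; rewrite !inE /R /lt.
    by rewrite /free_pair andbC.
have c2 : #|{: free_index}| = #|[set p | R p && lt (sw p)]|.
  rewrite c1 -(card_imset _ (_ : injective sw)); last by move=> [a b] [c d] [-> ->].
  apply: eq_card => p; apply/imsetP/idP => [[q]|]; rewrite inE => /andP[h1 h2].
    move=> ->; rewrite inE /R /= Asym Lsym; apply/andP; split=> //.
  exists (sw p); last by case: (p).
  by rewrite inE /R /= Asym Lsym; apply/andP.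
have c3 : #|[set i | A i i && ~~ Lk i i]| = #|[set p | R p && (p.1 == p.2)]|.
  rewrite -(card_imset _ (_ : injective (fun i : I => (i, i)))); last by move=> a b [].
  apply: eq_card => p; apply/imsetP/idP => [[i]|]; rewrite inE.
    by move=> h ->; rewrite inE /R /= h eqxx.
  by case: p => a b /andP[/= h /eqP e]; exists a; rewrite ?inE -?e // /R /= {2 4}e.
rewrite mul2n -addnn {1}c1 c2 c3.
rewrite -[RHS](cardsID [set p | lt p]) -addnA; congr (_ + _)%N.
  by apply: eq_card => p; rewrite !inE.
rewrite -[RHS](cardsID [set p | lt (sw p)]); congr (_ + _)%N; apply: eq_card => p; rewrite !inE.
  rewrite /lt /sw /= -leqNgt andbC; case: ltngtP; rewrite ?andbF ?andbT //.
rewrite /lt /sw /= -!leqNgt -(inj_eq (@enum_rank_inj I)) -val_eqE eqn_leq /= -/(R p).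
by case: (R p); rewrite ?andbF ?andbT.
Qed.

End SkewPatterns.

(** * A basis of V adapted to U, W, S and the orthogonal of S *)

Section AdaptedBasis.
Variables (F : fieldType) (n : nat) (J : 'M[F]_n).
Hypotheses (F2 : (2%:R : F) != 0) (Ju : J \in unitmx) (Jsym : J^T = J).

Definition bil (u v : 'rV[F]_n) := (u *m J *m v^T) 0 0.

Variable perp : {vspace 'rV[F]_n} -> {vspace 'rV[F]_n}.
Hypothesis perpP : forall Y u, u \in perp Y <-> forall y, y \in Y -> bil u y = 0.

Lemma bil_sym u v : bil u v = bil v u.
Proof.
have -> : bil u v = ((u *m J *m v^T)^T) 0 0 by rewrite mxE.
by rewrite !trmx_mul trmxK Jsym mulmxA.
Qed.

Lemma dim_perp Y : \dim (perp Y) = (n - \dim Y)%N.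
Proof.
pose A := J *m (rows_of (\dim Y) Y)^T.
have h u : (u \in perp Y) = (u <= kermx A)%MS.
  apply/idP/sub_kermxP => [/perpP h|h].
    apply/rowP => i; rewrite mulmxA [RHS]mxE -[RHS](h (row i (rows_of (\dim Y) Y))).
      by rewrite /bil mxE [RHS]mxE; apply: eq_bigr => j _; rewrite !mxE.
    by rewrite (mem_rows_of _ (erefl _)) row_sub.
  apply/perpP => y; rewrite (mem_rows_of _ (erefl _)) => /submxP[c ->].
  by rewrite /bil trmx_mul !mulmxA -[u *m J *m _]mulmxA h mul0mx mxE.
have -> : \dim (perp Y) = \rank (kermx A).
  have := row_free_rows_of (erefl (\dim (perp Y))); rewrite -row_leq_rank => r1.
  apply/eqP; rewrite eqn_leq (leq_trans r1) /=; last first.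
    by apply/mxrankS/rV_subP => u; rewrite -(mem_rows_of _ (erefl _)) h.
  rewrite -[X in (_ <= X)%N](eqP (row_free_rows_of (erefl (\dim (perp Y))))).
  by apply/mxrankS/rV_subP => u; rewrite -(mem_rows_of _ (erefl _)) h.
rewrite mxrank_ker; congr (_ - _)%N.
rewrite (eqmxMfull _ _) ?row_full_unit // mxrank_tr.
exact/eqP/row_free_rows_of.
Qed.

Lemma perpK Y : perp (perp Y) = Y.
Proof.
have dn (X : {vspace 'rV[F]_n}) : (\dim X <= n)%N.
  by apply: leq_trans (dimvS (subvf X)) _; rewrite dimvf /dim /= mul1n.
apply/esym/eqP; rewrite eqEdim !dim_perp subKn // leqnn andbT.
by apply/subvP => y yY; apply/perpP => z /perpP h; rewrite bil_sym; apply: h.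
Qed.

Lemma perpD X Y : perp (X + Y) = (perp X :&: perp Y)%VS.
Proof.
apply/vspaceP => u; rewrite memv_cap; apply/idP/andP => [/perpP h|[/perpP hX /perpP hY]].
  split; apply/perpP => y yX; apply: h; first by apply: (subvP (addvSl _ _)).
  by apply: (subvP (addvSr _ _)).
apply/perpP => _ /memv_addP[x xX [y yY ->]].
by rewrite /bil linearD /= mulmxDr mxE -/(bil u x) -/(bil u y) hX // hY // addr0.
Qed.

(** Indexing the two summands by a boolean lets each statement about U also serve for W. *)
Variables (Us : bool -> {vspace 'rV[F]_n}) (S : {vspace 'rV[F]_n}).
Hypotheses (Usum : (Us true + Us false)%VS = fullv) (Ucap : (Us true :&: Us false)%VS = 0%VS).
Hypothesis Uperp : forall s, perp (Us s) = Us (~~ s).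
Hypothesis Siso : (S <= perp S)%VS.

Let S' := perp S.
Definition proj s := daddv_pi (Us s) (Us (~~ s)).

Lemma Ucaps s : (Us s :&: Us (~~ s))%VS = 0%VS.
Proof. by case: s; rewrite //= capvC. Qed.

Lemma proj_mem s u : proj s u \in Us s.
Proof. exact: memv_pi. Qed.

Lemma proj_add u : proj true u + proj false u = u.
Proof. by apply: daddv_pi_add => //; rewrite Usum memvf. Qed.

Lemma proj_id s u : u \in Us s -> proj s u = u.
Proof. by apply: daddv_pi_id; apply: Ucaps. Qed.

Lemma proj_id' s u : u \in Us (~~ s) -> proj s u = 0.
Proof.
move=> us; have := proj_add u; have := proj_id us; case: s us => /= us e.
  by rewrite e -[RHS]add0r => /addIr.
by rewrite e -[RHS]addr0 => /addrI.
Qed.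

Lemma lker_proj s : lker (proj s) = Us (~~ s).
Proof.
apply/vspaceP => u; rewrite memv_ker; apply/eqP/idP => [h|]; last exact: proj_id'.
have := proj_add u; have := proj_mem (~~ s) u; case: s h => /= h us; rewrite h.
  by rewrite add0r => <-.
by rewrite addr0 => <-.
Qed.

Lemma dim_proj s X : (\dim (X :&: Us (~~ s)) + \dim (proj s @: X))%N = \dim X.
Proof. by rewrite -lker_proj limg_ker_dim. Qed.

(* With [S] contained in [S' = perp S], both [Us s] for [s = true, false] get a basis
   made of [Kv s], of the projections of [Rv], [Pv], [Tv], and of [Qv s], [Lv s]; then
   [S] is spanned by [Kv], [Rv], [Pv], and [S'] by [S], [Tv], [Qv] and the projections
   of [Rv]. *)
Definition Kv s := (S :&: Us s)%VS.
Definition Dv s := (S' :&: Us s)%VS.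
Definition Nv := (S :&: (Dv true + Dv false))%VS.
Definition Rv := (Nv :\: (Kv true + Kv false))%VS.
Definition Pv := (S :\: Nv)%VS.
Definition Qv s := (Dv s :\: proj s @: Nv)%VS.
Definition Tv := (S' :\: (S + (Dv true + Dv false)))%VS.
Definition Lv s := (Us s :\: proj s @: S')%VS.

Lemma proj_DD s u : u \in (Dv true + Dv false)%VS -> proj s u \in Dv s.
Proof.
case/memv_addP => x xD [y yD ->].
have xU := subvP (capvSr _ _) _ xD; have yU := subvP (capvSr _ _) _ yD.
rewrite linearD /=; case: s.
  by rewrite (proj_id xU) (@proj_id' true y) // addr0.
by rewrite (proj_id yU) (@proj_id' false x) // add0r.
Qed.

Lemma Kv_sub s : (Kv s <= Dv s)%VS.
Proof. by apply: capvS. Qed.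

Lemma KK_sub : (Kv true + Kv false <= Nv)%VS.
Proof.
rewrite subv_cap; apply/andP; split; first by rewrite subv_add !capvSl.
by apply: addvS; apply: Kv_sub.
Qed.

Lemma projN_sub s : (proj s @: Nv <= Dv s)%VS.
Proof.
by apply/subvP => _ /memv_imgP[u uN ->]; apply/proj_DD/(subvP (capvSr _ _) _ uN).
Qed.

Lemma S_DD_sub : (S + (Dv true + Dv false) <= S')%VS.
Proof. by rewrite !subv_add Siso !capvSl. Qed.

Lemma projS'_sub s : (proj s @: S' <= Us s)%VS.
Proof. by apply/subvP => _ /memv_imgP[u _ ->]; apply: proj_mem. Qed.

Lemma N_sub : (Nv <= S)%VS. Proof. exact: capvSl. Qed.

Lemma N_capU s : (Nv :&: Us s)%VS = Kv s.
Proof.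
apply/eqP; rewrite eqEsubv; apply/andP; split; first by apply: capvS => //; apply: N_sub.
rewrite subv_cap capvSr andbT; apply: subv_trans KK_sub.
by case: s; [apply: addvSl|apply: addvSr].
Qed.

Lemma dim_diff (X Y : {vspace 'rV[F]_n}) : (Y <= X)%VS -> (\dim (X :\: Y) + \dim Y)%N = \dim X.
Proof. by move=> YX; rewrite -[RHS](dimv_cap_compl X Y) (capv_idPr YX) addnC. Qed.

(** The form puts T in duality with R, and L with K on each side. Numerically this follows from Dv s
    being the orthogonal of S + Us (~~ s), from the dimension of an orthogonal and from rank-nullity
    for the projections. *)
Lemma dim_facts :
  [/\ \dim Tv = \dim Rv,
      forall s, \dim (Lv s) = \dim (Kv s),
      \dim S = (\dim (Kv true) + \dim (Kv false) + \dim Rv + \dim Pv)%N,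
      forall s, \dim (Us s) =
        (2 * \dim (Kv s) + 2 * \dim Rv + \dim Pv + \dim (Qv s))%N &
      n = (\dim (Us true) + \dim (Us false))%N].
Proof.
clear F2; have nE : n = (\dim (Us true) + \dim (Us false))%N.
  by rewrite -dimv_disjoint_sum // Usum dimvf /dim /= mul1n.
have KK0 : (Kv true :&: Kv false)%VS = 0%VS.
  by apply/eqP; rewrite -subv0 -Ucap; apply: capvS; apply: capvSr.
have DD0 : (Dv true :&: Dv false)%VS = 0%VS.
  by apply/eqP; rewrite -subv0 -Ucap; apply: capvS; apply: capvSr.
have e1 := dim_diff KK_sub; rewrite (dimv_disjoint_sum KK0) in e1.
have e2 := dim_diff N_sub.
have e3 s : (\dim (Dv s) + \dim S + \dim (Us (~~ s)))%N = (n + \dim (Kv (~~ s)))%N.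
  have eD : Dv s = perp (S + Us (~~ s)) by rewrite perpD Uperp negbK.
  have := dimv_sum_cap S (Us (~~ s)); rewrite -/(Kv _) eD dim_perp.
  have : (\dim (S + Us (~~ s)) <= n)%N.
    by apply: leq_trans (dimvS (subvf _)) _; rewrite dimvf /dim /= mul1n.
  lia.
have e4 s : (\dim (Qv s) + (\dim (proj s @: Nv)))%N = \dim (Dv s) := dim_diff (projN_sub s).
have e4' s := dim_proj s Nv; have e4'' s := congr1 (fun X => \dim X) (N_capU s).
have e5 := dim_diff S_DD_sub.
have e5' := dimv_sum_cap S (Dv true + Dv false); rewrite -/Nv (dimv_disjoint_sum DD0) in e5'.
have e6 s := dim_diff (projS'_sub s); have e6' s := dim_proj s S'.
have dS' : \dim S' = (n - \dim S)%N := dim_perp S.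
have rn : (\dim S <= n)%N.
  by apply: leq_trans (dimvS (subvf _)) _; rewrite dimvf /dim /= mul1n.
move: (e3 true) (e3 false) (e4 true) (e4 false) (e4' true) (e4' false) (e4'' true) (e4'' false)
  (e6 true) (e6 false) (e6' true) (e6' false); rewrite /= -/(Rv) -/(Pv) -/(Tv) -/(Lv true) -/(Lv false)
  -/(Dv true) -/(Dv false) dS' in e1 e2 e5 *.
split; first lia.
- case; lia.
- lia.
- case; lia.
- exact: nE.
Qed.


(** A vector of R, P or T contributes a basis vector on each side, namely its two projections; this
    doubling is what will link entries of the two sides. *)
Definition shared := ('I_(\dim Rv) + 'I_(\dim Pv) + 'I_(\dim Tv))%type.
Definition own s := ('I_(\dim (Kv s)) + 'I_(\dim (Qv s)) + 'I_(\dim (Lv s)))%type.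
Definition idx : finType := {s : bool & (shared + own s)%type}.

Definition shared_vec (z : shared) : 'rV[F]_n := match z with
  | inl (inl i) => (vbasis Rv)`_i
  | inl (inr i) => (vbasis Pv)`_i
  | inr i => (vbasis Tv)`_i
  end.

Definition own_vec s (o : own s) : 'rV[F]_n := match o with
  | inl (inl i) => (vbasis (Kv s))`_i
  | inl (inr i) => (vbasis (Qv s))`_i
  | inr i => (vbasis (Lv s))`_i
  end.

Definition side_vec s (x : shared + own s) : 'rV[F]_n :=
  match x with inl z => proj s (shared_vec z) | inr o => own_vec o end.

Definition vec (i : idx) : 'rV[F]_n := side_vec (tagged i).

(* The blocks of the basis: R = 0, P = 1, T = 2, K = 3, Q = 4, L = 5. *)
Definition blk s (x : shared + own s) : nat := match x with
  | inl (inl (inl _)) => 0 | inl (inl (inr _)) => 1 | inl (inr _) => 2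
  | inr (inl (inl _)) => 3 | inr (inl (inr _)) => 4 | inr (inr _) => 5
  end.

Lemma img_basis_sub (X E : {vspace 'rV[F]_n}) (f : 'End('rV[F]_n)) :
  (forall i : 'I_(\dim X), f (vbasis X)`_i \in E) -> (f @: X <= E)%VS.
Proof.
move=> h; apply/subvP => _ /memv_imgP[u uX ->].
rewrite (coord_vbasis uX) linear_sum memv_suml // => i _.
by rewrite linearZ memvZ ?h.
Qed.

Lemma basis_sub (X E : {vspace 'rV[F]_n}) :
  (forall i : 'I_(\dim X), (vbasis X)`_i \in E) -> (X <= E)%VS.
Proof.
move=> h; rewrite -[X]lim1g; apply: img_basis_sub => i.
by rewrite id_lfunE.
Qed.

Lemma mem_basis (X : {vspace 'rV[F]_n}) (i : 'I_(\dim X)) : (vbasis X)`_i \in X.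
Proof. by rewrite vbasis_mem // mem_nth // size_tuple. Qed.

(** The span is shown to contain the projections of N, S, S' and finally each side, every step
    adding one complement. Freeness needs no separate argument, since the number of vectors is n. *)
Lemma vec_span : (\sum_(i : idx) <[vec i]>)%VS = fullv.
Proof.
set E := (\sum_(i : idx) _)%VS.
have vE i : vec i \in E by apply: (subvP (sumv_sup i _ (subvv _))) => //; apply: memv_line.
have vE' s x : @side_vec s x \in E by apply: (vE (existT _ s x)).
have shE s (X : {vspace 'rV[F]_n}) Y : (X <= Y)%VS -> (proj s @: (Y :\: X) <= E)%VS ->
    (proj s @: X <= E)%VS -> (proj s @: Y <= E)%VS.
  by move=> XY h1 h2; rewrite -(addv_diff_cap Y X) (capv_idPr XY) limgD subv_add h1.
have KE s : (Kv s <= E)%VS by apply: basis_sub => i; apply: (vE' s (inr (inl (inl i)))).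
have projU s (X : {vspace 'rV[F]_n}) : (X <= Us s)%VS -> (proj s @: X)%VS = X.
  move=> XU; apply/vspaceP => u; apply/memv_imgP/idP => [[w wX ->]|uX].
    by rewrite proj_id // (subvP XU).
  by exists u => //; rewrite proj_id // (subvP XU).
have projU' s (X : {vspace 'rV[F]_n}) : (X <= Us (~~ s))%VS -> (proj s @: X)%VS = 0%VS.
  move=> XU; apply/eqP; rewrite -subv0; apply/subvP => _ /memv_imgP[w wX ->].
  by rewrite (proj_id' (subvP XU _ wX)) mem0v.
have NE s : (proj s @: Nv <= E)%VS.
  apply: (shE s _ _ KK_sub); first by apply: img_basis_sub => i; apply: (vE' s (inl (inl (inl i)))).
  rewrite limgD subv_add; case: s.
    by rewrite (projU true) ?capvSr // (projU' true) ?capvSr // KE sub0v.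
  by rewrite (projU' false) ?capvSr // (projU false) ?capvSr // KE sub0v.
have SE s : (proj s @: S <= E)%VS.
  by apply: (shE s _ _ N_sub) => //; apply: img_basis_sub => i; apply: (vE' s (inl (inl (inr i)))).
have DE s : (Dv s <= E)%VS.
  rewrite -(addv_diff_cap (Dv s) (proj s @: Nv)) (capv_idPr (projN_sub s)) subv_add NE andbT.
  by apply: basis_sub => i; apply: (vE' s (inr (inl (inr i)))).
have S'E s : (proj s @: S' <= E)%VS.
  apply: (shE s _ _ S_DD_sub).
    by apply: img_basis_sub => i; apply: (vE' s (inl (inr i))).
  rewrite !limgD !subv_add SE; case: s.
    by rewrite (projU true) ?capvSr // (projU' true) ?capvSr // DE sub0v.
  by rewrite (projU' false) ?capvSr // (projU false) ?capvSr // DE sub0v.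
have UE s : (Us s <= E)%VS.
  rewrite -(addv_diff_cap (Us s) (proj s @: S')) (capv_idPr (projS'_sub s)) subv_add S'E andbT.
  by apply: basis_sub => i; apply: (vE' s (inr (inr i))).
by apply/eqP; rewrite eqEsubv subvf -Usum subv_add !UE.
Qed.

Lemma card_idx : #|idx| = n.
Proof.
have [e1 e2 e3 e4 e5] := dim_facts.
rewrite card_tagged /= sumnE big_map big_enum /= big_bool /= !card_sum !card_ord.
have := e4 true; have := e4 false; have := e2 true; have := e2 false; lia.
Qed.

Definition vec_mx : 'M[F]_(#|idx|, n) := \matrix_(i < #|idx|) vec (enum_val i).

Lemma vec_mx_full : row_full vec_mx.
Proof.
rewrite -sub1mx; apply/rV_subP => u _.
have : u \in (\sum_(i : idx) <[vec i]>)%VS by rewrite vec_span memvf.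
case/memv_sumP => w hw ->; apply: summx_sub => i _.
have /vlineP[c ->] := hw i isT; apply: scalemx_sub.
have -> : vec i = row (enum_rank i) vec_mx by rewrite rowK enum_rankK.
exact: row_sub.
Qed.

Lemma vec_mx_free : row_free vec_mx.
Proof. by rewrite /row_free; have := vec_mx_full; rewrite /row_full => /eqP ->; rewrite card_idx. Qed.

Definition aform (x : 'M[F]_n) (u w : 'rV[F]_n) := bil (u *m x) w.

Lemma aformDl x u u' w : aform x (u + u') w = aform x u w + aform x u' w.
Proof. by rewrite /aform /bil !mulmxDl mxE. Qed.

Lemma aformDr x u w w' : aform x u (w + w') = aform x u w + aform x u w'.
Proof. by rewrite /aform /bil linearD /= mulmxDr mxE. Qed.

Lemma aformZl x c u w : aform x (c *: u) w = c * aform x u w.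
Proof. by rewrite /aform /bil -!scalemxAl mxE. Qed.

Lemma aformZr x c u w : aform x u (c *: w) = c * aform x u w.
Proof. by rewrite /aform /bil linearZ /= -scalemxAr mxE. Qed.

Lemma aform_suml x (I : Type) (r : seq I) (P : pred I) (f : I -> 'rV[F]_n) w :
  aform x (\sum_(i <- r | P i) f i) w = \sum_(i <- r | P i) aform x (f i) w.
Proof.
elim/big_rec2: _ => [|i u v _ <-]; last by rewrite aformDl.
by rewrite -[0](scale0r 0) aformZl mul0r.
Qed.

Lemma aform_sumr x (I : Type) (r : seq I) (P : pred I) (f : I -> 'rV[F]_n) u :
  aform x u (\sum_(i <- r | P i) f i) = \sum_(i <- r | P i) aform x u (f i).
Proof.
elim/big_rec2: _ => [|i w v _ <-]; last by rewrite aformDr.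
by rewrite -[0](scale0r 0) aformZr mul0r.
Qed.

Definition aorth x (Y Z : {vspace 'rV[F]_n}) :=
  forall u w, u \in Y -> w \in Z -> aform x u w = 0.

Lemma sub_fmx_aorth x Y : (fmx x @: Y <= Y)%VS <-> aorth x Y (perp Y).
Proof.
split=> [/sub_fmxP h u w uY /perpP|h].
  by move=> /(_ _ (h u uY)); rewrite bil_sym.
apply/sub_fmxP => u uY; rewrite -[Y]perpK; apply/perpP => w wY; exact: h.
Qed.

Lemma skew_aform x : x *m J + J *m x^T = 0 <-> forall u w, aform x w u = - aform x u w.
Proof.
have e u w : aform x u w + aform x w u = (u *m (x *m J + J *m x^T) *m w^T) 0 0.
  by rewrite [aform x w u]bil_sym /aform /bil trmx_mul mulmxDr mulmxDl !mulmxA [RHS]mxE.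
split=> [h u w|h].
  by apply/eqP; rewrite -addr_eq0 addrC e h mulmx0 mul0mx mxE.
apply/matrixP => i j; rewrite [RHS]mxE.
have := e (delta_mx 0 i) (delta_mx 0 j); rewrite h addNr => ->.
by rewrite -rowE trmx_delta -colE !mxE.
Qed.

Lemma inL_aform x : inL J [:: S; Us true; Us false] x <->
  [/\ forall u w, aform x w u = - aform x u w, forall s, aorth x (Us s) (Us (~~ s)) &
      aorth x S S'].
Proof.
split=> [[/skew_aform h hX]|[h1 h2 h3]].
  split=> // [s|]; last by apply/sub_fmx_aorth/hX; rewrite inE eqxx.
  rewrite -Uperp; apply/sub_fmx_aorth/hX.
  by case: s; rewrite !inE eqxx ?orbT.
split; first exact/skew_aform.
move=> X; rewrite !inE => /or3P[]/eqP ->; apply/sub_fmx_aorth => //; rewrite Uperp;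
  by [apply: (h2 true)|apply: (h2 false)].
Qed.


(* For [x] in the Lie algebra of the stabilizer, the skew form [aform x] can be
   nonzero only between [allowed] blocks of the same side, and on the [linked] pairs
   of blocks its values on the two sides are opposite. *)
Definition allowed (x y : nat) : bool :=
  ([|| x == 5, y == 5, (x == 2) && (y != 3),
    (y == 2) && (x != 3), (x == 1) && (y == 1) | (x == 4) && (y == 4)])%N.

Definition linked (x y : nat) : bool :=
  ([|| (x < 2) && (y == 2), (x == 2) && (y < 2) | (x == 1) && (y == 1)])%N.

Definition Arel : rel idx := fun i j =>
  (tag i == tag j) && allowed (blk (tagged i)) (blk (tagged j)).

(** Of two opposite entries, the one on the side [false] is declared dependent. *)
Definition Lrel : rel idx := fun i j =>
  [&& ~~ tag i, ~~ tag j & linked (blk (tagged i)) (blk (tagged j))].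

Definition mkidx s (x : shared + own s) : idx := existT _ s x.

(** The value on the blocks K, Q, L is a default: linked pairs only involve shared vectors. *)
Definition flip (i : idx) : idx :=
  match tagged i with inl z => mkidx (s := ~~ tag i) (inl z) | inr _ => i end.

Lemma side_vec_mem s (x : shared + own s) : side_vec x \in Us s.
Proof.
case: x => [z|[[i|i]|i]] /=; first exact: proj_mem.
- by apply: (subvP (capvSr _ _)); apply: mem_basis.
- apply: (subvP (capvSr S' _)); apply: (subvP (diffvSl _ (proj s @: Nv))); exact: mem_basis.
- by apply: (subvP (diffvSl _ (proj s @: S'))); apply: mem_basis.
Qed.

Lemma shared_vec_sum z : shared_vec z =
  side_vec (inl z : shared + own true) + side_vec (inl z : shared + own false).
Proof. by rewrite /= proj_add. Qed.

Lemma aorth_S x (Z : {vspace 'rV[F]_n}) : (forall z : shared, (blk (inl z : shared + own true) < 2)%N ->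
     forall w, w \in Z -> aform x (shared_vec z) w = 0) ->
  (forall s (i : 'I_(\dim (Kv s))) w, w \in Z -> aform x ((vbasis (Kv s))`_i) w = 0) -> aorth x S Z.
Proof.
move=> hz hK.
have D X Y : aorth x X Z -> aorth x Y Z -> aorth x (X + Y) Z.
  move=> hX hY u w /memv_addP[u1 uX [u2 uY ->]] wZ.
  by rewrite aformDl hX // hY // addr0.
have bs X : (forall (i : 'I_(\dim X)) w, w \in Z -> aform x (vbasis X)`_i w = 0) -> aorth x X Z.
  move=> h u w uX wZ; rewrite (coord_vbasis uX) aform_suml big1 // => i _.
  by rewrite aformZl h // mulr0.
rewrite -(addv_diff_cap S Nv) (capv_idPr N_sub).
apply: (D); first by apply: (bs) => i; apply: (hz (inl (inr i)) isT).
rewrite -(addv_diff_cap Nv (Kv true + Kv false)) (capv_idPr KK_sub).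
apply: (D); first by apply: (bs) => i; apply: (hz (inl (inl i)) isT).
by apply: (D); apply: (bs) => i; apply: hK.
Qed.

Lemma aform_S'_eq0 x u : (forall z, aform x u (shared_vec z) = 0) ->
  (forall s (o : own s), (blk (inr o) < 5)%N -> aform x u (own_vec o) = 0) ->
  (forall s (i : 'I_(\dim Rv)), aform x u (proj s (vbasis Rv)`_i) = 0) ->
  forall w, w \in S' -> aform x u w = 0.
Proof.
move=> hz ho hR.
pose ou (X : {vspace 'rV[F]_n}) := forall w, w \in X -> aform x u w = 0.
have D X Y : ou X -> ou Y -> ou (X + Y)%VS.
  by move=> hX hY w /memv_addP[w1 wX [w2 wY ->]]; rewrite aformDr hX // hY // addr0.
have bs X : (forall i : 'I_(\dim X), aform x u (vbasis X)`_i = 0) -> ou X.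
  move=> h w wX; rewrite (coord_vbasis wX) aform_sumr big1 // => i _.
  by rewrite aformZr h mulr0.
have N_ou s : ou (proj s @: Nv)%VS.
  move=> _ /memv_imgP[w wN ->]; move: wN.
  rewrite -(addv_diff_cap Nv (Kv true + Kv false)) (capv_idPr KK_sub).
  case/memv_addP => w1 w1R [_ /memv_addP[k1 k1K [k2 k2K ->]] ->].
  have e1 : aform x u (proj s w1) = 0.
    rewrite (coord_vbasis w1R) linear_sum aform_sumr big1 // => i _.
    by rewrite linearZ aformZr hR mulr0.
  have e2 : aform x u (proj s (k1 + k2)) = 0.
    have k1U := subvP (capvSr _ _) _ k1K; have k2U := subvP (capvSr _ _) _ k2K.
    have K0 s' : ou (Kv s') by apply: (bs) => i; apply: (ho s' (inl (inl i)) isT).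
    rewrite linearD /=; case: s {e1}.
      by rewrite (proj_id k1U) (@proj_id' true _ k2U) addr0; apply: K0 k1K.
    by rewrite (proj_id k2U) (@proj_id' false _ k1U) add0r; apply: K0 k2K.
  by rewrite linearD aformDr e1 e2 addr0.
have D_ou s : ou (Dv s).
  rewrite -(addv_diff_cap (Dv s) (proj s @: Nv)) (capv_idPr (projN_sub s)).
  by apply: (D) => //; apply: (bs) => i; apply: (ho s (inl (inr i)) isT).
rewrite -/(ou S') -(addv_diff_cap S' (S + (Dv true + Dv false))) (capv_idPr S_DD_sub).
apply: (D); first by apply: (bs) => i; apply: (hz (inr i)).
apply: (D); last by apply: (D).
rewrite -(addv_diff_cap S Nv) (capv_idPr N_sub).
apply: (D); first by apply: (bs) => i; apply: (hz (inl (inr i))).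
rewrite -(addv_diff_cap Nv (Kv true + Kv false)) (capv_idPr KK_sub).
apply: (D); first by apply: (bs) => i; apply: (hz (inl (inl i))).
by apply: (D); apply: (bs) => i; [apply: (ho true (inl (inl i)) isT)|apply: (ho false (inl (inl i)) isT)].
Qed.

Lemma admissible_inL x :
  admissible Arel Lrel flip (fun i j => aform x (vec i) (vec j)) ->
  (forall u w, aform x w u = - aform x u w) ->
  (forall s, aorth x (Us s) (Us (~~ s))) -> aorth x S S'.
Proof.
move=> [Xs XA XL] sk hU.
have nA s s' (p : shared + own s) (q : shared + own s') : ~~ ((s == s') && allowed (blk p) (blk q)) ->
    aform x (side_vec p) (side_vec q) = 0.
  by move=> h; apply: (XA (mkidx p) (mkidx q)).
apply: aorth_S => [z z2|s i]; apply: aform_S'_eq0.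
- move=> z'; rewrite !shared_vec_sum !(aformDl, aformDr).
  rewrite (nA true false) // (nA false true) // addr0 add0r.
  (* Without the cross terms the value is the sum of the contributions of the two sides: they cancel
     on linked blocks and are both 0 otherwise. *)
  have [lk|nlk] := boolP (linked (blk (inl z : shared + own true)) (blk (inl z' : shared + own true))).
    have := XL (mkidx (s := false) (inl z)) (mkidx (s := false) (inl z')).
    by rewrite /Lrel /= => /(_ lk); rewrite /vec /= => ->; rewrite addrN.
  have al : ~~ allowed (blk (inl z : shared + own true)) (blk (inl z' : shared + own true)).
    by case: z z2 nlk => [[?|?]|?] //; case: z' => [[?|?]|?].
  by rewrite (nA true) // (nA false) ?addr0.
- move=> s o o5; rewrite shared_vec_sum aformDl -[own_vec o]/(side_vec (inr o : shared + own s)).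
  have al s' : ~~ allowed (blk (inl z : shared + own s')) (blk (inr o : shared + own s)).
    by case: z z2 => [[?|?]|?] //; case: o o5 => [[?|?]|?].
  by rewrite !nA ?addr0 // negb_and al orbT.
- move=> s j; rewrite shared_vec_sum aformDl.
  rewrite -[proj s _]/(side_vec (inl (inl (inl j)) : shared + own s)).
  have al s' : ~~ allowed (blk (inl z : shared + own s')) (blk (inl (inl (inl j)) : shared + own s)).
    by case: z z2 => [[?|?]|?].
  by rewrite !nA ?addr0 // negb_and al orbT.
- move=> z; rewrite shared_vec_sum aformDr -[(vbasis _)`_i]/(side_vec (inr (inl (inl i)) : shared + own s)).
  by rewrite !nA ?addr0 // negb_and; case: z => [[?|?]|?]; rewrite orbT.
- move=> s' o o5; rewrite -[(vbasis _)`_i]/(side_vec (inr (inl (inl i)) : shared + own s)).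
  rewrite -[own_vec o]/(side_vec (inr o : shared + own s')) nA // negb_and.
  by case: o o5 => [[?|?]|?] // _; rewrite orbT.
- move=> s' j; rewrite -[(vbasis _)`_i]/(side_vec (inr (inl (inl i)) : shared + own s)).
  by rewrite -[proj s' _]/(side_vec (inl (inl (inl j)) : shared + own s')) nA // negb_and orbT.
Qed.

Lemma inL_admissible x :
  (forall u w, aform x w u = - aform x u w) ->
  (forall s, aorth x (Us s) (Us (~~ s))) -> aorth x S S' ->
  admissible Arel Lrel flip (fun i j => aform x (vec i) (vec j)).
Proof.
move=> sk hU hS.
have cross s s' (p : shared + own s) (q : shared + own s') : s != s' ->
    aform x (side_vec p) (side_vec q) = 0.
  move=> ss; apply: (hU s); first exact: side_vec_mem.
  have -> : ~~ s = s' by case: s s' ss {p q} => [] [].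
  exact: side_vec_mem.
have shS (z : shared) : (blk (inl z : shared + own true) < 2)%N -> shared_vec z \in S.
  case: z => [[i|i]|i] //= _.
    by apply: (subvP N_sub); apply: (subvP (diffvSl _ (Kv true + Kv false))); apply: mem_basis.
  by apply: (subvP (diffvSl _ Nv)); apply: mem_basis.
have shS' (z : shared) : shared_vec z \in S'.
  case: z => [z|i]; last by apply: (subvP (diffvSl _ (S + (Dv true + Dv false)))); apply: mem_basis.
  by apply: (subvP Siso); apply: shS; case: z.
have split_l z s (q : shared + own s) : aform x (shared_vec z) (side_vec q) =
    aform x (side_vec (inl z : shared + own s)) (side_vec q).
  rewrite shared_vec_sum aformDl; case: s q => q.
    by rewrite (cross false) // addr0.
  by rewrite (cross true) // add0r.
(* The vectors of the blocks R, K, Q on a side lie in S' themselves; for P and T, only the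
   unprojected vectors are known to lie in S'. *)
have z0 s (p q : shared + own s) : ((blk p < 2) || (blk p == 3))%N ->
    (blk q \in [:: 0; 3; 4])%N -> aform x (side_vec p) (side_vec q) = 0.
  move=> hp hq.
  have qS' : side_vec q \in S'.
    apply: (subvP (capvSl _ (Us s))); rewrite -/(Dv s).
    case: q hq => [[[i|i]|i]|[[i|i]|i]] //= _.
    - apply: (subvP (projN_sub s)); apply: memv_img.
      by apply: (subvP (diffvSl _ (Kv true + Kv false))); apply: mem_basis.
    - by apply: (subvP (Kv_sub s)); apply: mem_basis.
    - by apply: (subvP (diffvSl _ (proj s @: Nv))); apply: mem_basis.
  case: p hp => [z hp|[[i|i]|i]] //.
    by rewrite -split_l; apply: hS qS'; apply: shS; case: z hp => [[?|?]|?].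
  by move=> _; apply: hS qS'; apply: (subvP (capvSl _ (Us s))); apply: mem_basis.
have KT s (i : 'I_(\dim (Kv s))) (j : 'I_(\dim Tv)) :
    aform x (side_vec (inr (inl (inl i)) : shared + own s)) (side_vec (inl (inr j) : shared + own s)) = 0.
  have e := split_l (inr j) s (inr (inl (inl i))).
  rewrite sk -e sk opprK; apply: hS; last exact: shS'.
  by apply: (subvP (capvSl _ (Us s))); apply: mem_basis.
split=> [i j|[s p] [s' q]|[s p] [s' q]]; first exact: sk.
- rewrite /Arel /vec /=; have [e|ss _] := eqVneq s s'; last exact: cross.
  subst s' => /= nal.
  have : [|| ((blk p < 2) || (blk p == 3)) && (blk q \in [:: 0; 3; 4]),
    ((blk q < 2) || (blk q == 3)) && (blk p \in [:: 0; 3; 4]),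
    (blk p == 3) && (blk q == 2) | (blk q == 3) && (blk p == 2)]%N.
    by move: nal; case: p => [[[i|i]|i]|[[i|i]|i]]; case: q => [[[j|j]|j]|[[j|j]|j]].
  case/or4P => /andP[h1 h2]; first exact: z0.
  - by rewrite sk z0 ?oppr0.
  - case: p h1 {nal} => [[[i|i]|i]|[[i|i]|i]] // _; case: q h2 => [[[j|j]|j]|[[j|j]|j]] // _.
  - rewrite sk; case: q h1 {nal} => [[[i|i]|i]|[[i|i]|i]] // _.
    by case: p h2 => [[[j|j]|j]|[[j|j]|j]] // _; rewrite KT oppr0.
case/and3P; rewrite /vec /flip /= => /negPf es /negPf es' lk; subst s s'.
have [z [z' [pz qz lz]]] : exists z z', [/\ p = inl z, q = inl z' &
    ((blk (inl z : shared + own true) < 2)%N || (blk (inl z' : shared + own true) < 2)%N)].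
  by case: p lk => [[[i|i]|i]|[[i|i]|i]] //; case: q => [[[j|j]|j]|[[j|j]|j]] // _; do 2 eexists; split.
subst p q.
have H : aform x (shared_vec z) (shared_vec z') = 0.
  case/orP: lz => h; first by apply: hS; [apply: shS|apply: shS'].
  by rewrite sk; apply/eqP; rewrite oppr_eq0; apply/eqP; apply: hS; [apply: shS|apply: shS'].
rewrite !shared_vec_sum !(aformDl, aformDr) (cross true false) // (cross false true) // in H.
by move/eqP: H; rewrite addr0 add0r addrC addr_eq0 => /eqP.
Qed.


Lemma allowedC : forall x y, allowed x y = allowed y x.
Proof. by move=> x y; rewrite /allowed; do !case: eqP => ? //=. Qed.

Lemma linkedC : forall x y, linked x y = linked y x.
Proof. by move=> x y; rewrite /linked orbCA [(x == 1%N) && _]andbC [in RHS]andbC [(y == 2%N) && _]andbC. Qed.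

Lemma Arel_sym : ssrbool.symmetric Arel.
Proof. by move=> i j; rewrite /Arel eq_sym allowedC. Qed.

Lemma Lrel_sym : ssrbool.symmetric Lrel.
Proof. by move=> i j; rewrite /Lrel andbCA linkedC. Qed.

Lemma Lrel_sub i j : Lrel i j -> Arel i j.
Proof.
case: i j => s p [s' q]; rewrite /Lrel /Arel /= => /and3P[/negPf es /negPf es' lk].
subst s s'; rewrite eqxx /=; move: lk; rewrite /linked /allowed.
by case: (blk p) => [|[|[|k]]] //; case: (blk q) => [|[|[|l]]].
Qed.

Lemma Lrel_flip i j : Lrel i j -> Arel (flip i) (flip j) /\ ~~ Lrel (flip i) (flip j).
Proof.
case: i j => s p [s' q]; rewrite /Lrel /Arel /flip /= => /and3P[/negPf es /negPf es' lk].
subst s s'; case: p lk => [z|[[?|?]|?]] //; case: q => [z'|[[?|?]|?]]; rewrite ?/linked ?andbF //=;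
  by case: z => [[?|?]|?] //; case: z' => [[?|?]|?].
Qed.

Lemma proj_vec s (i : idx) : proj s (vec i) = if tag i == s then vec i else 0.
Proof.
case: i => t p; rewrite /vec /=; case: eqP => [<-|ts].
  by rewrite proj_id // side_vec_mem.
rewrite proj_id' //; have -> : ~~ s = t by case: s t ts {p} => [] [].
exact: side_vec_mem.
Qed.

Lemma vec_coord u : exists c : idx -> F, u = \sum_i c i *: vec i.
Proof.
have : u \in (\sum_(i : idx) <[vec i]>)%VS by rewrite vec_span memvf.
case/memv_sumP => w hw ->.
have hc i : exists c, w i = c *: vec i by have /vlineP[c ->] := hw i isT; exists c.
exists (fun i => projT1 (cid (hc i))); apply: eq_bigr => i _.
exact: projT2 (cid (hc i)).
Qed.

Lemma dim_inL (Ls : {vspace 'M[F]_n}) :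
  (forall x, x \in Ls <-> inL J [:: S; Us true; Us false] x) ->
  \dim Ls = #|{: free_index Arel Lrel}|.
Proof.
move=> hLs.
apply: (dim_coordinates (phi := fun (p : free_index Arel Lrel) x => aform x (vec (val p).1) (vec (val p).2))).
- move=> p a x y; rewrite /aform /bil mulmxDr -scalemxAr !mulmxDl -!scalemxAl.
  by rewrite 2!mxE.
- move=> x /hLs/inL_aform[h1 h2 h3] h.
  have adm := inL_admissible h1 h2 h3.
  have z := admissible_eq0 F2 Arel_sym Lrel_sym (fun i j h => (Lrel_flip h).1)
    (fun i j h => (Lrel_flip h).2) adm h.
  have a0 u w : aform x u w = 0.
    have [c ->] := vec_coord u; have [d ->] := vec_coord w.
    rewrite aform_suml big1 // => i _; rewrite aformZl aform_sumr big1 ?mulr0 // => j _.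
    by rewrite aformZr z mulr0.
  have xJ : x *m J = 0.
    apply/matrixP => i j; rewrite [RHS]mxE -(a0 (delta_mx 0 i) (delta_mx 0 j)).
    rewrite /aform /bil -[_ *m x *m J]mulmxA -rowE trmx_delta -colE.
    by rewrite [RHS]mxE [RHS]mxE.
  by rewrite -[x](mulmxK Ju) xJ mul0mx.
move=> y.
have [X adm hX] := admissible_exists Arel_sym Lrel_sym Lrel_sub (fun i j h => (Lrel_flip h).2) y.
have [Xs XA XL] := adm.
pose XM : 'M[F]_#|idx| := \matrix_(i, j) X (enum_val i) (enum_val j).
have [Q hQ] : exists Q, vec_mx *m Q = 1%:M.
  by exists (pinvmx vec_mx); apply: mulmxVp vec_mx_free.
(* The form with entries [X] in the adapted basis, rewritten in the standard basis; multiplication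
   by the inverse of [J] turns it into an endomorphism. *)
pose M := Q *m XM *m Q^T.
pose x := M *m invmx J.
have xJ : x *m J = M by rewrite mulmxKV.
have MT : M^T = - M.
  rewrite /M !trmx_mul trmxK mulmxA; have -> : XM^T = - XM by apply/matrixP => i j; rewrite !mxE Xs.
  by rewrite mulmxN mulNmx.
have ax i j : aform x (vec i) (vec j) = X i j.
  have e (k : idx) : vec k = row (enum_rank k) vec_mx by rewrite rowK enum_rankK.
  rewrite /aform /bil -mulmxA -mulmxA [x *m _]mulmxA xJ !e.
  have -> : row (enum_rank i) vec_mx *m (M *m (row (enum_rank j) vec_mx)^T) =
     (row (enum_rank i) vec_mx *m M *m vec_mx^T) *m delta_mx (enum_rank j) 0.
    by rewrite [in (row _ _)^T]rowE trmx_mul trmx_delta !mulmxA.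
  rewrite -colE rowE.
  have -> : (delta_mx 0 (enum_rank i) : 'rV[F]_#|idx|) *m vec_mx *m M *m vec_mx^T =
      delta_mx 0 (enum_rank i) *m XM.
    rewrite -!mulmxA; congr (_ *m _); rewrite /M !mulmxA hQ mul1mx -mulmxA.
    by rewrite -trmx_mul hQ trmx1 mulmx1.
  by rewrite -rowE !mxE !enum_rankK.
exists x; last by move=> p; rewrite ax hX.
have sk : forall u w, aform x w u = - aform x u w.
  by apply/skew_aform; rewrite -{2}Jsym -trmx_mul xJ MT addrN.
have hU s : aorth x (Us s) (Us (~~ s)).
  move=> u w uU wU; rewrite -(proj_id uU) -(proj_id wU).
  have [c ->] := vec_coord u; have [d ->] := vec_coord w.
  rewrite !linear_sum aform_suml big1 // => i _; rewrite aform_sumr big1 // => j _.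
  rewrite !linearZ /= aformZl aformZr !proj_vec.
  have z0 u' : aform x 0 u' = 0 by rewrite -(scale0r 0) aformZl mul0r.
  have z0' u' : aform x u' 0 = 0 by rewrite -(scale0r 0) aformZr mul0r.
  case: eqP => [ei|_]; last by rewrite z0 !mulr0.
  case: eqP => [ej|_]; last by rewrite z0' !mulr0.
  rewrite ax XA ?mulr0 // /Arel negb_and; apply/orP; left.
  by apply/eqP => e; move: ej; rewrite -e ei; case: (s).
apply/hLs/inL_aform; split=> //; apply: admissible_inL => //.
have -> : (fun i j => aform x (vec i) (vec j)) = X by apply/funext => i; apply/funext => j; apply: ax.
exact: adm.
Qed.


(** Sums over the basis of quantities depending only on side and block; cardinals of sets of
    positions thereby become polynomials in the block dimensions. *)
Definition weight (f : bool -> nat -> nat) s : nat :=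
  (\dim Rv * f s 0 + \dim Pv * f s 1 + \dim Tv * f s 2 +
   (\dim (Kv s) * f s 3 + \dim (Qv s) * f s 4 + \dim (Lv s) * f s 5))%N.

Lemma sum_idx (f : bool -> nat -> nat) :
  (\sum_(i : idx) f (tag i) (blk (tagged i)) = weight f true + weight f false)%N.
Proof.
rewrite -(sig_big_dep predT (fun _ => predT) (fun s (x : shared + own s) => f s (blk x))) /=.
rewrite big_bool /= /weight.
by congr (_ + _)%N; rewrite !big_sumType /= !sum_nat_const !card_ord.
Qed.

Lemma card_formula : (2 * #|{: free_index Arel Lrel}| +
  \sum_(i : idx) (Arel i i && ~~ Lrel i i) =
  \sum_(i : idx) \sum_(j : idx) (Arel i j && ~~ Lrel i j))%N.
Proof.
have := card_free_index Arel_sym Lrel_sym.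
rewrite -!sum1_card ![in RHS]big_mkcond /= => e.
rewrite (pair_bigA _ (fun i j => (Arel i j && ~~ Lrel i j) : nat)) /=.
move: e; rewrite [X in (_ + X)%N]big_mkcond [X in _ = X -> _]big_mkcond /=.
rewrite (eq_bigr (fun i => (Arel i i && ~~ Lrel i i) : nat)); last by move=> i _; rewrite inE; case: (_ && _).
rewrite [X in _ = X -> _](eq_bigr (fun p => (Arel p.1 p.2 && ~~ Lrel p.1 p.2) : nat)) //.
by move=> i _; rewrite inE; case: (_ && _).
Qed.


Definition free_cell s x s' y : bool :=
  ((s == s') && allowed x y) && ~~ [&& ~~ s, ~~ s' & linked x y].

Lemma card_weight : (2 * #|{: free_index Arel Lrel}| +
    (weight (fun s x => free_cell s x s x) true + weight (fun s x => free_cell s x s x) false) =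
    weight (fun s x => weight (free_cell s x) true + weight (free_cell s x) false) true +
    weight (fun s x => weight (free_cell s x) true + weight (free_cell s x) false) false)%N.
Proof.
rewrite -!sum_idx card_formula; apply: eq_bigr => i _.
by rewrite -sum_idx; apply: eq_bigr => j _.
Qed.

(** On the first side m - 2 k - 2 a is dim P + dim Q and m - 2 k - 2 a - b is dim Q, and likewise on
    the other side. The formula is the count of free positions with T and L removed by duality and Q
    expressed through m and m'. *)
Lemma dim_stab_formula (Ls : {vspace 'M[F]_n}) :
  (forall x, x \in Ls <-> inL J [:: S; Us true; Us false] x) ->
  let m : rat := (\dim (Us true))%:R in let m' : rat := (\dim (Us false))%:R in
  let k : rat := (\dim (Kv true))%:R in let k' : rat := (\dim (Kv false))%:R in
  let a : rat := (\dim Rv)%:R in let b : rat := (\dim Pv)%:R in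
  (\dim Ls)%:R = 1 / 2%:R * (binom2 m + binom2 m' + k ^+ 2 + k' ^+ 2
                      - binom2 (m - 2%:R * k - 2%:R * a)
                      - binom2 (m' - 2%:R * k' - 2%:R * a))
          + binom2 b - a * b
          + binom2 (m - 2%:R * k - 2%:R * a - b)
          + binom2 (m' - 2%:R * k' - 2%:R * a - b).
Proof.
move=> hLs m m' k k' a b.
have [e1 e2 e3 e4 e5] := dim_facts.
have h := card_weight; rewrite -(dim_inL hLs) /weight /free_cell /allowed /linked /= in h.
rewrite !e1 !e2 in h.
rewrite !(muln0, muln1, addn0, add0n) in h.
have h' := congr1 (fun x : nat => x%:R : rat) h; rewrite !(natrD, natrM) /= in h'.
rewrite /m /m' !e4 !(natrD, natrM) -/k -/k' -/a -/b.
rewrite -/k -/k' -/a -/b in h'.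
move: h'; move: ((\dim Ls)%:R : rat) ((\dim (Qv true))%:R : rat) ((\dim (Qv false))%:R : rat).
move: k k' a b => k k' a b D q q'; set X := (X in 2%:R * D + X); set Y := (Y in _ = Y) => h'.
have -> : D = (Y - X) / 2%:R by rewrite -h'; field.
by rewrite /X /Y /binom2; field.
Qed.


Lemma proj_img : ((S + Us false) :&: Us true)%VS = (proj true @: S)%VS.
Proof.
apply/vspaceP => u; rewrite memv_cap; apply/andP/memv_imgP => [[]|[s sS ->]].
  case/memv_addP => s sS [w wW ->] uU; exists s => //.
  by rewrite -[LHS](proj_id uU) linearD /= (@proj_id' true w) // addr0.
split; last exact: proj_mem.
rewrite -[proj true s](addrK (proj false s)) proj_add memv_add //.
by rewrite memvN proj_mem.
Qed.

Lemma bilDr u v w : bil u (v + w) = bil u v + bil u w.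
Proof. by rewrite /bil linearD /= mulmxDr mxE. Qed.

Lemma bil_sides s u w : u \in Us s -> w \in Us (~~ s) -> bil u w = 0.
Proof. by move=> us; rewrite -Uperp => /perpP h; rewrite bil_sym; apply: h. Qed.

(** A vector of U pairs with an element of S through the U-part of that element only. Hence the
    projection of s in S lies in the radical exactly when it lies in S', and then so does the other
    projection, because S is contained in S'. *)
Lemma rad_proj_img : ((proj true @: S) :&: perp (proj true @: S))%VS = (proj true @: Nv)%VS.
Proof.
apply/vspaceP => u; rewrite memv_cap; apply/andP/memv_imgP => [[]|[s sN ->]].
  case/memv_imgP => s sS uE /perpP h; exists s => //.
  have uU : u \in Us true by rewrite uE; apply: proj_mem.
  have uS' : u \in S'.
    apply/perpP => y yS; rewrite -(proj_add y) bilDr h ?memv_img // add0r.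
    by apply: (bil_sides uU); apply: proj_mem.
  rewrite memv_cap sS -(proj_add s) memv_add // memv_cap proj_mem andbT -?uE //.
  have -> : proj false s = s - u by rewrite uE -{2}(proj_add s) addrAC subrr add0r.
  by rewrite memvB // (subvP Siso).
have sS : s \in S by apply: (subvP N_sub).
split; first exact: memv_img.
have uD : proj true s \in Dv true by apply: (subvP (projN_sub true)); apply: memv_img.
apply/perpP => _ /memv_imgP[y yS ->].
have := perpP S (proj true s); rewrite (subvP (capvSl _ _) _ uD) => -[/(_ isT) h _].
have := h y yS; rewrite -{1}(proj_add y) bilDr [X in _ + X](bil_sides (proj_mem true s)) ?addr0 //.
exact: proj_mem.
Qed.

(** Identifies the invariants: modulo the part of S in U the radical has the size of R, and the
    projection modulo its radical has the size of P, so these blocks account for a and b. *)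
Lemma dim_rad : \dim (proj true @: Nv) = (\dim (Kv true) + \dim Rv)%N /\
  \dim (proj true @: S) = (\dim (Kv true) + \dim Rv + \dim Pv)%N.
Proof.
clear F2; have [_ _ e3 _ _] := dim_facts.
have KK0 : (Kv true :&: Kv false)%VS = 0%VS.
  by apply/eqP; rewrite -subv0 -Ucap; apply: capvS; apply: capvSr.
have e1 := dim_diff KK_sub; rewrite (dimv_disjoint_sum KK0) -/Rv in e1.
have := dim_proj true Nv; have := dim_proj true S; rewrite /= -/(Kv false) (N_capU false).
split; lia.
Qed.

End AdaptedBasis.

(** * From the bilinear form to its Gram matrix *)

Section FormInvariance.
Variables (F : closedFieldType) (n : nat) (B : {symmetric 'rV[F]_n}).

Definition gram : 'M[F]_n := matrix_of_form B.

Lemma bil_gram u v : bil gram u v = B u v.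
Proof.
rewrite -(matrix_of_formK B) /form_of_matrix /bil trace_mx11 (_ : (v^T ^ idfun)%sesqui = v^T) //.
by apply/matrixP => i j; rewrite mxE.
Qed.

Lemma form_sym u v : B u v = B v u.
Proof. by rewrite hermC expr0 mul1r. Qed.

Lemma gram_sym : gram^T = gram.
Proof. by apply/matrixP => i j; rewrite !mxE form_sym. Qed.

Lemma gram_unit : nondegenerate B -> gram \in unitmx.
Proof.
move=> ndB; rewrite -row_free_unit -kermx_eq0; apply/rowV0P => u /sub_kermxP u0.
suff : u \in (0%VS : {vspace 'rV[F]_n}) by rewrite memv0 => /eqP.
rewrite -(eqP ndB); apply/mem_orthovP => v _.
by rewrite -bil_gram /bil u0 mul0mx mxE.
Qed.

Lemma orthov_bil (Y : {vspace 'rV[F]_n}) u :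
  u \in orthov B Y <-> forall y, y \in Y -> bil gram u y = 0.
Proof.
split=> [/mem_orthovP h y /h|h]; first by rewrite bil_gram.
by apply/mem_orthovP => y /h; rewrite bil_gram.
Qed.

Lemma gram_isometry g : g *m gram *m g^T = gram <-> forall u v, B (u *m g) (v *m g) = B u v.
Proof.
have e u v : B (u *m g) (v *m g) = (u *m (g *m gram *m g^T) *m v^T) 0 0.
  by rewrite -bil_gram /bil trmx_mul !mulmxA.
split=> [h u v|h]; first by rewrite e h -bil_gram.
apply/matrixP => i j; have := h (delta_mx 0 i) (delta_mx 0 j).
by rewrite e -bil_gram /bil trmx_delta -rowE -rowE -!colE !mxE.
Qed.

Variables U W : {vspace 'rV[F]_n}.
Hypotheses (sumUW : (U + W)%VS = fullv) (orthoUW : (U <= orthov B W)%VS).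

(** Isometries of the two summands add up to an isometry of V because all mixed terms vanish by
    orthogonality. *)
Lemma groupH_inG h : groupH B U W h <-> inG gram [:: U; W] (lin1_mx h).
Proof.
have UW u w : u \in U -> w \in W -> B u w = 0.
  by move=> /(subvP orthoUW)/mem_orthovP; apply.
rewrite -{1}[h]lin1_mxK; set g := lin1_mx h; split.
  move=> [hU hW iU iW]; split; last by move=> X; rewrite !inE => /orP[]/eqP ->.
  have gU u : u \in U -> u *m g \in U by move=> uU; rewrite -hU -fmxE memv_img.
  have gW u : u \in W -> u *m g \in W by move=> uW; rewrite -hW -fmxE memv_img.
  apply/gram_isometry => u v.
  have : u \in (U + W)%VS by rewrite sumUW memvf.
  case/memv_addP => u1 u1U [u2 u2W ->].
  have : v \in (U + W)%VS by rewrite sumUW memvf.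
  case/memv_addP => v1 v1U [v2 v2W ->].
  have := iU u1 v1 u1U v1U; have := iW u2 v2 u2W v2W; rewrite !fmxE => e2 e1.
  rewrite !mulmxDl !(linearDl, linearDr) /= e1 e2 [B (u1 *m g) (v2 *m g)]UW ?gU ?gW //.
  rewrite [B (u2 *m g) _]form_sym [B _ (u2 *m g)]UW ?gU ?gW //.
  by rewrite [B u1 v2]UW // [B u2 v1]form_sym [B v1 u2]UW.
move=> [/gram_isometry h1 h2]; split.
- by apply: h2; rewrite inE eqxx.
- by apply: h2; rewrite !inE eqxx orbT.
- by move=> u v _ _; rewrite !fmxE.
- by move=> u v _ _; rewrite !fmxE.
Qed.

End FormInvariance.

(** * Constancy of the 4-tuple along an orbit *)

Section InvariantsOfImage.
Variables (F : closedFieldType) (n : nat) (B : {symmetric 'rV[F]_n}).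
Variables (U W S0 : {vspace 'rV[F]_n}) (g : 'M[F]_n).
Hypotheses (gu : g \in unitmx) (gi : forall u v, B (u *m g) (v *m g) = B u v).
Hypotheses (gU : (fmx g @: U)%VS = U) (gW : (fmx g @: W)%VS = W).

Let S := (fmx g @: S0)%VS.

Lemma img_cap X Y : (fmx g @: (X :&: Y))%VS = (fmx g @: X :&: fmx g @: Y)%VS.
Proof. exact: lker0_img_cap (lker_fmx gu). Qed.

Lemma img_orthov X : (fmx g @: orthov B X)%VS = orthov B (fmx g @: X)%VS.
Proof.
apply/vspaceP => u; apply/memv_imgP/mem_orthovP => [[w /mem_orthovP h -> _ /memv_imgP[y yX ->]]|h].
  by rewrite !fmxE gi h.
exists (u *m invmx g); last by rewrite fmxE mulmxKV.
apply/mem_orthovP => y yX; rewrite -gi mulmxKV // h // -fmxE memv_img //.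
Qed.

Lemma img_PU : PU U W S = (fmx g @: PU U W S0)%VS.
Proof. by rewrite /PU img_cap limgD gU gW. Qed.

Lemma img_Rad X : Rad B (fmx g @: X)%VS = (fmx g @: Rad B X)%VS.
Proof. by rewrite /Rad img_cap img_orthov. Qed.

(** The 4-tuple is given at a representative of the orbit, while the stabilizer is that of an
    arbitrary point. *)
Lemma img_invariants :
  [/\ inv_rU U S = inv_rU U S0, inv_rW W S = inv_rW W S0,
      inv_a B U W S = inv_a B U W S0 & inv_b B U W S = inv_b B U W S0].
Proof.
have eU : inv_rU U S = inv_rU U S0 by rewrite /inv_rU -{1}gU -img_cap dim_fmx.
have eW : inv_rW W S = inv_rW W S0 by rewrite /inv_rW -{1}gW -img_cap dim_fmx.
split=> //; first by rewrite /inv_a -/(inv_rU U S) -/(inv_rU U S0) eU img_PU img_Rad dim_fmx.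
by rewrite /inv_b img_PU img_Rad !dim_fmx.
Qed.

End InvariantsOfImage.

Theorem theorem4p7 (F : closedFieldType) (charF : 2%N \notin [pchar F])
    (n m r : nat) (m_gt0 : (0 < m)%N) (ltmn : (m < n)%N) (ler : (r <= n./2)%N)
    (B : {symmetric 'rV[F]_n}) (ndB : nondegenerate B)
    (U W : {vspace 'rV[F]_n})
    (sumUW : (U + W)%VS = fullv) (capUW : (U :&: W)%VS = 0%VS)
    (orthoUW : (U <= orthov B W)%VS)
    (dimU : \dim U = m) (dimW : \dim W = (n - m)%N)
    (rU rW a b : nat) (O : set {vspace 'rV[F]_n})
    (hO : orbit_with_invariants B U W r rU rW a b O)
    (S : {vspace 'rV[F]_n}) (hS : O S) :
  exists dO dH dHS : nat,
    [/\ has_dimension (@zariski_closed_Gr F n r) O dO,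
        has_dimension (@zariski_closed_End F n) (groupH B U W) dH &
        has_dimension (@zariski_closed_End F n) (stabH B U W S) dHS] /\
    let qm : rat := m%:R in let qk : rat := n%:R - m%:R in
    let qU : rat := rU%:R in let qW : rat := rW%:R in
    let qa : rat := a%:R in let qb : rat := b%:R in
    [/\ dO%:R = dH%:R - dHS%:R :> rat,
        dH%:R - dHS%:R = binom2 qm + binom2 qk - dHS%:R :> rat &
        dHS%:R =
          1 / 2%:R * (binom2 qm + binom2 qk + qU ^+ 2 + qW ^+ 2
                      - binom2 (qm - 2%:R * qU - 2%:R * qa)
                      - binom2 (qk - 2%:R * qW - 2%:R * qa))
          + binom2 qb - qa * qb
          + binom2 (qm - 2%:R * qU - 2%:R * qa - qb)
          + binom2 (qk - 2%:R * qW - 2%:R * qa - qb) :> rat].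
Proof.
have F2 : (2%:R : F) != 0 by apply: contraNneq charF => h; rewrite inE /= h eqxx.
set J := gram B; have Ju : J \in unitmx := gram_unit ndB; have Js : J^T = J := gram_sym B.
have perpP := orthov_bil B.
have dperp := dim_perp Ju perpP.
pose Us (s : bool) := if s then U else W.
have dW0 : \dim (orthov B W) = m by rewrite dperp dimW subKn // ltnW.
have perpW : orthov B W = U by apply/esym/eqP; rewrite eqEdim orthoUW dW0 dimU /=.
have perpU : orthov B U = W by rewrite -perpW (perpK Ju Js perpP).
have Uperp s : orthov B (Us s) = Us (~~ s) by case: s.
have groupE := groupH_inG sumUW orthoUW.
case: hO => S0 [[dS0 S0iso] [hrU hrW ha hb] OE].
have [h0 h0H h0S] : exists2 h, groupH B U W h & (h @: S0)%VS = S.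
  by move: hS; rewrite OE => -[h hH <-]; exists h.
pose g0 := lin1_mx h0; have g0G : inG J [:: U; W] g0 by apply/groupE.
have g0u := inG_unit Ju g0G.
have h0E : fmx g0 = h0 by apply: lin1_mxK.
have [/gram_isometry g0i g0X] := g0G.
have g0U : (fmx g0 @: U)%VS = U by apply: g0X; rewrite inE eqxx.
have g0W : (fmx g0 @: W)%VS = W by apply: g0X; rewrite !inE eqxx orbT.
have SE : S = (fmx g0 @: S0)%VS by rewrite h0E.
have dS : \dim S = r by rewrite SE dim_fmx.
have Siso : (S <= orthov B S)%VS by rewrite SE -(img_orthov g0u g0i) limgS.
have [e1 e2 e3 e4] := img_invariants S0 g0u g0i g0U g0W.
rewrite -SE hrU hrW ha hb in e1 e2 e3 e4.
have lieE Xs : exists V : {vspace 'M[F]_n}, forall x, x \in V <-> inL J Xs x.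
  apply: exists_vspace; first exact: inL0.
  by move=> c x y; apply: inL_lin.
have [L hL] := lieE [:: U; W]; have [LS hLS] := lieE [:: S; U; W].
(* The zero subspace is always stable, so the dimension of h is the case S = 0 of the formula for
   the stabilizer. *)
have hL0 x : x \in L <-> inL J [:: 0%VS; U; W] x.
  rewrite hL; split=> -[h1 h2]; split=> // X XX; last by apply: h2; rewrite inE XX orbT.
  by move: XX; rewrite inE => /predU1P[->|/h2//]; rewrite limg0 subvv.
have LSL : (\dim LS <= \dim L)%N by apply/dimvS; apply: LS_sub hL hLS.
exists (\dim L - \dim LS)%N, (\dim L), (\dim LS).
have f1 := dim_stab_formula F2 Ju Js perpP sumUW capUW Uperp Siso hLS.
have iso0 : (0 <= orthov B 0)%VS by apply: sub0v.
have f0 := dim_stab_formula F2 Ju Js perpP sumUW capUW Uperp iso0 hL0.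
have k1 : \dim (Kv Us S true) = rU by rewrite -e1.
have k0 : \dim (Kv Us S false) = rW by rewrite -e2.
have PUE : PU U W S = (proj Us true @: S)%VS := proj_img (Us := Us) S sumUW capUW.
have RadE : Rad B (PU U W S) = (proj Us true @: Nv (orthov B) Us S)%VS.
  rewrite PUE; exact: (rad_proj_img (Us := Us) Js perpP sumUW capUW Uperp Siso).
have [d1 d2] := dim_rad (Us := Us) Ju perpP sumUW capUW Uperp Siso.
have Rva : \dim (Rv (orthov B) Us S) = a.
  by rewrite -e3 /inv_a RadE d1 -/(Kv Us S true) addKn.
have Pvb : \dim (Pv (orthov B) Us S) = b.
  by rewrite -e4 /inv_b RadE d1 PUE d2 addKn.
have dimWq : (\dim W)%:R = n%:R - m%:R :> rat by rewrite dimW natrB // ltnW.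
rewrite k1 k0 Rva Pvb /= dimU dimWq in f1.
have f0' : (\dim L)%:R = binom2 (m%:R) + binom2 (n%:R - m%:R) :> rat.
  (* For S = 0 the dimensions of K, R and P add up to 0, so all these blocks are empty. *)
  have [_ _ g3 _ _] := dim_facts (Us := Us) Ju perpP sumUW capUW Uperp iso0.
  move/esym/eqP: g3; rewrite dimv0 !addn_eq0 => /andP[/andP[/andP[/eqP z1 /eqP z2] /eqP z3] /eqP z4].
  by rewrite f0 z1 z2 z3 z4 /= dimU dimWq /binom2; field.
have setE Xs (G : set 'End('rV[F]_n)) : (forall h, G h <-> inG J Xs (lin1_mx h)) ->
    G = [set h | inG J Xs (lin1_mx h)]%classic.
  by move=> h; apply/funext => x; apply/propext; apply: h.
(* The orbit is based at S instead of its given representative, in order that the stabilizer of S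
   enters its dimension. *)
have OS : O = [set (fmx g @: S)%VS | g in inG J [:: U; W]]%classic.
  rewrite OE; apply/seteqP; split=> X /= [].
    move=> h /groupE hG <-; exists (invmx g0 *m lin1_mx h).
      by apply: inGM => //; apply: inGV.
    by rewrite SE -limg_fmxM mulmxA mulmxV // mul1mx lin1_mxK.
  move=> g gG <-; exists (fmx (g0 *m g)); last by rewrite limg_fmxM SE.
  by apply/groupE; rewrite fmxK; apply: inGM.
split; last first.
  split; [by rewrite natrB|by rewrite f0'|].
  exact: f1.
split.
- rewrite OS -dS; split; first exact: orbit_lower hL hLS.
  exact: orbit_upper hL hLS.
- rewrite (setE [:: U; W] (groupH B U W)) //; exact: dim_group.
- rewrite (setE [:: S; U; W] (stabH B U W S)); first exact: dim_group.
  move=> h; rewrite /stabH /= groupE; split=> [[[h1 h2] hS']|[h1 h2]].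
    split=> // X; rewrite inE => /predU1P[->|/h2//].
    by rewrite lin1_mxK.
  split; last by rewrite -{1}[h]lin1_mxK; apply: h2; rewrite inE eqxx.
  by split=> // X XX; apply: h2; rewrite inE XX orbT.
Qed.
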